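(* Let $x_0\in\mathbb{R}^n$, $1\le p<\infty$, and let $\Omega\in L_s(S^{n-1})$, $1<s\le\infty$, be $A_t$-homogeneous of degree zero. Let $T_\Omega^P$ be a parabolic sublinear operator satisfying the size condition $(\ast)$ of the context, bounded on $L_p(\mathbb{R}^n)$ for $p>1$, and bounded from $L_1(\mathbb{R}^n)$ to $WL_1(\mathbb{R}^n)$. Let also, for $s'\le p$, $p\ne1$, the pair $(\varphi_1,\varphi_2)$ satisfy the condition $$\int_r^\infty \frac{\operatorname*{ess\,inf}_{t<\tau<\infty}\varphi_1(x_0,\tau)\,\tau^{\gamma/p}}{t^{\gamma/p+1}}\,dt\le C\,\varphi_2(x_0,r),$$ and for $1<p<s$ the pair $(\varphi_1,\varphi_2)$ satisfy the condition $$\int_r^\infty \frac{\operatorname*{ess\,inf}_{t<\tau<\infty}\varphi_1(x_0,\tau)\,\tau^{\gamma/p}}{t^{\gamma/p-\gamma/s+1}}\,dt\le C\,\varphi_2(x_0,r)\,r^{\gamma/s},$$ where $C$ does not depend on $r$. Then the operator $T_\Omega^P$ is bounded from $LM_{p,\varphi_1,P}^{\{x_0\}}$ to $LM_{p,\varphi_2,P}^{\{x_0\}}$ for $p>1$ and from $LM_{1,\varphi_1,P}^{\{x_0\}}$ to $WLM_{1,\varphi_2,P}^{\{x_0\}}$ for $p=1$. Moreover, for $p>1$ $$\|T_\Omega^Pf\|_{LM_{p,\varphi_2,P}^{\{x_0\}}}\lesssim\|f\|_{LM_{p,\varphi_1,P}^{\{x_0\}}},$$ and for $p=1$ $$\|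T_\Omega^Pf\|_{WLM_{1,\varphi_2,P}^{\{x_0\}}}\lesssim\|f\|_{LM_{1,\varphi_1,P}^{\{x_0\}}}.$$
   Context: Setting: $n\ge2$; $P$ is a real $n\times n$ matrix all of whose eigenvalues have positive real part; $A_t=t^P$ ($t>0$); $\gamma=\operatorname{tr}P$. $\rho$ is a quasi-distance associated with $P$: $\rho(A_tx)=t\rho(x)$ for all $t>0$, $x\in\mathbb{R}^n$; $\rho(0)=0$, $\rho(x-y)=\rho(y-x)\ge0$ and $\rho(x-y)\le k(\rho(x-z)+\rho(y-z))$ with a constant $k$; $dx=\rho^{\gamma-1}d\sigma(w)\,d\rho$, where $\rho=\rho(x)$, $w=A_{\rho^{-1}}x$ and $d\sigma(w)$ is a measure on $\{w:\rho(w)=1\}$; there are positive constants $c_i,\beta_i$ ($i=1,\dots,4$) with $c_1|x|^{\beta_1}\le\rho(x)\le c_2|x|^{\beta_2}$ if $\rho(x)\ge1$, $c_3|x|^{\beta_3}\le\rho(x)\le c_4|x|^{\beta_4}$ if $\rho(x)\le1$, and $\rho(\theta x)\le\rho(x)$ for $0<\theta<1$; similar properties hold for the quasi-distance $\rho^*$ associated with the adjoint $P^*$. $E(x,r)=\{y\in\mathbb{R}^n:\rho(x-y)<r\}$ is the ellipsoid with center $x$ and radius $r$; its Lebesgue measure is $|E(x,r)|=\upsilon_\rho r^\gamma$, where $\upsilon_\rho=|E(0,1)|$. $S^{n-1}$ is the Euclidean unit sphere of $\mathbb{R}^n$ with normalized surface measure. $\Omega$ is a real-valued measurable function on $\mathbb{R}^n$;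 it is $A_t$-homogeneous of degree zero if $\Omega(A_tx)=\Omega(x)$ for all $t>0$ and $x$. $s'=s/(s-1)$ ($s'=1$ if $s=\infty$). Sublinear: $|T(f+g)|\le|Tf|+|Tg|$ (linear operators included). Size condition $(\ast)$: for every $f\in L_1(\mathbb{R}^n)$ with compact support and every $x\notin\operatorname{supp}f$, $$|T_\Omega^Pf(x)|\le c_0\int_{\mathbb{R}^n}\frac{|\Omega(x-y)|}{\rho(x-y)^\gamma}|f(y)|\,dy,$$ with $c_0$ independent of $f$ and $x$. For measurable $D\subseteq\mathbb{R}^n$, $\|f\|_{WL_p(D)}=\sup_{t>0}t\,|\{y\in D:|f(y)|>t\}|^{1/p}$. $\varphi_1,\varphi_2$ are positive measurable functions on $\mathbb{R}^n\times(0,\infty)$. For a positive measurable $\varphi$ on $\mathbb{R}^n\times(0,\infty)$ and $1\le p<\infty$, the parabolic generalized local Morrey space $LM_{p,\varphi,P}^{\{x_0\}}$ consists of $f\in L_p^{loc}(\mathbb{R}^n)$ with $\|f\|_{LM_{p,\varphi,P}^{\{x_0\}}}=\sup_{r>0}\varphi(x_0,r)^{-1}|E(x_0,r)|^{-1/p}\|f\|_{L_p(E(x_0,r))}<\infty$, and the weak space $WLM_{p,\varphi,P}^{\{x_0\}}$ consists of $f\in WL_p^{loc}(\mathbb{R}^n)$ with $\|f\|_{WLM_{p,\varphi,P}^{\{x_0\}}}=\sup_{r>0}\varphi(x_0,r)^{-1}|E(x_0,r)|^{-1/p}\|f\|_{WL_p(E(x_0,r))}<\infty$. $A\lesssim B$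 means $A\le CB$ with a positive constant $C$ independent of appropriate quantities (in particular of $f$).
   Formalization: The second condition on (φ1,φ2) is also imposed for p=1, and s≤p<s' is excluded, as no condition was given there; for f in LM outside L_p, Tf is assumed measurable with |Tf| ≤ limsup_N |T(f·1_{E(0,N)})| a.e., since Tf is otherwise uncontrolled. *)

(* Defs.v *)
From HB Require Import structures.
From mathcomp Require Import all_boot all_order all_algebra.
From mathcomp Require Import all_classical all_reals all_analysis.
From mathcomp Require Import measurable_realfun ess_sup_inf complex.

Set Implicit Arguments.
Unset Strict Implicit.
Unset Printing Implicit Defensive.

Import Order.TTheory GRing.Theory Num.Theory.
Import numFieldNormedType.Exports.

Local Open Scope classical_set_scope.
Local Open Scope ring_scope.

(* R^n is 'cV[R]_n.  Its sigma-algebra is the product one, generated by the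
   coordinates, which for R : realType is the Borel sigma-algebra. *)

Definition measure_matrix_display : measure_display -> measure_display.
Proof. exact. Qed.

Section measurable_matrix.
Context {d} {T : measurableType d} (m n : nat).

Definition mx_cylinder : set (set 'M[T]_(m, n)) :=
  [set A | exists i j,
    preimage_set_system setT (fun M : 'M[T]_(m, n) => M i j) measurable A].

Let mx_set0 : <<s mx_cylinder >> set0.
Proof. exact: sigma_algebra0. Qed.

Let mx_setC A : <<s mx_cylinder >> A -> <<s mx_cylinder >> (~` A).
Proof. exact: sigma_algebraC. Qed.

Let mx_bigcup (F : (set 'M[T]_(m, n))^nat) :
  (forall i, <<s mx_cylinder >> (F i)) -> <<s mx_cylinder >> (\bigcup_i (F i)).
Proof. exact: sigma_algebra_bigcup. Qed.

HB.instance Definition _ := isMeasurable.Build (measure_matrix_display d)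
  'M[T]_(m, n) mx_set0 mx_setC mx_bigcup.

Lemma measurable_mx_coord i j :
  measurable_fun setT (fun M : 'M[T]_(m, n) => M i j).
Proof.
by move=> _ Y mY; rewrite setTI; apply: sub_sigma_algebra; exists i, j, Y;
  rewrite ?setTI.
Qed.

Lemma measurable_fun_mxP d' (S : measurableType d') (f : S -> 'M[T]_(m, n)) :
  (forall i j, measurable_fun setT (fun x => f x i j)) -> measurable_fun setT f.
Proof.
move=> mf; apply: (@measurability _ _ _ _ _ _ mx_cylinder) => //.
move=> _ [_ [i [j [B mB <-]]] <-].
by rewrite setTI; exact: (mf i j measurableT B mB).
Qed.

End measurable_matrix.

Section lebesgue_measure_rn.
Context {R : realType}.

Definition cons_cV n (z : measurableTypeR R * 'cV[R]_n) : 'cV[R]_n.+1 :=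
  @col_mx R 1 n 1 (z.1)%:M z.2.

Lemma measurable_cons_cV n : measurable_fun setT (@cons_cV n).
Proof.
apply: measurable_fun_mxP => i j; rewrite /cons_cV.
case: (split_ordP (i : 'I_(1 + n))) => k ik.
  rewrite (_ : (fun _ => _) = fst) //.
  apply/funext => z; rewrite ik; transitivity ((z.1%:M : 'M[R]_1) k j).
    exact: col_mxEu.
  by rewrite (ord1 k) (ord1 j) mxE eqxx mulr1n.
rewrite (_ : (fun _ => _) = (fun M : 'cV[R]_n => M k j) \o snd).
  by apply: measurableT_comp => //; exact: measurable_mx_coord.
by apply/funext => z; rewrite ik; exact: col_mxEd.
Qed.

Section step.
Variables (n : nat) (mu : {sigma_finite_measure set 'cV[R]_n -> \bar R}).

Definition lebesgue_cons : set 'cV[R]_n.+1 -> \bar R :=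
  pushforward (lebesgue_measure \x mu)%E (@cons_cV n).

Let mpre A : measurable A -> measurable (@cons_cV n @^-1` A).
Proof.
by move=> mA; rewrite -[X in measurable X]setTI; exact: measurable_cons_cV.
Qed.

Let lc0 : lebesgue_cons set0 = 0%E.
Proof. by rewrite /lebesgue_cons /pushforward preimage_set0 measure0. Qed.

Let lc_ge0 A : (0 <= lebesgue_cons A)%E.
Proof. by rewrite /lebesgue_cons /pushforward. Qed.

Let lc_sigma_additive : semi_sigma_additive lebesgue_cons.
Proof.
move=> F mF tF mUF; rewrite /lebesgue_cons /pushforward preimage_bigcup.
apply: measure_semi_sigma_additive.
- by move=> i; exact: mpre.
- apply/trivIsetP => /= i j _ _ ij; rewrite -preimage_setI.
  by move/trivIsetP : tF => /(_ _ _ _ _ ij) ->//; rewrite preimage_set0.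
- by rewrite -preimage_bigcup; exact: mpre.
Qed.

HB.instance Definition _ := isMeasure.Build _ _ _ lebesgue_cons
  lc0 lc_ge0 lc_sigma_additive.

Let lc_sigma_finite : sigma_finite setT lebesgue_cons.
Proof.
have /sigma_finiteP[F [TF ndF Foo]] := sigma_finiteT (@lebesgue_measure R).
have /sigma_finiteP[G [TG ndG Goo]] := sigma_finiteT mu.
pose g (x : 'cV[R]_n.+1) : measurableTypeR R * 'cV[R]_n :=
  (x ord0 ord0, @dsubmx R 1 n 1 x).
have mg : measurable_fun setT g.
  apply: measurable_fun_pair; first exact: measurable_mx_coord.
  apply: measurable_fun_mxP => i j; rewrite (_ : (fun _ => _) =
    (fun x : 'cV[R]_n.+1 => x (rshift 1 i) j)); first exact: measurable_mx_coord.
  by apply/funext => x; rewrite mxE.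
have gK : cancel (@cons_cV n) g.
  case=> a y; rewrite /g /cons_cV /= col_mxKd; congr pair.
  transitivity ((a%:M : 'M[R]_1) ord0 ord0); last by rewrite mxE eqxx mulr1n.
  apply: etrans (col_mxEu a%:M y ord0 ord0).
  by congr (@fun_of_matrix R (1 + n) 1 _ _ _); exact/val_inj.
exists (fun k => g @^-1` (F k `*` G k)).
  apply/esym; rewrite -subTset => x _.
  have [i _ Fi] : (\bigcup_k F k) (g x).1 by rewrite -TF.
  have [j _ Gj] : (\bigcup_k G k) (g x).2 by rewrite -TG.
  exists (maxn i j) => //; split.
    by move: Fi; exact/subsetPset/ndF/leq_maxl.
  by move: Gj; exact/subsetPset/ndG/leq_maxr.
move=> k; have [mF Fk] := Foo k; have [mG Gk] := Goo k; split.
  by rewrite -[X in measurable X]setTI; apply: mg => //; exact: measurableX.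
rewrite /lebesgue_cons /pushforward -comp_preimage (_ : g \o _ = id);
  last exact/funext.
by rewrite preimage_id product_measure1E// lte_mul_pinfty// ge0_fin_numE.
Qed.

HB.instance Definition _ := @Measure_isSigmaFinite.Build _ _ _ lebesgue_cons
  lc_sigma_finite.

End step.

Fixpoint lebesgue_rn (n : nat) :
    {sigma_finite_measure set 'cV[R]_n -> \bar R} :=
  match n with
  | 0 => \d_(0 : 'cV[R]_0)
  | m.+1 => lebesgue_cons (lebesgue_rn m)
  end.

End lebesgue_measure_rn.

Lemma lebesgue_rn_box (R : realType) n (A : 'I_n -> set (measurableTypeR R)) :
  (forall i, measurable (A i)) ->
  lebesgue_rn n [set x : 'cV[R]_n | forall i, A i (x i ord0)] =
  (\prod_(i < n) lebesgue_measure (A i))%E.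
Proof.
elim: n A => [|n IHn] A mA.
  rewrite big_ord0 /= diracE mem_set //= => i; by case: i.
rewrite big_ord_recl /= /lebesgue_cons /pushforward.
rewrite (_ : _ @^-1` _ = A ord0 `*`
    [set x : 'cV[R]_n | forall i, A (lift ord0 i) (x i ord0)]); last first.
  have E0 (z : measurableTypeR R * 'cV[R]_n) : cons_cV z ord0 ord0 = z.1.
    transitivity ((z.1%:M : 'M[R]_1) ord0 ord0); last first.
      by rewrite mxE eqxx mulr1n.
    apply: etrans (col_mxEu z.1%:M z.2 ord0 ord0).
    by congr (@fun_of_matrix R (1 + n) 1 _ _ _); exact/val_inj.
  have ES (z : measurableTypeR R * 'cV[R]_n) i :
      cons_cV z (lift ord0 i) ord0 = z.2 i ord0.
    apply: etrans (col_mxEd z.1%:M z.2 i ord0).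
    by congr (@fun_of_matrix R (1 + n) 1 _ _ _); exact/val_inj.
  apply/seteqP; split => z /=.
    by move=> Az; split => [|i]; rewrite -?E0 -?ES; exact: Az.
  move=> [A0 Az] i; case: (unliftP ord0 i) => [j|] ->; first by rewrite ES.
  by rewrite E0.
have mB : measurable [set x : 'cV[R]_n | forall i, A (lift ord0 i) (x i ord0)].
  rewrite (_ : [set x | _] = \bigcap_(i in [set: 'I_n])
      ((fun x : 'cV[R]_n => x i ord0) @^-1` A (lift ord0 i))); last first.
    by apply/seteqP; split => x /= H i *; exact: H.
  apply: fin_bigcap_measurable => // i _.
  rewrite -[X in measurable X]setTI.
  exact: (@measurable_mx_coord _ R n 1 i ord0 measurableT _ (mA _)).
rewrite product_measure1E//; congr (_ * _)%E.
by apply: (IHn (fun i => A (lift ord0 i))) => i; exact: mA.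
Qed.

Section euclidean.
Context {R : realType} (n : nat).

Definition enorm (x : 'cV[R]_n) : R := Num.sqrt (\sum_i x i ord0 ^+ 2).

Definition eball : set 'cV[R]_n := [set x | enorm x <= 1].

Definition radial (x : 'cV[R]_n) : 'cV[R]_n := (enorm x)^-1 *: x.

Lemma measurable_enorm : measurable_fun setT enorm.
Proof.
rewrite /enorm; apply: (@measurableT_comp _ _ _ _ _ _ (@Num.sqrt R)).
  by apply: continuous_measurable_fun; exact: sqrt_continuous.
apply: measurable_sum => i; apply: measurable_funX; exact: measurable_mx_coord.
Qed.

Lemma measurable_eball : measurable eball.
Proof.
rewrite (_ : eball = enorm @^-1` `]-oo, 1]); last first.
  by apply/seteqP; split => x; rewrite /eball /= in_itv.
by rewrite -[X in measurable X]setTI; apply: measurable_enorm.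
Qed.

Lemma measurable_radial : measurable_fun setT radial.
Proof.
apply: measurable_fun_mxP => i j.
rewrite (_ : (fun _ => _) = (fun x => enorm x `^ (-1) * x i j)); last first.
  by apply/funext => x; rewrite mxE powR_inv1// sqrtr_ge0.
apply: measurable_funM; last exact: measurable_mx_coord.
by apply: (measurableT_comp (measurable_powR _)); exact: measurable_enorm.
Qed.

(* Normalized surface measure of the Euclidean unit sphere, as the cone
   measure: the surface measure of B is, up to a constant, the volume of the
   part of the unit ball lying on the rays through B (radial sends 0 to 0, which
   is negligible in positive dimension). *)
Definition sphere_measure (B : set 'cV[R]_n) : \bar R :=
  ((fine (lebesgue_rn n eball))^-1%:E *
    lebesgue_rn n (eball `&` radial @^-1` B))%E.

Let mpre B : measurable B -> measurable (eball `&` radial @^-1` B).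
Proof.
move=> mB; apply: measurableI; first exact: measurable_eball.
by rewrite -[X in measurable X]setTI; apply: measurable_radial.
Qed.

Let cst_ge0 : (0 <= (fine (lebesgue_rn n eball))^-1%:E)%E.
Proof. by rewrite lee_fin invr_ge0 fine_ge0. Qed.

Let sphere0 : sphere_measure set0 = 0%E.
Proof. by rewrite /sphere_measure preimage_set0 setI0 measure0 mule0. Qed.

Let sphere_ge0 B : (0 <= sphere_measure B)%E.
Proof. exact: mule_ge0. Qed.

Let sphere_sigma_additive : semi_sigma_additive sphere_measure.
Proof.
move=> F mF tF mUF; rewrite /sphere_measure preimage_bigcup setI_bigcupr.
under eq_fun do rewrite -ge0_sume_distrr //.
apply: cvgeZl => //.
apply: measure_semi_sigma_additive => [i|/=|].
- exact: mpre.
- apply/trivIsetP => /= i j _ _ ij; rewrite setIACA -preimage_setI.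
  by move/trivIsetP : tF => /(_ _ _ _ _ ij) ->//; rewrite preimage_set0 setI0.
- by rewrite -setI_bigcupr -preimage_bigcup; exact: mpre.
Qed.

HB.instance Definition _ := isMeasure.Build _ _ _ sphere_measure
  sphere0 sphere_ge0 sphere_sigma_additive.

End euclidean.

Section parabolic.
Context {R : realType} {n : nat}.
Implicit Types (P : 'M[R]_n) (rho Omega : 'cV[R]_n -> R) (f g : 'cV[R]_n -> R).
Implicit Types (phi : 'cV[R]_n -> R -> R) (x y w : 'cV[R]_n) (p r t : R).
Implicit Types (T : ('cV[R]_n -> R) -> ('cV[R]_n -> R)).

Local Notation mu := (lebesgue_rn n).

Definition expmx (M : 'M[R]_n) : 'M[R]_n :=
  \matrix_(i, j) limn (series (fun k => (M ^+ k) i j / k`!%:R)).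

(* dilation P t is the matrix A_t = t^P *)
Definition dilation P t : 'M[R]_n := expmx (ln t *: P).

Definition positive_spectrum P : Prop :=
  forall z : R[i], eigenvalue (map_mx (real_complex R) P) z ->
    0 < complex.Re z.

Record quasi_distance P rho : Prop := QuasiDistance {
  qd_measurable : measurable_fun setT rho ;
  qd_dilation : forall t x, 0 < t -> rho (dilation P t *m x) = t * rho x ;
  qd_0 : rho 0 = 0 ;
  qd_sym : forall x y, rho (x - y) = rho (y - x) ;
  qd_ge0 : forall x, 0 <= rho x ;
  qd_triangle : exists k : R, forall x y z,
    rho (x - y) <= k * (rho (x - z) + rho (y - z)) ;
  qd_polar : exists sigma : {measure set 'cV[R]_n -> \bar R},
    sigma [set w | rho w <> 1] = 0%E /\
    forall h : 'cV[R]_n -> \bar R, measurable_fun setT h ->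
      (forall x, 0 <= h x)%E ->
      (\int[mu]_x h x = \int[lebesgue_measure]_(t in `]0%R, +oo[)
        ((\int[sigma]_w h (dilation P t *m w)) * (t `^ (\tr P - 1))%:E))%E ;
  qd_large : exists c1 c2 b1 b2 : R,
    [/\ 0 < c1, 0 < c2, 0 < b1, 0 < b2 & forall x, 1 <= rho x ->
      c1 * enorm x `^ b1 <= rho x <= c2 * enorm x `^ b2] ;
  qd_small : exists c3 c4 b3 b4 : R,
    [/\ 0 < c3, 0 < c4, 0 < b3, 0 < b4 & forall x, rho x <= 1 ->
      c3 * enorm x `^ b3 <= rho x <= c4 * enorm x `^ b4] ;
  qd_star_shaped : forall (theta : R) x, 0 < theta < 1 ->
    rho (theta *: x) <= rho x
}.

Definition ellipsoid rho x r : set 'cV[R]_n := [set y | rho (x - y) < r].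

Definition dilation_homogeneous0 P Omega : Prop :=
  forall t x, 0 < t -> Omega (dilation P t *m x) = Omega x.

Definition Lp p : set ('cV[R]_n -> R) := [set f | f \in Lfun mu p%:E].

Definition Lp_norm p f : \bar R := 'N[mu]_p%:E[EFin \o f].

Definition Lp_loc p : set ('cV[R]_n -> R) := [set f : 'cV[R]_n -> R |
  measurable_fun setT f /\
  forall K, compact K -> (Lp_norm p (f \_ K) < +oo)%E].

Definition weak_norm p (D : set 'cV[R]_n) f : \bar R :=
  ereal_sup [set (t%:E * mu (D `&` [set y | (t < `|f y|)%R]) `^ (p^-1)%R)%E |
    t in [set t : R | 0 < t]].

Definition weakLp p : set ('cV[R]_n -> R) := [set f : 'cV[R]_n -> R |
  measurable_fun setT f /\ (weak_norm p setT f < +oo)%E].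

Definition weakLp_loc p : set ('cV[R]_n -> R) := [set f : 'cV[R]_n -> R |
  measurable_fun setT f /\
  forall K, compact K -> (weak_norm p K f < +oo)%E].

Definition positive_measurable phi : Prop :=
  measurable_fun ([set: 'cV[R]_n] `*` `]0, +oo[ : set ('cV[R]_n * R))
    (fun z : 'cV[R]_n * R => phi z.1 z.2) /\
  forall x r, 0 < r -> 0 < phi x r.

Definition morrey_weight rho phi p x0 r : R :=
  (phi x0 r)^-1 * fine (mu (ellipsoid rho x0 r)) `^ (- p^-1).

Definition LM_norm rho phi p x0 f : \bar R :=
  ereal_sup [set ((morrey_weight rho phi p x0 r)%:E *
      Lp_norm p (f \_ (ellipsoid rho x0 r)))%E | r in [set r : R | 0 < r]].

Definition LM rho phi p x0 : set ('cV[R]_n -> R) :=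
  [set f : 'cV[R]_n -> R | Lp_loc p f /\ (LM_norm rho phi p x0 f < +oo)%E].

Definition WLM_norm rho phi p x0 f : \bar R :=
  ereal_sup [set ((morrey_weight rho phi p x0 r)%:E *
      weak_norm p (ellipsoid rho x0 r) f)%E | r in [set r : R | 0 < r]].

Definition WLM rho phi p x0 : set ('cV[R]_n -> R) :=
  [set f : 'cV[R]_n -> R | weakLp_loc p f /\ (WLM_norm rho phi p x0 f < +oo)%E].

Definition bounded_operator T (X : set ('cV[R]_n -> R))
    (normX : ('cV[R]_n -> R) -> \bar R) (Y : set ('cV[R]_n -> R))
    (normY : ('cV[R]_n -> R) -> \bar R) : Prop :=
  exists2 C : R, 0 < C & forall f, X f ->
    Y (T f) /\ (normY (T f) <= C%:E * normX f)%E.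

(* The values of T on L_p are functions defined up to null sets, hence the
   almost everywhere inequality. *)
Definition sublinear_on (X : set ('cV[R]_n -> R)) T : Prop :=
  forall f g, X f -> X g ->
    {ae mu, forall x, `|T (f \+ g) x| <= `|T f x| + `|T g x|}.

Definition supp f : set 'cV[R]_n := closure [set y | f y != 0].

Definition size_condition P rho Omega T : Prop :=
  exists2 c0 : R, 0 < c0 & forall f, Lp 1 f -> compact (supp f) ->
    forall x, ~ supp f x ->
      (`|T f x|%:E <= c0%:E * \int[mu]_y
        (`|Omega (x - y)| / rho (x - y) `^ \tr P * `|f y|)%:E)%E.

(* The action of T on the functions of X outside L_p: none of the other
   conditions on T applies to them, and T f is understood as a limit of the
   values of T at truncations of f.  On L_p this inequality follows from
   sublinearity and boundedness (strong or weak). *)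
Definition truncation_extension rho p (X : set ('cV[R]_n -> R)) T : Prop :=
  forall f, X f -> ~ Lp p f ->
    measurable_fun setT (T f) /\
    {ae mu, forall x, (`|T f x|%:E <=
      limn_esup (fun N : nat => `|T (f \_ (ellipsoid rho 0 N%:R)) x|%:E))%E}.

Definition essinf_phi P phi p x0 t : \bar R :=
  ess_inf (mrestr lebesgue_measure (measurable_itv `]t, +oo[))
    (fun tau => (phi x0 tau * tau `^ (\tr P / p))%:E).

End parabolic.

(* Main.v *)
Require Import Defs.
From HB Require Import structures.
From mathcomp Require Import all_boot all_order all_algebra.
From mathcomp Require Import all_classical all_reals all_analysis.
From mathcomp Require Import measurable_realfun ess_sup_inf complex.
From mathcomp Require Import ring lra.

(* Split f into f1, its restriction to the ellipsoid E(x0, 2kr), and the rest,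
   where k is the constant of the quasi-triangle inequality.  On E(x0, r) the
   size condition bounds the contribution of the rest by
     c * \int_{rho(x0 - y) >= 2kr} |Omega(x - y)| |f(y)| rho(x0 - y)^-gamma dy.
   Writing rho^-gamma as an integral of powers of t > rho (Tonelli) turns this
   into \int_{2kr}^oo t^(-gamma-1) \int_{E(x0, t)} |Omega(x - y)| |f(y)| dy dt.
   If s' <= p the inner integral is bounded by Hoelder's inequality; if p < s the
   power mean inequality for the measure |f(y)| rho^(theta-gamma) dy, with
   theta = gamma / s, and Tonelli in (x, y) bound the p-th power over E(x0, r).
   In both cases ||f||_{L_p(E(x0, t))} <= N ess inf_{tau > t} phi_1 tau^(gamma/p)
   and the condition on (phi_1, phi_2) conclude.  The same condition bounds
   ||f1||_p, because ||f||_{L_p(E(x0, t))} is nondecreasing in t.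

   The integrability of Omega is given on the Euclidean sphere whereas polar
   coordinates use an unspecified measure on {rho = 1}.  A Lipschitz change of
   variables along the dilation orbits bounds the volume of a dilation-invariant
   set in the annulus {a < rho < b} by its surface measure on the sphere; hence
   \int_{rho < r} |Omega|^q <= C r^gamma \int_{S^(n-1)} |Omega|^q.

   The pointwise inequality |T f| <= |T f1| + far part holds only almost
   everywhere.  Outside L_p it follows from the truncations of f; for f in L_p
   the remainders f - f_N tend to 0 in L_p, so T(f - f_N) tends to 0 in measure. *)

Set Implicit Arguments.
Unset Strict Implicit.
Unset Printing Implicit Defensive.

Import Order.TTheory GRing.Theory Num.Theory.
Import numFieldNormedType.Exports.

Local Open Scope classical_set_scope.
Local Open Scope ring_scope.

(** * Lebesgue measure on R^n *)

(** The two integral conditions are instances of one: with theta = 0 when s' <= p and theta = gamma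
    / s when p < s, the integral of the weight against t^(-(gamma/p - theta) - 1) is at most C phi_2
    r^theta, and all later estimates depend on theta alone. For p = 1 the first alternative is
    excluded, so the weak estimate always runs with theta = gamma / s.

    The factor 2k makes the centre movable: if rho(x0 - x) < r and rho(x0 - y) >= 2kr, then rho(x0 -
    y) <= 2k rho(x - y). Hence the kernel at x costs at most (2k)^gamma times rho(x0 - y)^-gamma,
    and x stays off the support of the far part.

    The obstacle is that the size condition concerns compactly supported functions and sublinearity
    concerns L_p, whereas f may belong to neither class. The size condition is applied to f on
    bounded sets B_N \ E(x0, 2kr), with a bound that does not depend on N, so that N may be sent to
    infinity or chosen point by point.

    Facts on t^P such as invertibility and bounds for the inverse are read off from rho: homogeneity
    turns statements about dilations into statements about the bounded sets {rho <= c}. *)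

Section rn_measure.
Context {R : realType} {n : nat}.
Implicit Types (x y a : 'cV[R]_n).
Local Notation mu := (lebesgue_rn n).

Lemma coord_le_norm x i : `|x i ord0| <= `|x|.
Proof. by rewrite /Num.norm/= mx_normrE; exact: (le_bigmax _ _ (i, ord0)). Qed.

Lemma norm_le_coord x (e : R) : 0 <= e ->
  (forall i, `|x i ord0| <= e) -> `|x| <= e.
Proof.
move=> e0 xe; rewrite /Num.norm/= mx_normrE; apply/bigmax_leP; split => // -[i j] _.
by rewrite /= (ord1 j); exact: xe.
Qed.

Lemma norm_lt_coord x (e : R) : 0 < e ->
  (forall i, `|x i ord0| < e) -> `|x| < e.
Proof.
move=> e0 xe; rewrite /Num.norm/= mx_normrE; apply/bigmax_ltP; split => // -[i j] _.
by rewrite /= (ord1 j); exact: xe.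
Qed.

Definition rn_box (A : 'I_n -> set R) : set 'cV[R]_n :=
  [set x | forall i, A i (x i ord0)].

Lemma measurable_rn_box (A : 'I_n -> set (measurableTypeR R)) :
  (forall i, measurable (A i)) -> measurable (rn_box A).
Proof.
move=> mA; rewrite (_ : rn_box A = \bigcap_(i in [set: 'I_n])
    ((fun x : 'cV[R]_n => x i ord0) @^-1` A i)); last first.
  by apply/seteqP; split => x /= H i *; exact: H.
apply: fin_bigcap_measurable => // i _.
rewrite -[X in measurable X]setTI.
exact: (@measurable_mx_coord _ R n 1 i ord0 measurableT _ (mA _)).
Qed.

Definition rn_boxes : set (set 'cV[R]_n) :=
  [set B | exists2 A : 'I_n -> set (measurableTypeR R),
    (forall i, measurable (A i)) & B = rn_box A].

Lemma measurable_rn_boxesE : @measurable _ 'cV[R]_n = <<s rn_boxes >>.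
Proof.
apply/seteqP; split.
- apply: smallest_sub; first exact: smallest_sigma_algebra.
  move=> _ [i [j [B mB <-]]]; apply: sub_sigma_algebra.
  exists (fun k => if k == i then B else setT).
    by move=> k; case: ifP.
  rewrite setTI (ord1 j); apply/seteqP; split => [x /= Bx k|x /= /(_ i)].
    by case: eqP => // ->.
  by rewrite eqxx.
- apply: smallest_sub; first exact: sigma_algebra_measurable.
  by move=> _ [A mA ->]; exact: measurable_rn_box.
Qed.

(** The booleans choose which ends of the sides are closed: balls are open cubes, dyadic cells are
    half-open ones. *)
Lemma lebesgue_rn_cube (c : 'I_n -> R) (r : R) (b1 b2 : bool) : 0 <= r ->
  mu (rn_box (fun i => [set` Interval (BSide b1 (c i - r)) (BSide b2 (c i + r))]))
  = ((2 * r) ^+ n)%:E.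
Proof.
move=> r0; apply: etrans (lebesgue_rn_box _) _.
  by move=> i; exact: measurable_itv.
rewrite (eq_bigr (fun=> (2 * r)%:E)) => [|i _].
  by rewrite prodEFin prodr_const card_ord.
rewrite lebesgue_measure_itv/= lte_fin.
have [r1|r1] := ltP 0 r; first by rewrite ifT; [congr EFin; ring|lra].
by rewrite ifF; [congr EFin|]; lra.
Qed.

(** Boxes form a generating family stable under intersection, and the cubes [-k, k]^n have finite
    measure and exhaust the space. *)
Lemma lebesgue_rn_unique (m : {measure set 'cV[R]_n -> \bar R}) :
  (forall A : 'I_n -> set (measurableTypeR R), (forall i, measurable (A i)) ->
    m (rn_box A) = (\prod_(i < n) lebesgue_measure (A i))%E) ->
  forall B, measurable B -> mu B = m B.
Proof.
move=> mE B mB.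
pose g k := rn_box (fun=> `[- k%:R, k%:R]%classic : set R).
apply: (measure_unique rn_boxes g) => //.
- exact: measurable_rn_boxesE.
- move=> _ _ [A mA ->] [A' mA' ->]; exists (fun i => A i `&` A' i).
    by move=> i; exact: measurableI.
  apply/seteqP; split => [x [Ax A'x] i|x H]; first by split.
  by split => i; have [] := H i.
- by move=> k; eexists; last reflexivity; move=> i; exact: measurable_itv.
- apply/seteqP; split => // x _; exists (Num.truncn `|x|).+1 => // i.
  have : `|x i ord0| <= (Num.truncn `|x|).+1%:R.
    apply: le_trans (ltW (truncnS_gt _)).
    exact: coord_le_norm.
  by rewrite /= in_itv/= ler_norml.
- by move=> _ [A mA ->]; rewrite mE//; exact: lebesgue_rn_box.
- move=> k; have E := lebesgue_rn_cube (fun=> 0) true false (ler0n R k).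
  rewrite (_ : g k = rn_box (fun=> [set` Interval (BSide true (0 - k%:R))
      (BSide false (0 + k%:R))])).
    by apply: etrans (congr1 (fun z => z < +oo)%E E) _; exact: ltry.
  by rewrite !add0r.
Qed.

(** The ambient norm of column vectors is the maximum norm, so its balls are cubes. *)
Lemma ball_rn_box x (r : R) : 0 < r ->
  ball x r = rn_box (fun i => `]x i ord0 - r, x i ord0 + r[%classic).
Proof.
move=> r0; rewrite mx_norm_ball; apply/seteqP; split => y /=.
  move=> xyr i; rewrite /= in_itv/=.
  have := le_lt_trans (coord_le_norm (x - y) i) xyr.
  rewrite !mxE ltr_norml; lra.
move=> xy; apply: norm_lt_coord => // i; have := xy i.
by rewrite /= in_itv/= !mxE ltr_norml; lra.
Qed.

Lemma measurable_ball_rn x (r : R) : measurable (ball x r).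
Proof.
have [r0|r0] := ltP 0 r; last by rewrite le0_ball0.
by rewrite ball_rn_box//; apply: measurable_rn_box => i; exact: measurable_itv.
Qed.

Lemma lebesgue_rn_ball x (r : R) : 0 < r -> mu (ball x r) = ((2 * r) ^+ n)%:E.
Proof.
by move=> r0; rewrite ball_rn_box// (lebesgue_rn_cube (fun i => x i ord0))// ltW.
Qed.

(** The sigma-algebra is generated by the coordinates, not by the topology. An open set is the union
    of the countably many balls with rational centre and radius 1/(k+1) that it contains. *)
Lemma open_rn_measurable (U : set 'cV[R]_n) : open U -> measurable U.
Proof.
move=> oU.
pose rc (q : 'cV[rat]_n) : 'cV[R]_n := map_mx ratr q.
pose S (z : 'cV[rat]_n * nat) := if `[< ball (rc z.1) z.2.+1%:R^-1 `<=` U >]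
  then ball (rc z.1) z.2.+1%:R^-1 else set0.
rewrite (_ : U = \bigcup_z S z).
  apply: countable_bigcupT_measurable => [|z].
    exact: countableP.
  by rewrite /S; case: ifP => // _; exact: measurable_ball_rn.
apply/seteqP; split => [x Ux|x [z _]]; last first.
  by rewrite /S; case: asboolP => //; exact.
have /nbhs_ballP[e /= e0 xeU] := open_nbhs_nbhs (conj oU Ux).
have [k ke] : exists k : nat, (k.+1%:R : R)^-1 < e / 2.
  have [k _ /(_ _ (leqnn k))] := near_infty_natSinv_lt (PosNum (divr_gt0 e0 (ltr0Sn R 1))).
  by exists k.
have d0 : 0 < (k.+1%:R : R)^-1 by rewrite invr_gt0.
set d := (k.+1%:R : R)^-1 in ke d0 *.
have /choice[q xq] i : exists q : rat, `|x i ord0 - ratr q| < d.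
  have /rat_in_itvoo[q] : x i ord0 - d < x i ord0 + d by lra.
  by rewrite in_itv/= => xqd; exists q; rewrite ltr_norml; lra.
have xqd : ball (rc (\col_i q i)) d x.
  by apply: ball_sym; rewrite mx_norm_ball; apply: norm_lt_coord => // i; rewrite !mxE.
exists (\col_i q i, k) => //; rewrite /S asboolT// => y yqk.
apply: xeU; apply: (@le_ball _ _ _ (d + d)); first lra.
by apply: ball_triangle yqk; exact: ball_sym.
Qed.

Lemma measurable_compact (K : set 'cV[R]_n) : compact K -> measurable K.
Proof.
move=> cK; rewrite -[K]setCK; apply: measurableC; apply: open_rn_measurable.
apply: closed_openC; apply: compact_closed => //; exact: norm_hausdorff.
Qed.

Section affine.
Variables (b : bool) (a : 'cV[R]_n).

(* Translations and point reflections are treated at once: b = true is the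
   reflection y |-> a - y, b = false the translation y |-> a + y. *)
Definition signed_translation y := a + (-1) ^+ b *: y.

Lemma measurable_signed_translation : measurable_fun setT signed_translation.
Proof.
apply: measurable_fun_mxP => i j.
rewrite (_ : (fun _ => _) = (fun y : 'cV[R]_n => a i j + (-1) ^+ b * y i j)).
  apply: measurable_funD => //; apply: measurable_funM => //.
  exact: measurable_mx_coord.
by apply/funext => y; rewrite !mxE.
Qed.

Lemma lebesgue_signed_translation (c : R) (A : set (measurableTypeR R)) :
  measurable A ->
  lebesgue_measure ((fun y : measurableTypeR R => c + (-1) ^+ b * y) @^-1` A) =
  lebesgue_measure A.
Proof.
move=> mA; pose h (y : measurableTypeR R) : measurableTypeR R := c + (-1) ^+ b * y.
have mh : measurable_fun setT h.
  by apply: measurable_funD => //; apply: measurable_funM.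
apply/esym; apply: (lebesgue_measure_unique (mu := pushforward lebesgue_measure h)) => //.
move=> X [[u v] _ <-] /=; rewrite /pushforward /h.
(* Arbitrary intervals are allowed here because the reflection turns []u, v]] into an interval
   closed at the other end. *)
have E (i j : interval R) : (fun y : R => c + (-1) ^+ b * y) @^-1` [set` i] = [set` j] ->
   ((j.1 < j.2)%E = (i.1 < i.2)%E) -> ((j.2 : \bar R) - j.1 = (i.2 : \bar R) - i.1)%E ->
   lebesgue_measure [set` i] =
   lebesgue_measure ((fun y : R => c + (-1) ^+ b * y) @^-1` [set` i]).
  by move=> -> e1 e2; rewrite !lebesgue_measure_itv e1 e2.
case: b => /= in h mh E *.
- apply: (E _ `[c - v, c - u[).
  + apply/seteqP; split => y /=; rewrite !in_itv/= expr1; lra.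
  + by rewrite /= !lte_fin; apply/idP/idP; lra.
  + by rewrite -!EFinB/=; congr EFin; ring.
- apply: (E _ `]u - c, v - c]).
  + apply/seteqP; split => y /=; rewrite !in_itv/= expr0; lra.
  + by rewrite /= !lte_fin; apply/idP/idP; lra.
  + by rewrite -!EFinB/=; congr EFin; ring.
Qed.

Lemma lebesgue_rn_signed_translation B : measurable B ->
  mu (signed_translation @^-1` B) = mu B.
Proof.
move=> mB; apply/esym.
apply: (lebesgue_rn_unique (m := pushforward mu signed_translation)) => //.
  exact: measurable_signed_translation.
move=> ? A mA; rewrite /= /pushforward.
rewrite (_ : _ @^-1` _ = rn_box (fun i =>
  (fun y : measurableTypeR R => a i ord0 + (-1) ^+ b * y) @^-1` A i)).
  apply: etrans (lebesgue_rn_box _) _.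
    move=> i; rewrite -[X in measurable X]setTI.
    suff mh : measurable_fun setT (fun y : measurableTypeR R =>
        a i ord0 + (-1) ^+ b * y : measurableTypeR R) by exact: mh.
    by apply: measurable_funD => //; apply: measurable_funM.
  by apply: eq_bigr => i _; rewrite lebesgue_signed_translation.
by apply/seteqP; split => y /= Ay i; have := Ay i; rewrite /= !mxE.
Qed.

Lemma ge0_integral_signed_translation (h : 'cV[R]_n -> \bar R) :
  measurable_fun setT h -> (forall y, 0 <= h y)%E ->
  (\int[mu]_y h (signed_translation y) = \int[mu]_y h y)%E.
Proof.
move=> mh h0; have mt := measurable_signed_translation.
transitivity (\int[pushforward mu signed_translation]_y h y)%E.
  by rewrite ge0_integral_pushforward.
by apply: eq_measure_integral => B mB _; exact: lebesgue_rn_signed_translation.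
Qed.

End affine.

Lemma ge0_integral_subr (x : 'cV[R]_n) (h : 'cV[R]_n -> \bar R) :
  measurable_fun setT h -> (forall y, 0 <= h y)%E ->
  (\int[mu]_y h (x - y)%R = \int[mu]_y h y)%E.
Proof.
move=> mh h0; rewrite -(ge0_integral_signed_translation true x mh h0).
by apply: eq_integral => y _; rewrite /signed_translation expr1 scaleN1r.
Qed.

Lemma ge0_integral_subl (y : 'cV[R]_n) (h : 'cV[R]_n -> \bar R) :
  measurable_fun setT h -> (forall y, 0 <= h y)%E ->
  (\int[mu]_x h (x - y)%R = \int[mu]_x h x)%E.
Proof.
move=> mh h0; rewrite -(ge0_integral_signed_translation false (- y) mh h0).
by apply: eq_integral => x _; rewrite /signed_translation expr0 scale1r addrC.
Qed.

End rn_measure.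

(** * Regularity of finite measures on R^n *)

Section regularity.
Context {R : realType} {n : nat}.
Implicit Types (x y : 'cV[R]_n).
Variable m : {measure set 'cV[R]_n -> \bar R}.
Hypothesis moo : (m setT < +oo)%E.

(* For a finite measure the sets that are both outer regular by open sets and
   inner regular by closed ones form a sigma-algebra containing the closed sets. *)
Let regular (B : set 'cV[R]_n) := forall e : R, 0 < e ->
  exists U C, [/\ open U, closed C, C `<=` B, B `<=` U & (m (U `\` C) < e%:E)%E].

Let mfin A : measurable A -> (m A < +oo)%E.
Proof. by move=> mA; apply: le_lt_trans moo; apply: le_measure; rewrite ?inE. Qed.

Let closed_rn_measurable (C : set 'cV[R]_n) : closed C -> measurable C.
Proof.
move=> cC; rewrite -[C]setCK; apply: measurableC; apply: open_rn_measurable.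
exact: closed_openC.
Qed.

Let regularC B : regular B -> regular (~` B).
Proof.
move=> rB e /rB[U [C [oU cC CB BU UC]]]; exists (~` C), (~` U); split.
- exact: closed_openC.
- exact: open_closedC.
- exact: subsetC.
- exact: subsetC.
- by rewrite setDE setCK setIC -setDE.
Qed.

Let decreasing_small (D : nat -> set 'cV[R]_n) (e : R) :
  (forall k, measurable (D k)) -> nonincreasing_seq D ->
  (m (\bigcap_k D k) < e%:E)%E -> exists k, (m (D k) < e%:E)%E.
Proof.
move=> mD niD De.
have cD := nonincreasing_cvg_mu (mfin (mD 0%N)) mD (bigcapT_measurable mD) niD.
have [k _ /(_ _ (leqnn k)) kD] := cD _ (open_ereal_lt' De).
by exists k.
Qed.

(** The open neighbourhoods of radius 1/(k+1) of a closed set decrease to it, so by finiteness of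
    [m] their excess mass tends to 0. *)
Let regular_closed B : closed B -> regular B.
Proof.
move=> cB e e0.
pose U k : set 'cV[R]_n := \bigcup_(x in B) ball x k.+1%:R^-1.
have oU k : open (U k) by apply: bigcup_open => x _; exact: ball_open.
have BU k : B `<=` U k by move=> x Bx; exists x => //; exact: ballxx.
have [||| k Uk] := @decreasing_small (fun k => U k `\` B) e.
- by move=> k; apply: measurableD; [exact: open_rn_measurable|
    exact: closed_rn_measurable].
- apply/nonincreasing_seqP => k; apply/subsetPset; apply: setSD.
  move=> y [x Bx xy]; exists x => //; apply: le_ball xy.
  by rewrite lef_pV2 ?posrE// ler_nat.
- rewrite (_ : \bigcap_k _ = set0) ?measure0 ?lte_fin// -subset0 => y yB.
  have [_] := yB 0%N Logic.I; apply; apply: cB => V /nbhs_ballP[d /= d0 dV].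
  have [k _ /(_ _ (leqnn k)) /= kd] := near_infty_natSinv_lt (PosNum d0).
  have [[x Bx xy] _] := yB k Logic.I; exists x; split => //; apply: dV.
  by apply: ball_sym; apply: le_ball xy; exact: ltW.
- by exists (U k), B; split.
Qed.

(** The k-th set is approximated within e / 2^(k+2). The union of all the inner closed sets need not
    be closed; continuity from above allows keeping finitely many of them at the price of the other
    e / 2. *)
Let regular_bigcup (B : nat -> set 'cV[R]_n) :
  (forall k, regular (B k)) -> regular (\bigcup_k B k).
Proof.
move=> rB e e0.
have /choice[U /choice[C H]] k : exists U C, [/\ open U, closed C, C `<=` B k,
    B k `<=` U & (m (U `\` C) < (e / 2 / (2 ^ k.+1)%:R)%:E)%E].
  by apply: rB; rewrite !divr_gt0// ltr0n expn_gt0.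
have mU k : measurable (U k) by apply: open_rn_measurable; have [] := H k.
have mC k : measurable (C k) by apply: closed_rn_measurable; have [] := H k.
pose F N := \big[setU/set0]_(k < N) C k.
have cF N : closed (F N) by apply: closed_bigsetU => k _; have [] := H k.
have oU : open (\bigcup_k U k) by apply: bigcup_open => k _; have [] := H k.
have [||| N DN] := @decreasing_small (fun N => (\bigcup_k U k) `\` F N) e.
- move=> N; apply: measurableD; first exact: bigcupT_measurable.
  exact: closed_rn_measurable.
- apply/nonincreasing_seqP => N; apply/subsetPset; apply: setDS.
  by rewrite /F big_ord_recr/=; exact: subsetUl.
- apply: (@le_lt_trans _ _ (e / 2)%:E); last by rewrite lte_fin; lra.
  apply: le_trans (epsilon_trick0 xpredT _); last lra.
  apply: (@le_trans _ _ (\sum_(k <oo) m (U k `\` C k))%E).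
    apply: measure_sigma_subadditive.
    + by move=> k; exact: measurableD.
    + apply: bigcapT_measurable => N; apply: measurableD.
        exact: bigcupT_measurable.
      exact: closed_rn_measurable.
    + move=> x xD; have [[k _ Ukx] _] := xD 0%N Logic.I.
      exists k => //; split => // Ckx; have [_] := xD k.+1 Logic.I; apply.
      by rewrite /F big_ord_recr/=; right.
  by apply: lee_nneseries => // k _; have [_ _ _ _ /ltW] := H k.
- exists (\bigcup_k U k), (F N); split => //.
    rewrite /F -bigcup_mkord; apply: bigcup_sub => k _ x Ckx; exists k => //.
    by have [_ _ CB _ _] := H k; exact: CB.
  by move=> x [k _ Bkx]; exists k => //; have [_ _ _ BU _] := H k; exact: BU.
Qed.

Let regular_measurable B : measurable B -> regular B.
Proof.
have sigreg : sigma_algebra setT regular.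
  split; first by apply: regular_closed; exact: closed0.
    by move=> A rA; rewrite setTD; exact: regularC.
  exact: regular_bigcup.
move: B; apply: smallest_sub; first exact: sigreg.
move=> _ [i [j [B mB <-]]]; rewrite setTI.
(* For a fixed entry, the subsets of R with regular preimage form a sigma-algebra, and it contains
   the open intervals. *)
suff : measurable `<=` [set B : set R | regular ((fun M : 'cV[R]_n => M i j) @^-1` B)].
  exact.
have mE : (@measurable _ (measurableTypeR R)) = <<s RGenOpens.G (R:=R) >>.
  exact: RGenOpens.measurableE.
rewrite [X in X `<=` _]mE; apply: smallest_sub.
  split => /=; first by rewrite preimage_set0; have [] := sigreg.
    by move=> A rA; rewrite setTD preimage_setC; exact: regularC.
  by move=> A rA; rewrite preimage_bigcup; exact: regular_bigcup.
move=> _ [u [v ->]] /=; rewrite -[X in regular X]setCK; apply: regularC.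
apply: regular_closed; apply: open_closedC.
apply: open_comp; last exact: interval_open.
by move=> x _; exact: coord_continuous.
Qed.

Lemma rn_outer_regular (B : set 'cV[R]_n) (e : R) : measurable B -> 0 < e ->
  exists U, [/\ open U, B `<=` U & (m (U `\` B) < e%:E)%E].
Proof.
move=> mB /(regular_measurable mB)[U [C [oU cC CB BU UC]]]; exists U; split => //.
apply: le_lt_trans UC; apply: le_measure; rewrite ?inE//; last exact: setDS.
- by apply: measurableD => //; exact: open_rn_measurable.
- by apply: measurableD => //; [exact: open_rn_measurable|exact: closed_rn_measurable].
Qed.

End regularity.

(** * Dyadic cells and the measure of Lipschitz images *)

Section dyadic.
Context {R : realType} {n : nat}.
Implicit Types (x y : 'cV[R]_n) (z w : 'cV[int]_n).
Local Notation mu := (lebesgue_rn n).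

Definition dyadic_cell (k : nat) z : set 'cV[R]_n :=
  rn_box (fun i => [set a : R | (z i ord0)%:~R <= 2 ^+ k * a < (z i ord0 + 1)%:~R]).

Let side k : R := (2 ^+ k)^-1.

Let pow2_gt0 k : 0 < 2 ^+ k :> R. Proof. exact: exprn_gt0. Qed.

(** Centre and half side are made explicit to match [lebesgue_rn_cube]. *)
Let dyadic_cellE k z : dyadic_cell k z = rn_box (fun i =>
  `[(side k * (z i ord0)%:~R + side k / 2) - side k / 2,
    (side k * (z i ord0)%:~R + side k / 2) + side k / 2[%classic).
Proof.
congr rn_box; apply/funext => i; apply/seteqP.
have sk : side k * 2 ^+ k = 1 by rewrite /side mulVf// gt_eqF.
have s0 : 0 < side k by rewrite invr_gt0.
have lo (a b : R) : (b <= 2 ^+ k * a) = (side k * b <= a).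
  by rewrite -(ler_pM2l s0) mulrA sk mul1r.
have hi (a b : R) : (2 ^+ k * a < b) = (a < side k * b).
  by rewrite -(ltr_pM2l s0) mulrA sk mul1r.
split => a /=; rewrite in_itv/= lo hi intrD; lra.
Qed.

Lemma measurable_dyadic_cell k z : measurable (dyadic_cell k z).
Proof.
by rewrite dyadic_cellE; apply: measurable_rn_box => i; exact: measurable_itv.
Qed.

Lemma lebesgue_dyadic_cell k z : mu (dyadic_cell k z) = (side k ^+ n)%:E.
Proof.
have s0 : 0 < side k by rewrite invr_gt0.
rewrite dyadic_cellE (lebesgue_rn_cube (fun i => side k * (z i ord0)%:~R + side k / 2))//.
  by rewrite mulrC divfK.
by rewrite ltW// divr_gt0.
Qed.

Lemma dyadic_cell_diam k z x y :
  dyadic_cell k z x -> dyadic_cell k z y -> `|x - y| <= side k.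
Proof.
move=> zx zy; have s0 : 0 < side k by rewrite invr_gt0.
apply: norm_le_coord; first exact: ltW.
move=> i; move: (zx i) (zy i) => /=; rewrite !mxE !(intrD _ _ 1) => xi yi.
rewrite -(ler_pM2l (pow2_gt0 k)) divff ?gt_eqF//.
rewrite -[X in X * _]gtr0_norm// -normrM ler_norml mulrBr; lra.
Qed.

(** Dyadic cells are nested or disjoint: at scale k the bounds of the coarse cell are integers,
    which a finer cell cannot cross. *)
Lemma dyadic_cell_sub j k w z x : (j <= k)%N ->
  dyadic_cell j w x -> dyadic_cell k z x -> dyadic_cell k z `<=` dyadic_cell j w.
Proof.
move=> jk wx zx y zy i; move: (wx i) (zx i) (zy i) => /=.
rewrite -(subnK jk) exprD; set d := (k - j)%N.
set a := w i ord0; set b := z i ord0 => wxi zxi zyi.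
have d0 := pow2_gt0 d.
have dE : 2 ^+ d = (2 ^+ d)%:~R :> R by rewrite rmorphXn.
have [wx1 wx2] : 2 ^+ d * a%:~R <= 2 ^+ d * 2 ^+ j * x i ord0 /\
    2 ^+ d * 2 ^+ j * x i ord0 < 2 ^+ d * (a + 1)%:~R.
  by rewrite -mulrA ler_pM2l// ltr_pM2l//; exact/andP.
move: zxi => /andP[zx1 zx2].
have ab1 : (2 ^+ d * a <= b)%R.
  rewrite -ltzD1 -(ltr_int R) intrM -dE; exact: le_lt_trans wx1 zx2.
have ab2 : (b < 2 ^+ d * (a + 1))%R.
  rewrite -(ltr_int R) intrM -dE; exact: le_lt_trans zx1 wx2.
move: zyi => /andP[zy1 zy2]; apply/andP; split.
  rewrite -(ler_pM2l d0) mulrA; apply: le_trans zy1.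
  by rewrite dE -intrM ler_int.
rewrite -(ltr_pM2l d0) mulrA; apply: lt_le_trans zy2 _.
by rewrite dE -intrM ler_int lezD1.
Qed.

Lemma dyadic_cell_floor k x :
  dyadic_cell k (\col_i Num.floor (2 ^+ k * x i ord0)) x.
Proof. by move=> i /=; rewrite !mxE floor_itv. Qed.

Lemma dyadic_cell_inj k z w x : dyadic_cell k z x -> dyadic_cell k w x -> z = w.
Proof.
move=> zx wx; apply/colP => i; move: (zx i) (wx i) => /= zi wi.
have lt_int (a b : int) : (a%:~R : R) <= 2 ^+ k * x i ord0 < (a + 1)%:~R ->
    b%:~R <= 2 ^+ k * x i ord0 < (b + 1)%:~R -> (a <= b)%R.
  move=> /andP[ax _] /andP[_ xb]; rewrite -ltzD1 -(ltr_int R).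
  exact: le_lt_trans xb.
by apply/eqP; rewrite eq_le !lt_int.
Qed.

(** Sides are specified for nonempty [Q j] only: an index that does not encode a maximal cell gives
    the empty set. *)
Lemma open_dyadic_partition (U : set 'cV[R]_n) : open U ->
  exists (Q : nat -> set 'cV[R]_n) (s : nat -> R),
    [/\ trivIset setT Q, \bigcup_j Q j = U,
        (forall j, measurable (Q j)) &
        (forall j, Q j !=set0 -> [/\ 0 < s j, mu (Q j) = (s j ^+ n)%:E &
          forall x y, Q j x -> Q j y -> `|x - y| <= s j])].
Proof.
move=> oU.
(* Q enumerates the maximal dyadic cells contained in U. *)
pose D (c : nat * 'cV[int]_n) := dyadic_cell c.1 c.2 `<=` U /\
  forall j w, (j < c.1)%N -> dyadic_cell j w `<=` U ->
    dyadic_cell j w `&` dyadic_cell c.1 c.2 = set0.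
pose Q j : set 'cV[R]_n :=
  if @pickle_inv (nat * 'cV[int]_n)%type j is Some c then
    if `[< D c >] then dyadic_cell c.1 c.2 else set0
  else set0.
pose s j : R := if (@pickle_inv (nat * 'cV[int]_n)%type j) is Some c then side c.1 else 0.
have QP j : Q j !=set0 -> exists2 c, pickle c = j & D c /\ Q j = dyadic_cell c.1 c.2.
  rewrite /Q; have := @pickle_invK (nat * 'cV[int]_n)%type j.
  case: pickle_inv => [c|_ [x]//] /= cj; case: asboolP => [Dc _|_ [x]//].
  by exists c.
exists Q, s; split.
- move=> i j _ _ [x [Qi Qj]].
  have [[k z] /= ik [[/= zU Dz] QiE]] := QP i (ex_intro _ x Qi).
  have [[l w] /= jl [[/= wU Dw] QjE]] := QP j (ex_intro _ x Qj).
  rewrite QiE/= in Qi; rewrite QjE/= in Qj.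
  have [kl|lk|kl] := ltngtP k l.
  + by have /seteqP[/(_ x)] := Dw k z kl zU; case; split.
  + by have /seteqP[/(_ x)] := Dz l w lk wU; case; split.
  + by subst l; rewrite -ik -jl (dyadic_cell_inj Qi Qj).
- apply/seteqP; split => [x [j _ Qx]|x Ux].
    have [c _ [Dc QE]] := QP j (ex_intro _ x Qx).
    by apply: Dc.1; rewrite -QE.
  pose z k : 'cV[int]_n := \col_i Num.floor (2 ^+ k * x i ord0).
  have exk : exists k, `[< dyadic_cell k (z k) `<=` U >].
    have /nbhs_ballP[e /= e0 xeU] := open_nbhs_nbhs (conj oU Ux).
    have [k _ /(_ _ (leqnn k)) /= ke] := near_infty_natSinv_expn_lt (PosNum e0).
    exists k; apply/asboolP => y zy; apply: xeU; rewrite mx_norm_ball/=.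
    apply: le_lt_trans ke. rewrite mul1r.
    exact: (dyadic_cell_diam (@dyadic_cell_floor k x) zy).
  (* The coarsest cell through [x] inside [U] is maximal: a coarser cell in [U] that meets it would
     contain [x] as well. *)
  case: (ex_minnP exk) => k /asboolP zU kmin.
  have Dk : D (k, z k).
    split => //= j w jk wU; apply/seteqP; split => // y [wy zy].
    have wx : dyadic_cell j w x.
      apply: (dyadic_cell_sub (ltnW jk) wy zy); exact: dyadic_cell_floor.
    have : (k <= j)%N; last by rewrite leqNgt jk.
    apply: kmin; apply/asboolP; apply: subset_trans wU.
    apply: (dyadic_cell_sub (leqnn j) wx); exact: dyadic_cell_floor.
  exists (pickle (k, z k)) => //; rewrite /Q pickleK_inv/= asboolT//.
  exact: dyadic_cell_floor.
- move=> j; rewrite /Q; case: pickle_inv => // c; case: ifP => // _.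
  exact: measurable_dyadic_cell.
- move=> j /QP[c jc [_ QE]]; rewrite /s -jc pickleK_inv jc QE; split.
  + by rewrite invr_gt0.
  + exact: lebesgue_dyadic_cell.
  + exact: dyadic_cell_diam.
Qed.

(** Enclose [B] in an open set of almost the same measure and cut that set into dyadic cells. The
    part of [B] in a cell of side s is sent into a ball of radius 2 L s, of measure (4 L s)^n, that
    is (4 L)^n times the measure of the cell. *)
Lemma lebesgue_rn_lipschitz_image (Psi : 'cV[R]_n -> 'cV[R]_n) (L M : R)
    (A B : set 'cV[R]_n) : 0 < L -> measurable A -> measurable B ->
  B `<=` ball 0 M ->
  (forall x y, B x -> B y -> `|Psi x - Psi y| <= L * `|x - y|) ->
  A `<=` Psi @` B ->
  (mu A <= ((4 * L) ^+ n)%:E * mu B)%E.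
Proof.
move=> L0 mA mB BM lipPsi AB.
have [M0|M0] := ltP 0 M; last first.
  suff -> : A = set0 by rewrite measure0 mule_ge0// lee_fin exprn_ge0// mulr_ge0// ltW.
  rewrite -subset0 => a /AB[x /BM]; by rewrite le0_ball0.
pose K := ball (0 : 'cV[R]_n) M.
(* Outer regularity holds for finite measures, hence the restriction of [mu] to a ball that contains
   [B]. *)
have mK : measurable K by exact: measurable_ball_rn.
have muK : (mrestr mu mK setT < +oo)%E.
  by rewrite /mrestr setTI lebesgue_rn_ball// ltry.
have C0 : 0 < (4 * L) ^+ n by rewrite exprn_gt0// mulr_gt0.
apply/lee_addgt0Pr => e e0.
have eC0 : 0 < e / (4 * L) ^+ n by rewrite divr_gt0.
have [V [oV BV VB]] := rn_outer_regular muK mB eC0.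
have mV := open_rn_measurable oV.
have oU : open (V `&` K) by apply: openI => //; exact: ball_open.
have [Q [s [tQ QU mQ Qs]]] := open_dyadic_partition oU.
have /choice[W HW] j : exists W : set 'cV[R]_n, [/\ measurable W,
    (mu W <= ((4 * L) ^+ n)%:E * mu (Q j))%E & Psi @` (B `&` Q j) `<=` W].
  have [[x [Bx Qx]]|BQ0] := pselect ((B `&` Q j) !=set0); last first.
    exists set0; split => //.
      by rewrite measure0 mule_ge0// lee_fin ltW.
    by move=> a [x BQx _]; apply: BQ0; exists x.
  have [s0 muQ Qd] := Qs j (ex_intro _ x Qx).
  have Ls : 0 < L * s j by rewrite mulr_gt0.
  (* Balls are open and the bound L s may be attained, whence the factor 2. *)
  exists (ball (Psi x) (2 * (L * s j))); split.
  - exact: measurable_ball_rn.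
  - rewrite lebesgue_rn_ball ?mulr_gt0// muQ -EFinM lee_fin -exprMn.
    by rewrite le_eqVlt; apply/orP; left; apply/eqP; congr (_ ^+ _); ring.
  - move=> _ [y [By Qy] <-]; rewrite mx_norm_ball/=.
    apply: (@le_lt_trans _ _ (L * s j)); last by rewrite ltr_pMl// ltr1n.
    by apply: le_trans (lipPsi _ _ Bx By) _; rewrite ler_pM2l//; exact: Qd.
apply: (@le_trans _ _ (\sum_(j <oo) mu (W j))%E).
  apply: measure_sigma_subadditive => //.
    by move=> j; have [] := HW j.
  move=> a /AB[x Bx xa].
  have [j _ Qx] : (\bigcup_j Q j) x by rewrite QU; split; [exact: BV|exact: BM].
  by exists j => //; have [_ _] := HW j; apply; exists x.
apply: (@le_trans _ _ (\sum_(j <oo) ((4 * L) ^+ n)%:E * mu (Q j))%E).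
  by apply: lee_nneseries => // j _; have [] := HW j.
rewrite nneseriesZl//.
have -> : (\sum_(j <oo) mu (Q j) = mu (V `&` K))%E.
  rewrite -QU; apply/cvg_lim => //; apply: measure_semi_sigma_additive => //.
  exact: bigcupT_measurable.
have VK : (mu (V `&` K) <= mu B + (e / (4 * L) ^+ n)%:E)%E.
  apply: (@le_trans _ _ (mu (B `|` ((V `\` B) `&` K)))).
    apply: le_measure; rewrite ?inE.
    - exact: measurableI.
    - apply: measurableU => //; apply: measurableI => //; exact: measurableD.
    - by move=> x [Vx Kx]; have [Bx|nBx] := pselect (B x); [left|right].
  apply: le_trans (measureU2 _ _ _) _ => //.
    by apply: measurableI => //; exact: measurableD.
  by rewrite leeD2l// ltW.
apply: (@le_trans _ _ (((4 * L) ^+ n)%:E * (mu B + (e / (4 * L) ^+ n)%:E))%E).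
  by rewrite lee_pmul2l ?lte_fin.
by rewrite ge0_muleDr ?lee_fin ?(ltW eC0)// -EFinM mulrCA divff ?gt_eqF// mulr1.
Qed.

End dyadic.

(** * Geometry of the dilations and of the quasi-distance *)

Section exponential_lipschitz.
Context {R : realType} {n : nat}.
Implicit Types (P : 'M[R]_n).

(** An entry of a product is a sum of n terms, so each further power costs the factor n |P|. *)
Lemma exprmx_coord_le P (c : R) : 1 <= c -> n%:R * `|P| <= c ->
  forall k i j, `|(P ^+ k) i j| <= c ^+ k.
Proof.
move=> c1 Pc; elim=> [i j|k IH i j].
  by rewrite expr0 mxE; case: eqP; rewrite ?normr1 ?normr0.
rewrite exprSr mxE; apply: le_trans (ler_norm_sum _ _ _) _.
apply: (@le_trans _ _ (\sum_(l < n) c ^+ k * `|P|)).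
  apply: ler_sum => l _; rewrite normrM ler_pM//.
  by rewrite /Num.norm/= mx_normrE; exact: (le_bigmax _ _ (l, j)).
rewrite sumr_const card_ord exprSr -mulrnAr; apply: ler_wpM2l.
  by rewrite exprn_ge0// (le_trans _ c1).
by move: Pc; rewrite mulr_natl.
Qed.

Lemma subrXX_le (u v B : R) k : `|u| <= B -> `|v| <= B ->
  `|u ^+ k.+1 - v ^+ k.+1| <= `|u - v| * (k.+1%:R * B ^+ k).
Proof.
move=> uB vB; rewrite subrXX normrM ler_wpM2l//.
apply: le_trans (ler_norm_sum _ _ _) _.
apply: (@le_trans _ _ (\sum_(i < k.+1) B ^+ k)).
  apply: ler_sum => i _; rewrite normrM !normrX/=.
  rewrite -[in leRHS](subnK (ltn_ord i : (i <= k)%N)) exprD.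
  by rewrite ler_pM ?exprn_ge0// lerXn2r ?nnegrE// (le_trans _ uB).
by rewrite sumr_const card_ord mulr_natl.
Qed.

Lemma is_cvg_exp_series (a : nat -> R) (c u : R) : 0 <= c ->
  (forall k, `|a k| <= c ^+ k) -> cvgn (series (fun k => a k * u ^+ k / k`!%:R)).
Proof.
move=> c0 ac; apply: normed_cvg.
apply: (@series_le_cvg _ _ (exp_coeff (c * `|u|))) => [k|k|k|].
- exact: normr_ge0.
- by apply: exp_coeff_ge0; rewrite mulr_ge0.
- rewrite /exp_coeff/= !normrM normrX [X in _ * X]ger0_norm ?invr_ge0//.
  by rewrite exprMn ler_wpM2r ?invr_ge0// ler_wpM2r// exprn_ge0.
- exact: is_cvg_series_exp_coeff.
Qed.

(** The constant terms cancel, and |u^(k+1) - v^(k+1)| <= (k+1) B^k |u - v| turns 1 / (k+1)! into 1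
    / k!, so the differences are again dominated by an exponential series. *)
Lemma exp_series_lipschitz (a : nat -> R) (c B u v : R) : 0 <= c ->
  (forall k, `|a k| <= c ^+ k) -> `|u| <= B -> `|v| <= B ->
  `|limn (series (fun k => a k * u ^+ k / k`!%:R)) -
    limn (series (fun k => a k * v ^+ k / k`!%:R))| <= c * expR (c * B) * `|u - v|.
Proof.
move=> c0 ac uB vB; have B0 : 0 <= B by exact: le_trans uB.
set S := fun w => series (fun k => a k * w ^+ k / k`!%:R).
have cS w : cvgn (S w) by exact: is_cvg_exp_series ac.
have cSB : cvgn (S u \- S v) by exact: is_cvgB.
rewrite -/(S u) -/(S v) -limB// -lim_norm//.
apply: limr_le; first exact: is_cvg_norm.
near=> N.
have [M ->] : exists M, N = M.+1.
  by exists N.-1; rewrite prednK//; near: N; exact: nbhs_infty_gt.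
rewrite (_ : _ M.+1 = S u M.+1 - S v M.+1)// /S /series /= !big_nat_recl//=.
rewrite !expr0 opprD addrACA subrr add0r -sumrB.
apply: le_trans (ler_norm_sum _ _ _) _.
apply: (@le_trans _ _ (c * `|u - v| * series (exp_coeff (c * B)) M)).
  rewrite /series/= mulr_sumr; apply: ler_sum => k _.
  rewrite -mulrBl -mulrBr !normrM [X in _ * X]ger0_norm ?invr_ge0//.
  apply: (@le_trans _ _ (c ^+ k.+1 * (`|u - v| * (k.+1%:R * B ^+ k)) / k.+1`!%:R)).
    by rewrite ler_wpM2r ?invr_ge0// ler_pM//; exact: subrXX_le.
  rewrite le_eqVlt; apply/orP; left; apply/eqP.
  rewrite /exp_coeff/= factS natrM invfM exprMn exprS; set f := (k`!%:R)^-1.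
  have k0 : k.+1%:R != 0 :> R by rewrite pnatr_eq0.
  by field; rewrite addrC natr1.
rewrite mulrAC ler_wpM2r// ler_wpM2l// /expR.
apply: nondecreasing_cvgn_le; last exact: is_cvg_series_exp_coeff.
apply/nondecreasing_seqP => k; rewrite /series/= big_nat_recr//= lerDl.
by apply: exp_coeff_ge0; rewrite mulr_ge0.
Unshelve. all: by end_near. Qed.

Lemma expmxZ_lipschitz P (B : R) : exists2 K : R, 0 < K &
  forall u v i j, `|u| <= B -> `|v| <= B ->
    `|expmx (u *: P) i j - expmx (v *: P) i j| <= K * `|u - v|.
Proof.
pose c := 1 + n%:R * `|P|.
have c1 : 1 <= c by rewrite lerDl mulr_ge0.
have Pc : n%:R * `|P| <= c by rewrite lerDr.
exists (c * expR (c * B)).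
  by rewrite mulr_gt0 ?expR_gt0//; exact: lt_le_trans c1.
move=> u v i j uB vB.
have pw w k : (w *: P) ^+ k = w ^+ k *: P ^+ k.
  elim: k => [|k IH]; first by rewrite !expr0 scale1r.
  rewrite !exprS IH -[LHS]/(mulmx (w *: P) (w ^+ k *: P ^+ k)).
  by rewrite -scalemxAl -scalemxAr scalerA.
have E w : expmx (w *: P) i j = limn (series (fun k => (P ^+ k) i j * w ^+ k / k`!%:R)).
  rewrite mxE; congr (limn (series _)); apply/funext => k.
  by rewrite pw mxE (mulrC (w ^+ k)).
rewrite !E; apply: exp_series_lipschitz => //; first exact: le_trans c1.
by move=> k; exact: exprmx_coord_le.
Qed.

Lemma ln_lipschitz (a s t : R) : 0 < a -> a <= s -> a <= t ->
  `|ln s - ln t| <= a^-1 * `|s - t|.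
Proof.
move=> a0; wlog st : s t / s <= t => [H|] as_ at_.
  by have [/H|/ltW/H] := leP s t; [|rewrite distrC (distrC s)]; apply.
have s0 : 0 < s by exact: lt_le_trans as_.
have t0 : 0 < t by exact: lt_le_trans at_.
rewrite distrC (distrC s) !ger0_norm ?subr_ge0 ?ler_ln ?posrE//.
rewrite -ln_div ?posrE//.
have -> : t / s = 1 + (t - s) / s by rewrite mulrBl divff ?gt_eqF// addrC subrK.
apply: (@le_trans _ _ ((t - s) / s)).
  by rewrite le_ln1Dx// (@lt_le_trans _ _ 0)// divr_ge0 ?subr_ge0// ltW.
by rewrite mulrC ler_wpM2r ?subr_ge0// lef_pV2 ?posrE.
Qed.

Lemma dilation_lipschitz P (a b : R) : 0 < a -> exists2 K : R, 0 < K &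
  forall s t i j, a <= s <= b -> a <= t <= b ->
    `|dilation P s i j - dilation P t i j| <= K * `|s - t|.
Proof.
move=> a0; have [K K0 HK] := expmxZ_lipschitz P (`|ln a| + `|ln b|).
exists (K * a^-1); first by rewrite mulr_gt0// invr_gt0.
have lnB s : a <= s <= b -> `|ln s| <= `|ln a| + `|ln b|.
  move=> /andP[as_ sb]; have s0 := lt_le_trans a0 as_.
  have : ln a <= ln s by rewrite ler_ln ?posrE.
  have : ln s <= ln b by rewrite ler_ln ?posrE// (lt_le_trans s0).
  have := ler_norm (ln b); have := ler_norm (- ln a); rewrite normrN.
  have := normr_ge0 (ln b); have := normr_ge0 (ln a).
  by move=> ????? ?; rewrite ler_norml; apply/andP; split; lra.
move=> s t i j sab tab; rewrite /dilation.
apply: le_trans (HK _ _ _ _ (lnB s sab) (lnB t tab)) _.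
rewrite -mulrA ler_wpM2l ?(ltW K0)//; apply: ln_lipschitz => //.
  by case/andP : sab.
by case/andP : tab.
Qed.

End exponential_lipschitz.

(** * The Euclidean norm compared with the maximum norm *)

Section enorm_theory.
Context {R : realType} {n : nat}.
Implicit Types (x y : 'cV[R]_n).

Lemma enorm_ge0 x : 0 <= enorm x. Proof. exact: sqrtr_ge0. Qed.

Lemma sqr_enorm x : enorm x ^+ 2 = \sum_i x i ord0 ^+ 2.
Proof. by rewrite sqr_sqrtr// sumr_ge0// => i _; exact: sqr_ge0. Qed.

Lemma coord_le_enorm x i : `|x i ord0| <= enorm x.
Proof.
rewrite -sqrtr_sqr ler_sqrt; last by rewrite sumr_ge0// => j _; exact: sqr_ge0.
by rewrite (bigD1 i)//= lerDl sumr_ge0// => j _; exact: sqr_ge0.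
Qed.

Lemma norm_le_enorm x : `|x| <= enorm x.
Proof. by apply: norm_le_coord; [exact: enorm_ge0|exact: coord_le_enorm]. Qed.

Lemma enorm_le_norm x : enorm x <= n%:R * `|x|.
Proof.
rewrite -[leRHS]ger0_norm ?mulr_ge0// -sqrtr_sqr ler_wsqrtr//.
apply: (@le_trans _ _ (\sum_(i < n) `|x| ^+ 2)).
  by apply: ler_sum => i _; rewrite -(real_normK (num_real (x i _))) lerXn2r ?nnegrE ?coord_le_norm.
rewrite sumr_const card_ord exprMn -[leLHS]mulr_natl ler_wpM2r ?sqr_ge0//.
by rewrite -natrX ler_nat; case: (n) => // m; rewrite expnS expn1 leq_pmulr.
Qed.

Lemma enormZ (a : R) x : enorm (a *: x) = `|a| * enorm x.
Proof.
rewrite /enorm -sqrtr_sqr -sqrtrM ?sqr_ge0// mulr_sumr.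
by congr Num.sqrt; apply: eq_bigr => i _; rewrite mxE exprMn.
Qed.

Lemma enorm_eq0 x : enorm x = 0 -> x = 0.
Proof.
by move=> x0; apply/eqP; rewrite -normr_le0 -x0 norm_le_enorm.
Qed.

Lemma enorm_distance x y : `|enorm x - enorm y| <= n%:R * `|x - y|.
Proof.
have [xy0|xy0] := ltP 0 (enorm x + enorm y); last first.
  have := enorm_ge0 x; have := enorm_ge0 y => y0 x0.
  have -> : enorm x - enorm y = 0 by lra.
  by rewrite normr0 mulr_ge0.
rewrite -(ler_pM2r xy0) -[X in `|_| * X]gtr0_norm// -normrM -subr_sqr.
rewrite !sqr_enorm -sumrB; apply: le_trans (ler_norm_sum _ _ _) _.
apply: (@le_trans _ _ (\sum_(i < n) `|x - y| * (enorm x + enorm y))).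
  apply: ler_sum => i _; rewrite subr_sqr normrM ler_pM//.
    by apply: le_trans (coord_le_norm _ i); rewrite !mxE.
  by apply: le_trans (ler_normD _ _) _; rewrite lerD ?coord_le_enorm.
by rewrite sumr_const card_ord -mulrnAl mulr_natl.
Qed.

End enorm_theory.

Lemma powR_le_root (R : realType) (a b c : R) : 0 <= a -> 0 < b ->
  a `^ b <= c -> a <= c `^ b^-1.
Proof.
move=> a0 b0 ab; have c0 : 0 <= c by apply: le_trans ab; exact: powR_ge0.
rewrite -[leLHS]powRr1// -(mulfV (lt0r_neq0 b0)) powRrM ge0_ler_powR ?nnegrE//.
  by rewrite invr_ge0 ltW.
exact: powR_ge0.
Qed.

Lemma powR_lt_root (R : realType) (a b c : R) : 0 <= a -> 0 < b -> 0 <= c ->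
  a < c `^ b^-1 -> a `^ b < c.
Proof.
move=> a0 b0 c0 ac.
rewrite -[ltRHS]powRr1// -(mulVf (lt0r_neq0 b0)) powRrM gt0_ltr_powR ?nnegrE//.
exact: powR_ge0.
Qed.

(** * Size of the quasi-distance and invertibility of the dilations *)

Section quasi_distance_theory.
Context {R : realType} {n : nat}.
Variables (P : 'M[R]_n) (rho : 'cV[R]_n -> R).
Hypothesis hrho : quasi_distance P rho.
Implicit Types (x y : 'cV[R]_n).

(** On the sphere every power of the norm is 1, so the bounds for large and for small [rho] reduce
    to their constants; the minimum and maximum with 1 cover both regimes. *)
Lemma quasi_distance_sphere_bounds : exists a b : R, [/\ 0 < a, 0 < b &
  forall x, enorm x = 1 -> a <= rho x <= b].
Proof.
have [c1 [c2 [b1 [b2 [c10 c20 b10 b20 rl]]]]] := qd_large hrho.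
have [c3 [c4 [b3 [b4 [c30 c40 b30 b40 rs]]]]] := qd_small hrho.
exists (Num.min 1 c3), (Num.max 1 c2); split.
- by rewrite lt_min ltr01.
- by rewrite lt_max ltr01.
- move=> x x1; rewrite ge_min le_max.
  have [r1|/ltW r1] := leP 1 (rho x).
    by have := rl x r1; rewrite x1 !powR1 !mulr1 => /andP[_ ->]; rewrite orbT.
  by have := rs x r1; rewrite x1 !powR1 !mulr1 => /andP[-> _]; rewrite r1 orbT.
Qed.

Lemma quasi_distance_bounded (r : R) : exists2 K : R, 0 < K &
  forall x, rho x <= r -> enorm x <= K.
Proof.
have [c1 [c2 [b1 [b2 [c10 c20 b10 b20 rl]]]]] := qd_large hrho.
have [c3 [c4 [b3 [b4 [c30 c40 b30 b40 rs]]]]] := qd_small hrho.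
have K1 := powR_ge0 (r / c1) b1^-1; have K2 := powR_ge0 (1 / c3) b3^-1.
exists (1 + (r / c1) `^ b1^-1 + (1 / c3) `^ b3^-1).
  by rewrite -addrA ltr_pwDl// addr_ge0.
move=> x xr; have [r1|/ltW r1] := leP 1 (rho x).
  have /andP[+ _] := rl x r1.
  rewrite mulrC -ler_pdivlMr// => /(powR_le_root (enorm_ge0 x) b10) xK.
  have : (rho x / c1) `^ b1^-1 <= (r / c1) `^ b1^-1.
    apply: ge0_ler_powR; rewrite ?nnegrE ?invr_ge0 ?(ltW b10)//.
    - by rewrite divr_ge0 ?(ltW c10)// (qd_ge0 hrho).
    - by rewrite divr_ge0 ?(ltW c10)// (le_trans _ xr)// (qd_ge0 hrho).
    - by rewrite ler_wpM2r// invr_ge0 ltW.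
  lra.
have /andP[+ _] := rs x r1.
rewrite mulrC -ler_pdivlMr// => /(powR_le_root (enorm_ge0 x) b30) xK.
have : (rho x / c3) `^ b3^-1 <= (1 / c3) `^ b3^-1.
  apply: ge0_ler_powR; rewrite ?nnegrE ?invr_ge0 ?(ltW b30)//.
  - by rewrite divr_ge0 ?(ltW c30)// (qd_ge0 hrho).
  - by rewrite divr_ge0 ?(ltW c30).
  - by rewrite ler_wpM2r// invr_ge0 ltW.
lra.
Qed.

Lemma quasi_distance_small (e : R) : 0 < e -> exists2 d : R, 0 < d &
  forall x, enorm x < d -> rho x < e.
Proof.
move=> e0.
have [c1 [c2 [b1 [b2 [c10 c20 b10 b20 rl]]]]] := qd_large hrho.
have [c3 [c4 [b3 [b4 [c30 c40 b30 b40 rs]]]]] := qd_small hrho.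
(* The first term forces c2 |x|^b2 < 1, which rules out rho x >= 1; the second gives c4 |x|^b4 <
   e. *)
exists (Num.min (c2^-1 `^ b2^-1) ((e / c4) `^ b4^-1)).
  by rewrite lt_min !powR_gt0 ?invr_gt0 ?divr_gt0.
move=> x; rewrite lt_min => /andP[x2 x4].
have {}x2 := powR_lt_root (enorm_ge0 x) b20 (ltW (_ : 0 < c2^-1)) x2.
have {}x4 := powR_lt_root (enorm_ge0 x) b40 (ltW (divr_gt0 e0 c40)) x4.
have [r1|/ltW r1] := leP 1 (rho x).
  have /andP[_] := rl x r1; have := x2; rewrite invr_gt0 => /(_ c20).
  rewrite -(ltr_pM2l c20) divff ?gt_eqF//; lra.
have /andP[_] := rs x r1; move: x4; rewrite ltr_pdivlMr// mulrC; lra.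
Qed.

Lemma enorm_small (e : R) : 0 < e -> exists2 r : R, 0 < r &
  forall x, rho x <= r -> enorm x < e.
Proof.
move=> e0.
have [c3 [c4 [b3 [b4 [c30 c40 b30 b40 rs]]]]] := qd_small hrho.
have eb : 0 < c3 * e `^ b3 by rewrite mulr_gt0// powR_gt0.
exists (Num.min 1 (c3 * e `^ b3 / 2)); first by rewrite lt_min ltr01 divr_gt0.
move=> x; rewrite le_min => /andP[x1 x2]; have /andP[x3 _] := rs x x1.
rewrite ltNge; apply/negP => ex.
have : c3 * e `^ b3 <= c3 * enorm x `^ b3.
  by rewrite ler_pM2l// ge0_ler_powR ?nnegrE ?(ltW b30) ?(ltW e0) ?enorm_ge0.
lra.
Qed.

Lemma enorm_large : exists2 r : R, 0 < r & forall x, r <= rho x -> 1 < enorm x.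
Proof.
have [c1 [c2 [b1 [b2 [c10 c20 b10 b20 rl]]]]] := qd_large hrho.
exists (Num.max 1 (2 * c2)); first by rewrite lt_max ltr01.
move=> x; rewrite ge_max => /andP[x1 x2]; have /andP[_ x3] := rl x x1.
rewrite ltNge; apply/negP => xe1.
have : c2 * enorm x `^ b2 <= c2 * 1 `^ b2.
  by rewrite ler_pM2l// ge0_ler_powR ?nnegrE ?(ltW b20) ?enorm_ge0.
rewrite powR1; lra.
Qed.

Lemma quasi_distance_eq0 x : rho x = 0 -> x = 0.
Proof.
move=> x0; apply: enorm_eq0; apply/eqP; rewrite -[_ == 0]negbK.
apply/negP => ex.
have /enorm_small[r r0 /(_ x)] : 0 < enorm x by rewrite lt_def ex enorm_ge0.
by rewrite x0 ltxx => /(_ (ltW r0)).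
Qed.

Lemma quasi_distance_triangle_ge1 : exists2 k : R, 1 <= k &
  forall x y z, rho (x - y) <= k * (rho (x - z) + rho (y - z)).
Proof.
have [k kP] := qd_triangle hrho; exists (Num.max 1 k).
  by rewrite le_max lexx.
move=> x y z; apply: le_trans (kP x y z) _.
by rewrite ler_wpM2r ?addr_ge0 ?(qd_ge0 hrho)// le_max lexx orbT.
Qed.

(** A vector v killed by the dilation has t * rho v = rho 0 = 0, and [rho] vanishes only at 0. The
    group law of t^P is never invoked. *)
Lemma dilation_unitmx (t : R) : 0 < t -> dilation P t \in unitmx.
Proof.
move=> t0; rewrite -unitmx_tr -row_free_unit -kermx_eq0.
apply/rowV0P => v /sub_kermxP vP; apply/trmx_inj.
rewrite trmx0; apply: quasi_distance_eq0.
have := qd_dilation hrho v^T t0.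
rewrite -[dilation P t]trmxK -trmx_mul vP trmx0 (qd_0 hrho) => /esym/eqP.
by rewrite mulf_eq0 gt_eqF//= => /eqP.
Qed.

(** For a unit vector, homogeneity gives the image under the inverse dilation a [rho] of at most r1
    / t <= r1 / a, and sets where [rho] is bounded are bounded. Linearity extends this to all
    vectors. *)
Lemma invmx_dilation_bound (a : R) : 0 < a -> exists2 K : R, 0 < K &
  forall t x, a <= t -> `|invmx (dilation P t) *m x| <= K * `|x|.
Proof.
move=> a0; have [r0 [r1 [r00 r10 rb]]] := quasi_distance_sphere_bounds.
have [K K0 HK] := quasi_distance_bounded (r1 / a).
exists (1 + K * n%:R); first by rewrite ltr_pwDl// mulr_ge0// ltW.
move=> t x at_; have t0 := lt_le_trans a0 at_.
have [->|x0] := eqVneq x 0; first by rewrite mulmx0 normr0 mulr0.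
have ex : 0 < enorm x.
  by rewrite lt_def enorm_ge0 andbT; apply: contra_neq x0; exact: enorm_eq0.
set th := (enorm x)^-1 *: x.
have eth : enorm th = 1 by rewrite enormZ gtr0_norm ?invr_gt0// mulVf// gt_eqF.
have xE : x = enorm x *: th by rewrite scalerA divff ?gt_eqF// scale1r.
have : enorm (invmx (dilation P t) *m th) <= K.
  apply: HK; rewrite -(ler_pM2l t0) -(qd_dilation hrho)//.
  rewrite mulKVmx ?dilation_unitmx//; have /andP[_ rth] := rb _ eth.
  apply: le_trans rth _; rewrite mulrCA -[leLHS]mulr1 ler_wpM2l ?(ltW r10)//.
  by rewrite ler_pdivlMr// mul1r.
move=> eK; rewrite xE -scalemxAr normrZ -xE gtr0_norm//.
apply: (@le_trans _ _ (enorm x * K)).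
  by rewrite ler_wpM2l ?(ltW ex)//; apply: le_trans eK; exact: norm_le_enorm.
apply: (@le_trans _ _ (n%:R * `|x| * K)).
  by rewrite ler_wpM2r ?(ltW K0)// enorm_le_norm.
by rewrite mulrDl mul1r mulrC mulrA lerDr.
Qed.

End quasi_distance_theory.

(** * Volume of dilation-invariant sets in an annulus *)

Section invariant_sets.
Context {R : realType} {n : nat}.
Variables (P : 'M[R]_n) (rho : 'cV[R]_n -> R).
Hypothesis hrho : quasi_distance P rho.
Implicit Types (x y : 'cV[R]_n).
Local Notation mu := (lebesgue_rn n).

Definition dilation_invariant (A : set 'cV[R]_n) :=
  forall t x, 0 < t -> A (dilation P t *m x) <-> A x.

(* For M large the Lipschitz image of the cone over the trace of a
   dilation-invariant set A on the Euclidean sphere covers A in an annulus. *)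
Definition parabolic_lift (M : R) y : 'cV[R]_n :=
  invmx (dilation P (M * enorm y)) *m radial y.

Lemma radial_lipschitz (d : R) x y : 0 < d -> d <= enorm x -> d <= enorm y ->
  `|radial x - radial y| <= d^-1 * (1 + n%:R) * `|x - y|.
Proof.
move=> d0 dx dy; have x0 := lt_le_trans d0 dx; have y0 := lt_le_trans d0 dy.
apply: norm_le_coord => [|i].
  by rewrite !mulr_ge0 ?addr_ge0// invr_ge0 ltW.
rewrite !mxE.
have -> : (enorm x)^-1 * x i ord0 - (enorm y)^-1 * y i ord0 =
    (enorm x)^-1 * ((x i ord0 - y i ord0) +
     (y i ord0 / enorm y) * (enorm y - enorm x)).
  by field; rewrite !gt_eqF.
rewrite normrM gtr0_norm ?invr_gt0// -[leRHS]mulrA; apply: ler_pM => //.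
- by rewrite invr_ge0 ltW.
- by rewrite lef_pV2 ?posrE.
apply: le_trans (ler_normD _ _) _; rewrite mulrDl mul1r lerD//.
  by apply: le_trans (coord_le_norm _ i); rewrite !mxE.
rewrite normrM -[leRHS]mul1r ler_pM//.
  rewrite normrM [X in _ * X]gtr0_norm ?invr_gt0// ler_pdivrMr// mul1r.
  exact: coord_le_enorm.
by rewrite distrC enorm_distance.
Qed.

Lemma norm_mulmx_le (D : 'M[R]_n) (k : R) x : (forall i j, `|D i j| <= k) ->
  0 <= k -> `|D *m x| <= n%:R * k * `|x|.
Proof.
move=> Dk k0; apply: norm_le_coord => [|i]; first by rewrite !mulr_ge0.
rewrite mxE; apply: le_trans (ler_norm_sum _ _ _) _.
apply: (@le_trans _ _ (\sum_(l < n) k * `|x|)).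
  by apply: ler_sum => l _; rewrite normrM ler_pM// coord_le_norm.
by rewrite sumr_const card_ord -mulrA mulr_natl.
Qed.

(** The resolvent identity A^-1 - B^-1 = A^-1 (B - A) B^-1: a Lipschitz estimate for the dilations
    then suffices for their inverses. *)
Lemma invmx_mul_sub (A B : 'M[R]_n) (u v : 'cV[R]_n) :
  A \in unitmx -> B \in unitmx ->
  invmx A *m u - invmx B *m v =
  invmx A *m (u - v) + invmx A *m ((B - A) *m (invmx B *m v)).
Proof.
move=> uA uB; rewrite mulmxBl mulKVmx// -mulmxDr addrA subrK.
by rewrite mulmxBr mulKmx.
Qed.

(** For d <= |x| <= 1 the times M |x| stay in [M d, M], where dilations are Lipschitz in time and
    their inverses uniformly bounded. *)
Lemma parabolic_lift_lipschitz (M d : R) : 0 < M -> 0 < d ->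
  exists2 L : R, 0 < L & forall x y,
    d <= enorm x <= 1 -> d <= enorm y <= 1 ->
    `|parabolic_lift M x - parabolic_lift M y| <= L * `|x - y|.
Proof.
move=> M0 d0; have Md : 0 < M * d by rewrite mulr_gt0.
have [K K0 HK] := invmx_dilation_bound hrho Md.
have [D D0 HD] := @dilation_lipschitz R n P (M * d) M Md.
(* The second term accounts for the variation of [radial], the third for that of the dilation
   between two inverses of size [K]; the 1 secures positivity. *)
exists (1 + K * (d^-1 * (1 + n%:R)) + K * (n%:R * (D * (M * n%:R))) * K).
  have d1 : 0 < d^-1 by rewrite invr_gt0.
  have n0 : 0 <= n%:R :> R by [].
  by rewrite -addrA ltr_pwDl// addr_ge0// !mulr_ge0 ?addr_ge0// ltW.
move=> x y /andP[dx x1] /andP[dy y1].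
have x0 := lt_le_trans d0 dx; have y0 := lt_le_trans d0 dy.
set s := M * enorm x; set t := M * enorm y.
have sM : M * d <= s <= M.
  by rewrite /s ler_pM2l// dx/= -[leRHS]mulr1 ler_pM2l.
have tM : M * d <= t <= M.
  by rewrite /t ler_pM2l// dy/= -[leRHS]mulr1 ler_pM2l.
have [s1 t1] : M * d <= s /\ M * d <= t by case/andP : sM; case/andP : tM.
have s0 := lt_le_trans Md s1; have t0 := lt_le_trans Md t1.
have -> : parabolic_lift M x - parabolic_lift M y =
    invmx (dilation P s) *m (radial x - radial y) +
    invmx (dilation P s) *m ((dilation P t - dilation P s) *m parabolic_lift M y).
  exact: invmx_mul_sub (dilation_unitmx hrho s0) (dilation_unitmx hrho t0).
apply: le_trans (ler_normD _ _) _.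
have ry1 : `|radial y| <= 1.
  apply: le_trans (norm_le_enorm _) _.
  by rewrite enormZ gtr0_norm ?invr_gt0// mulVf// gt_eqF.
have lK : `|parabolic_lift M y| <= K.
  by apply: le_trans (HK _ _ t1) _; rewrite -[leRHS]mulr1 ler_pM2l.
have st : `|t - s| <= M * n%:R * `|x - y|.
  rewrite /t /s -mulrBr normrM gtr0_norm// -mulrA ler_pM2l// distrC.
  exact: enorm_distance.
have DD : `|(dilation P t - dilation P s) *m parabolic_lift M y| <=
    n%:R * (D * (M * n%:R)) * K * `|x - y|.
  apply: (@le_trans _ _ (n%:R * (D * (M * n%:R * `|x - y|)) * K)).
    apply: (@le_trans _ _ (n%:R * (D * (M * n%:R * `|x - y|)) * `|parabolic_lift M y|)).
      apply: norm_mulmx_le => [i j|].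
        rewrite mxE [X in _ + X]mxE; apply: le_trans (HD _ _ _ _ tM sM) _.
        by rewrite ler_pM2l.
      by rewrite !mulr_ge0// ltW.
    by rewrite ler_wpM2l// !mulr_ge0// ltW.
  by rewrite le_eqVlt; apply/orP; left; apply/eqP; ring.
have := HK s (radial x - radial y) s1.
have := HK s ((dilation P t - dilation P s) *m parabolic_lift M y) s1.
have := radial_lipschitz d0 dx dy.
rewrite -(ler_pM2l K0) => h1.
move: DD; rewrite -(ler_pM2l K0) => h2 h3 h4.
rewrite !mulrDl mul1r; have := normr_ge0 (x - y).
move: h1 h2; rewrite !mulrA; lra.
Qed.

Lemma continuous_enorm_dilation x (t : R) : 0 < t ->
  {for t, continuous (fun s => enorm (dilation P s *m x))}.
Proof.
move=> t0; have t20 : 0 < t / 2 by rewrite divr_gt0.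
have [K K0 HK] := @dilation_lipschitz R n P (t / 2) (2 * t) t20.
apply/cvgrPdist_lt => e e0.
pose c := 1 + n%:R * (n%:R * K * `|x|).
have c0 : 0 < c by rewrite ltr_pwDl// !mulr_ge0// ltW.
have m0 : 0 < Num.min (t / 2) (e / c) by rewrite lt_min t20 divr_gt0.
near=> s.
have : `|t - s| < Num.min (t / 2) (e / c).
  by near: s; exact: cvgr_dist_lt.
rewrite lt_min => /andP[ts2 tsc].
have [sI tI] : t / 2 <= s <= 2 * t /\ t / 2 <= t <= 2 * t.
  by move: ts2; rewrite ltr_norml => /andP[h1 h2]; split; apply/andP; split; lra.
apply: le_lt_trans (enorm_distance _ _) _.
rewrite -mulmxBl.
apply: (@le_lt_trans _ _ (c * `|t - s|)); last by rewrite mulrC -ltr_pdivlMr.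
rewrite mulrDl mul1r ler_wpDl// -!mulrA ler_wpM2l//.
rewrite [X in _ <= n%:R * (K * X)]mulrC !mulrA -[X in _ <= X * _]mulrA.
apply: norm_mulmx_le => [i j|]; last by rewrite mulr_ge0// ltW.
by rewrite mxE [X in _ + X]mxE; exact: HK.
Unshelve. all: by end_near. Qed.

(** Along an orbit [rho] takes every positive value, so the Euclidean norm passes from below 1 to
    above 1; the intermediate value theorem gives the crossing. *)
Lemma dilation_meets_sphere x : 0 < rho x ->
  exists2 t : R, 0 < t & enorm (dilation P t *m x) = 1.
Proof.
move=> x0; have [r1 r10 H1] := enorm_small hrho (@ltr01 R).
have [r2 r20 H2] := enorm_large hrho.
pose t1 := r1 / rho x; pose t2 := r2 / rho x.
have t10 : 0 < t1 by rewrite divr_gt0.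
have t20 : 0 < t2 by rewrite divr_gt0.
have rt1 : rho (dilation P t1 *m x) = r1.
  by rewrite (qd_dilation hrho)// divfK// gt_eqF.
have rt2 : rho (dilation P t2 *m x) = r2.
  by rewrite (qd_dilation hrho)// divfK// gt_eqF.
have e1 : enorm (dilation P t1 *m x) < 1 by apply: H1; rewrite rt1.
have e2 : 1 < enorm (dilation P t2 *m x) by apply: H2; rewrite rt2.
have t12 : t1 <= t2.
  rewrite ler_pM2r ?invr_gt0// leNgt; apply/negP => r21.
  have h : enorm (dilation P t2 *m x) < 1 by apply: H1; rewrite rt2 ltW.
  by have := lt_trans h e2; rewrite ltxx.
have mM (u v : R) : u < 1 -> 1 < v -> Num.min u v <= 1 <= Num.max u v.
  by move=> u1 v1; rewrite ge_min (ltW u1)/= le_max (ltW v1) orbT.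
have [||t] := @IVT R (fun s => enorm (dilation P s *m x)) t1 t2 1 t12.
- apply: continuous_in_subspaceT => t; rewrite inE/= in_itv/= => /andP[t1t _].
  by apply: continuous_enorm_dilation; exact: lt_le_trans t1t.
- exact: mM e1 e2.
- by rewrite in_itv/= => /andP[t1t _] et; exists t => //; exact: lt_le_trans t1t.
Qed.

Lemma measure_invariant_annulus_le (a b : R) : 0 < a -> a < b ->
  exists2 C : R, 0 < C & forall A, measurable A -> dilation_invariant A ->
    (mu ([set x | (a < rho x < b)%R] `&` A) <=
      C%:E * mu (@eball R n `&` @radial R n @^-1` A))%E.
Proof.
move=> a0 ab; have b0 := lt_trans a0 ab.
have [r0 [r1 [r00 r10 rb]]] := quasi_distance_sphere_bounds hrho.
(* If t^P x = w is on the sphere, then r0 <= t rho x <= r1, so r0 / b <= t <= M. The lift sends (t /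
   M) w to x; the choice of [M] puts this point in the unit ball, and its norm t / M is at least
   [d]. *)
pose M := r1 / a; pose d := r0 / b / M.
have M0 : 0 < M by rewrite divr_gt0.
have d0 : 0 < d by rewrite !divr_gt0.
have [L L0 HL] := parabolic_lift_lipschitz M0 d0.
exists ((4 * L) ^+ n); first by rewrite exprn_gt0// mulr_gt0.
move=> A mA invA.
have mrA : measurable (@eball R n `&` @radial R n @^-1` A).
  apply: measurableI; first exact: measurable_eball.
  by rewrite -[X in measurable X]setTI; exact: measurable_radial.
pose B := [set y : 'cV[R]_n | d <= enorm y] `&` (@eball R n `&` @radial R n @^-1` A).
have mB : measurable B.
  apply: measurableI => //.
  rewrite (_ : [set _ | _] = @enorm R n @^-1` `[d, +oo[); last first.
    by apply/seteqP; split => y /=; rewrite in_itv/= andbT.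
  by rewrite -[X in measurable X]setTI; apply: measurable_enorm.
apply: (@le_trans _ _ (((4 * L) ^+ n)%:E * mu B)%E); last first.
  rewrite lee_pmul2l ?lte_fin ?exprn_gt0 ?mulr_gt0//.
  by apply: le_measure; rewrite ?inE//; exact: subIsetr.
apply: (@lebesgue_rn_lipschitz_image _ _ (parabolic_lift M) L 2) => //.
- apply: measurableI => //.
  rewrite (_ : [set _ | _] = rho @^-1` `]a, b[); last first.
    by apply/seteqP; split => y /=; rewrite in_itv.
  by rewrite -[X in measurable X]setTI; apply: (qd_measurable hrho).
- move=> y [_ [y1 _]]; rewrite mx_norm_ball/= sub0r normrN.
  apply: le_lt_trans (norm_le_enorm y) _; apply: le_lt_trans y1 _; lra.
- by move=> x y [dx [x1 _]] [dy [y1 _]]; apply: HL; apply/andP.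
- move=> x [/andP[ax xb] Ax].
  have x0 := lt_trans a0 ax.
  have [t t0 et] := dilation_meets_sphere x0.
  have /andP[rt0 rt1] := rb _ et; rewrite (qd_dilation hrho)// in rt0 rt1.
  have etM : enorm ((t / M) *: (dilation P t *m x)) = t / M.
    by rewrite enormZ et mulr1 gtr0_norm// divr_gt0.
  have tM0 : t / M != 0 by rewrite gt_eqF// divr_gt0.
  have rE : radial ((t / M) *: (dilation P t *m x)) = dilation P t *m x.
    by rewrite /radial etM scalerA mulVf// scale1r.
  exists ((t / M) *: (dilation P t *m x)); last first.
    rewrite /parabolic_lift rE etM mulrCA divff ?gt_eqF// mulr1.
    by rewrite (mulKmx (dilation_unitmx hrho t0)).
  split => /=; last split.
  + rewrite etM /d ler_pM2r ?invr_gt0// ler_pdivrMr//.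
    by apply: le_trans rt0 _; rewrite ler_pM2l// ltW.
  + rewrite /eball/= etM ler_pdivrMr// mul1r ler_pdivlMr//.
    by apply: le_trans rt1; rewrite ler_pM2l// ltW.
  + by rewrite rE; apply/invA.
Qed.

End invariant_sets.

(** * Polar coordinates and homogeneous functions *)

Section power_integrals.
Context {R : realType}.
Implicit Types (a b u v : R).

Lemma measurable_powR_pos a (D : set (measurableTypeR R)) : measurable D ->
  measurable_fun D (fun t : R => (t `^ a)%:E).
Proof.
by move=> mD; apply/measurable_EFinP; apply: (measurable_funS measurableT) => //;
  exact: measurable_powR.
Qed.

Lemma continuous_powR_pos a (t : R) : 0 < t ->
  {for t, continuous (fun s : R => s `^ a)}.
Proof.
move=> t0; apply: differentiable_continuous; apply/derivable1_diffP.
by apply: derivable_powR; rewrite in_itv/= andbT.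
Qed.

Lemma is_derive_powR_div a (t : R) : a != 0 -> 0 < t ->
  is_derive t (1 : R) (fun s => s `^ a / a) (t `^ (a - 1)).
Proof.
move=> a0 t0; have := is_deriveZ a^-1 (is_derive1_powR a t0).
rewrite [_ *: _](mulKf a0); congr is_derive.
by apply/funext => s; rewrite /= mulrC.
Qed.

Lemma integral_powR_itv a u v : a != 0 -> 0 < u -> u < v ->
  (\int[lebesgue_measure]_(t in `[u, v]) (t `^ (a - 1))%:E =
    ((v `^ a - u `^ a) / a)%:E)%E.
Proof.
move=> a0 u0 uv.
have pos (t : R) : u <= t -> 0 < t by exact: lt_le_trans.
pose F t : R := t `^ a / a.
have dF (t : R) : 0 < t -> is_derive t (1 : R) F (t `^ (a - 1)).
  exact: is_derive_powR_div.
have cF (t : R) : 0 < t -> F x @[x --> t] --> F t.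
  by move=> t0; apply: cvgMl; exact: continuous_powR_pos.
rewrite (@continuous_FTC2 _ (fun t => t `^ (a - 1)) F)//.
- by rewrite -EFinB /F mulrBl.
- apply: continuous_in_subspaceT => t; rewrite inE/= in_itv/= => /andP[ut _].
  exact/continuous_powR_pos/pos.
- split.
  + move=> t; rewrite in_itv/= => /andP[ut _].
    by have /dF[] : 0 < t := lt_trans u0 ut.
  + exact/cvg_at_right_filter/cF.
  + by apply/cvg_at_left_filter/cF; exact: lt_trans uv.
- move=> t; rewrite in_itv/= => /andP[ut _].
  by rewrite derive1E; apply: derive_val; apply: dF; exact: lt_trans ut.
Qed.

Lemma integral_powR0 a v : 0 < a -> 0 < v ->
  (\int[lebesgue_measure]_(t in `]0%R, v]) (t `^ (a - 1))%:E = (v `^ a / a)%:E)%E.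
Proof.
move=> a0 v0.
(* The integrand may be unbounded at 0, hence the exhaustion; with k.+2 in the denominator every
   interval is nondegenerate. *)
pose F (k : nat) : set R := `[v / k.+2%:R, v]%classic.
have vk k : 0 < v / k.+2%:R by rewrite divr_gt0.
have FE : \bigcup_k F k = `]0, v]%classic.
  apply/seteqP; split => [t [k _]|t] /=; rewrite /F /= !in_itv/= => /andP[t1 t2].
    by rewrite t2 (lt_le_trans (vk k) t1).
  exists (Num.truncn (v / t)) => //=; rewrite /F /= in_itv/= t2 andbT.
  rewrite ler_pdivrMr// mulrC -ler_pdivrMr// (le_trans (ltW (truncnS_gt _)))//.
  by rewrite ler_nat.
have H : (\int[lebesgue_measure]_(t in F i) (t `^ (a - 1))%:E)%E @[i --> \oo] -->
    (\int[lebesgue_measure]_(t in \bigcup_i F i) (t `^ (a - 1))%:E)%E.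
  apply: ge0_nondecreasing_set_cvg_integral.
  - apply/nondecreasing_seqP => k; apply/subsetPset => t /=.
    rewrite /F /= !in_itv/= => /andP[t1 ->]; rewrite andbT (le_trans _ t1)//.
    by rewrite ler_pM2l// lef_pV2 ?posrE// ler_nat.
  - by move=> k; exact: measurable_itv.
  - by move=> k; apply: measurable_powR_pos; exact: measurable_itv.
  - by move=> k t _; rewrite lee_fin powR_ge0.
rewrite FE in H; apply: cvg_unique H _ => //.
rewrite (_ : (fun i => _) = (fun i => ((v `^ a - (v / i.+2%:R) `^ a) / a)%:E)).
  2: by apply/funext => k; rewrite /F integral_powR_itv ?gt_eqF// ltr_pdivrMr// ltr_pMr// ltr1n.
apply: cvg_EFin; first by near=> k.
apply: cvgMl; rewrite -[X in _ --> X]subr0; apply: cvgB; first exact: cvg_cst.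
have /cvg_at_rightP := @powR_cvg0 R a a0; apply; split => //.
rewrite -[X in _ --> X](mulr0 v); apply: cvgMr.
by have := @cvg_harmonic R; rewrite -cvg_shiftS.
Unshelve. all: by end_near. Qed.

Lemma integral_powR_infty a u : 0 < a -> 0 < u ->
  (\int[lebesgue_measure]_(t in `[u, +oo[) (t `^ (- a - 1))%:E = (u `^ (- a) / a)%:E)%E.
Proof.
move=> a0 u0.
have pos (t : R) : u <= t -> 0 < t by exact: lt_le_trans.
pose F t : R := t `^ (- a) / (- a).
have dF (t : R) : 0 < t -> is_derive t (1 : R) F (t `^ (- a - 1)).
  by apply: is_derive_powR_div; rewrite oppr_eq0 gt_eqF.
have cF (t : R) : 0 < t -> F x @[x --> t] --> F t.
  by move=> t0; apply: cvgMl; exact: continuous_powR_pos.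
rewrite (@ge0_continuous_FTC2y _ (fun t => t `^ (- a - 1)) F u 0)//.
- by rewrite -EFinB /F sub0r invrN mulrN opprK.
- by move=> t _; rewrite powR_ge0.
- apply: continuous_in_subspaceT => t; rewrite inE/= in_itv/= andbT => ut.
  exact/continuous_powR_pos/pos.
- rewrite -[X in _ --> X](mul0r (- a)^-1); apply: cvgMl.
  apply/cvgr0Pnorm_lt => e e0; near=> t.
  have t0 : 0 < t by near: t; apply: nbhs_pinfty_gt; rewrite num_real.
  rewrite powRN ger0_norm ?invr_ge0 ?powR_ge0// invf_plt ?posrE ?powR_gt0//.
  rewrite ltNge; apply/negP => /(powR_le_root (ltW t0) a0); apply/negP.
  by rewrite -ltNge; near: t; apply: nbhs_pinfty_gt; rewrite num_real.
- by move=> t ut; have [] := dF _ (lt_trans u0 ut).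
- exact/cvg_at_right_filter/cF.
- move=> t; rewrite in_itv/= andbT => ut.
  by rewrite derive1E; apply: derive_val; apply: dF; exact: lt_trans ut.
Unshelve. all: by end_near. Qed.

End power_integrals.

(** * Polar coordinates on dilation-invariant sets *)

Section polar.
Context {R : realType} {n : nat}.
Variables (P : 'M[R]_n) (rho : 'cV[R]_n -> R).
Hypothesis hrho : quasi_distance P rho.
Implicit Types (x y : 'cV[R]_n).
Local Notation mu := (lebesgue_rn n).
Local Notation gamma := (\tr P).

Lemma measurable_quasi_distance_preimage (I : set (measurableTypeR R)) :
  measurable I -> measurable (rho @^-1` I).
Proof.
by move=> mI; rewrite -[X in measurable X]setTI; exact: (qd_measurable hrho).
Qed.

(** Since [sigma] lives on {rho = 1}, the point t^P w lies in the set exactly when t is in [I] and w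
    in [A], so the angular integral is constant in t. The product form lets different radial ranges
    be compared for the same [A] without knowing [sigma]. *)
Lemma polar_invariant : exists sigma : {measure set 'cV[R]_n -> \bar R},
  forall A (I : set (measurableTypeR R)), measurable A ->
    dilation_invariant P A -> measurable I ->
    (mu (rho @^-1` I `&` A) =
      sigma A * \int[lebesgue_measure]_(t in `]0%R, +oo[ `&` I)
        (t `^ (gamma - 1))%:E)%E.
Proof.
have [sigma [sigma1 polar]] := qd_polar hrho.
exists sigma => A I mA invA mI.
have mS : measurable (rho @^-1` I `&` A).
  by apply: measurableI => //; exact: measurable_quasi_distance_preimage.
have m1 : measurable (rho @^-1` [set 1]).
  exact: (measurable_quasi_distance_preimage (measurable_set1 1)).
have mrho1 : measurable [set w | rho w <> 1].
  rewrite (_ : [set w | _] = ~` (rho @^-1` [set 1]))//.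
  exact: measurableC.
have sigmaE B : measurable B -> sigma B = sigma (B `&` rho @^-1` [set 1]).
  move=> mB; rewrite (@measureDI _ _ _ sigma _ (rho @^-1` [set 1]) mB)//.
  rewrite [X in (X + _)%E](_ : _ = 0)%E ?add0e//.
  apply/eqP; rewrite eq_le measure_ge0 andbT -sigma1.
  apply: le_measure; rewrite ?inE//.
  exact: measurableD.
have := polar (fun x => (\1_(rho @^-1` I `&` A) x)%:E).
rewrite integral_indic// setIT => ->; last 2 first.
- exact/measurable_EFinP.
- by move=> x; rewrite lee_fin.
have mI0 : measurable (`]0, +oo[%classic `&` I : set (measurableTypeR R)).
  by apply: measurableI => //; exact: measurable_itv.
have mpw : measurable_fun (`]0%R, +oo[%classic : set (measurableTypeR R))
    ((fun t : R => (t `^ (gamma - 1))%:E) \_ I).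
  have mi : measurable (`]0%R, +oo[%classic : set (measurableTypeR R)).
    exact: measurable_itv.
  apply/(measurable_restrict _ mI mi); apply: measurable_powR_pos.
  exact: measurableI.
rewrite integral_mkcondr -(ge0_integralZl _ _ mpw)//; last first.
  by move=> t _; rewrite patchE; case: ifP => // _; rewrite lee_fin powR_ge0.
apply: eq_integral => t; rewrite inE/= in_itv/= andbT => t0.
rewrite patchE.
have mtrho : measurable ((fun w => t * rho w) @^-1` I).
  rewrite -[X in measurable X]setTI.
  suff mt : measurable_fun setT (fun w => t * rho w : measurableTypeR R) by exact: mt.
  by apply: measurable_funM => //; exact: (qd_measurable hrho).
pose Bt : set 'cV[R]_n := (fun w => t * rho w) @^-1` I `&` A.
have mB : measurable Bt by exact: measurableI.
rewrite (_ : \int[sigma]_w _ = sigma Bt)%E; last first.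
  rewrite -[X in sigma X]setIT -integral_indic//.
  apply: eq_integral => w _; rewrite !indicE; congr ((_ : bool)%:R)%:E.
  apply/idP/idP; rewrite !inE => -[/= H1 H2]; split => //=.
  - by rewrite (qd_dilation hrho) in H1.
  - exact: (invA t w t0).1.
  - by rewrite (qd_dilation hrho).
  - exact: (invA t w t0).2.
rewrite sigmaE// (sigmaE A)//; case: ifPn => It.
- congr (sigma _ * _)%E; rewrite /Bt; apply/seteqP; split => w /=.
    by move=> [[_ Aw] w1].
  by move=> [Aw w1]; rewrite w1 mulr1; split => //; split => //; exact/set_mem.
- rewrite mule0 /Bt (_ : _ `&` _ = set0) ?measure0 ?mul0e//.
  rewrite -subset0 => w [[/= + _] /= w1]; rewrite w1 mulr1.
  by move: It; rewrite notin_setE.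
Qed.

End polar.

(** * Positivity of the trace, volume of ellipsoids, homogeneous functions *)

Section homogeneous_functions.
Context {R : realType} {n : nat}.
Variables (P : 'M[R]_n) (rho : 'cV[R]_n -> R).
Hypothesis hrho : quasi_distance P rho.
Implicit Types (x y : 'cV[R]_n).
Local Notation mu := (lebesgue_rn n).
Local Notation gamma := (\tr P).

Let mrho := measurable_quasi_distance_preimage hrho.

Lemma lebesgue_bounded_finite (A : set 'cV[R]_n) (K : R) : measurable A ->
  (forall x, A x -> enorm x <= K) -> (mu A < +oo)%E.
Proof.
move=> mA AK; have K0 : 0 < `|K| + 1 by rewrite ltr_wpDl.
apply: (@le_lt_trans _ _ (mu (ball (0 : 'cV[R]_n) (`|K| + 1)))); last first.
  by rewrite lebesgue_rn_ball ?ltry.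
apply: le_measure; rewrite ?inE//; first exact: measurable_ball_rn.
move=> x /AK xK; rewrite mx_norm_ball/= sub0r normrN.
apply: le_lt_trans (norm_le_enorm x) _; have := ler_norm K; lra.
Qed.

Lemma lebesgue_nbhs_gt0 (A : set 'cV[R]_n) (d : R) : 0 < d -> measurable A ->
  (forall x, enorm x < d -> A x) -> (0 < mu A)%E.
Proof.
move=> d0 mA dA; have n0 : 0 < n%:R + 1 :> R by rewrite ltr_wpDl.
have e0 : 0 < d / (n%:R + 1) by rewrite divr_gt0.
apply: (@lt_le_trans _ _ (mu (ball (0 : 'cV[R]_n) (d / (n%:R + 1))))).
  by rewrite lebesgue_rn_ball// lte_fin exprn_gt0// mulr_gt0.
apply: le_measure; rewrite ?inE//; first exact: measurable_ball_rn.
move=> x; rewrite mx_norm_ball/= sub0r normrN ltr_pdivlMr// => xd.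
apply: dA; apply: le_lt_trans (enorm_le_norm x) (le_lt_trans _ xd).
by rewrite mulrC ler_wpM2l// lerDl.
Qed.

Lemma rho_ball_finite (I : set (measurableTypeR R)) (r : R) : measurable I ->
  I `<=` `]-oo, r[ -> (mu (rho @^-1` I) < +oo)%E.
Proof.
move=> mI Ir; have [K _ HK] := quasi_distance_bounded hrho r.
apply: (lebesgue_bounded_finite (mrho mI)) => x /Ir/=; rewrite in_itv/= => /ltW.
exact: HK.
Qed.

Lemma rho_ball_gt0 (r : R) : 0 < r -> (0 < mu (rho @^-1` `]-oo, r[))%E.
Proof.
move=> r0; have [d d0 Hd] := quasi_distance_small hrho r0.
apply: (lebesgue_nbhs_gt0 d0) => [|x /Hd]; last by rewrite /= in_itv.
by apply: mrho; exact: measurable_itv.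
Qed.

Lemma trace_gt0 : 0 < gamma.
Proof.
rewrite ltNge; apply/negP => g0.
have [sigma HS] := polar_invariant hrho.
have HT (I : set (measurableTypeR R)) : measurable I -> (mu (rho @^-1` I) =
    sigma setT * \int[lebesgue_measure]_(t in `]0%R, +oo[ `&` I)
        (t `^ (gamma - 1))%:E)%E.
  by move=> mI; rewrite -HS// setIT.
have S0 : (0 < sigma setT)%E.
  rewrite lt_neqAle measure_ge0 andbT eq_sym; apply/eqP => S0.
  have := rho_ball_gt0 (@ltr01 R); rewrite HT; last exact: measurable_itv.
  by rewrite S0 mul0e ltxx.
pose D k : set 'cV[R]_n := rho @^-1` `]0, k.+1%:R^-1[.
have mD k : measurable (D k) by apply: mrho; exact: measurable_itv.
(* If tr P <= 0 then t ^ (tr P - 1) >= 1 / t near 0, so the small annuli D k,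
   which decrease to the empty set, would keep a mass bounded below. *)
have lowD k : (sigma setT * (2^-1)%:E <= mu (D k))%E.
  rewrite /D HT; last exact: measurable_itv.
  apply: lee_wpmul2l => //; rewrite (_ : _ `&` _ = `]0, k.+1%:R^-1[%classic); last first.
    by apply/seteqP; split => t /=; rewrite !in_itv/= andbT; [case|move=> /andP[-> ->]].
  have k1 : k.+1%:R^-1 <= 1 :> R by rewrite invf_le1// ler1n.
  have k0 : 0 < k.+1%:R^-1 :> R by rewrite invr_gt0.
  set d : R := k.+1%:R^-1 in k0 k1 *.
  (* On an interval of length d / 2 the integrand is at least 1 / d, whence the uniform bound 1 /
     2. *)
  apply: (@le_trans _ _ (\int[lebesgue_measure]_(t in `](d / 2)%R, d[) (cst (d^-1)%:E t))%E).
    rewrite integral_cst/=; last exact: measurable_itv.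
    rewrite lebesgue_measure_itv/= lte_fin ifT; last lra.
    by rewrite -EFinB -EFinM lee_fin; set e := d^-1 * _; have -> : e = 2^-1
      by rewrite /e; field; rewrite gt_eqF.
  apply: (@le_trans _ _ (\int[lebesgue_measure]_(t in `](d / 2)%R, d[) (t `^ (gamma - 1))%:E)%E).
    apply: ge0_le_integral => //.
    - by move=> t _; rewrite lee_fin invr_ge0 ltW.
    - by apply: measurable_powR_pos; exact: measurable_itv.
    - move=> t /=; rewrite in_itv/= => /andP[t1 t2]; rewrite lee_fin.
      have t0 : 0 < t by lra.
      apply: (@le_trans _ _ (t `^ (-1))).
        by rewrite powR_inv1 ?(ltW t0)// lef_pV2 ?posrE// ltW.
      by apply: ger_powR; [apply/andP; split => //; lra|lra].
  apply: ge0_subset_integral.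
  - exact: measurable_itv.
  - exact: measurable_itv.
  - by apply: measurable_powR_pos; exact: measurable_itv.
  - by move=> t _; rewrite lee_fin powR_ge0.
  - by move=> t /=; rewrite !in_itv/= => /andP[t1 ->]; rewrite andbT; lra.
have cD : mu \o D @ \oo --> mu (\bigcap_k D k).
  apply: nonincreasing_cvg_mu => //.
  - apply: (@rho_ball_finite _ 1); first exact: measurable_itv.
    by move=> t /=; rewrite !in_itv/= invr1 => /andP[].
  - exact: bigcapT_measurable.
  - apply/nonincreasing_seqP => k; apply/subsetPset => x.
    rewrite /D /= !in_itv/= => /andP[->/= xk]; apply: lt_le_trans xk _.
    by rewrite lef_pV2 ?posrE// ler_nat.
have D0 : \bigcap_k D k = set0.
  rewrite -subset0 => x xD.
  have := xD 0%N Logic.I; rewrite /D/= in_itv/= => /andP[x0 _].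
  have [k _ /(_ _ (leqnn k)) /= kx] := near_infty_natSinv_lt (PosNum x0).
  have := xD k Logic.I; rewrite /D/= in_itv/= => /andP[_ xk].
  by have := lt_trans xk kx; rewrite ltxx.
rewrite D0 measure0 in cD.
have S20 : (0 < sigma setT * (2^-1)%:E)%E by rewrite mule_gt0.
have [k _ /(_ _ (leqnn k)) /= kD] := cD _ (open_ereal_lt' S20).
by have := le_lt_trans (lowD k) kD; rewrite ltxx.
Qed.

Lemma integral_powR_trace (r : R) : 0 < r ->
  (\int[lebesgue_measure]_(t in `]0%R, +oo[ `&` `]-oo, r[)
    (t `^ (gamma - 1))%:E = (r `^ gamma / gamma)%:E)%E.
Proof.
move=> r0; rewrite -integral_powR0 ?trace_gt0// (_ : _ `&` _ = `]0, r[%classic).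
  by rewrite integral_itv_bndo_bndc//; apply: measurable_powR_pos; exact: measurable_itv.
by apply/seteqP; split => t /=; rewrite !in_itv/= andbT; [case=> -> ->|move=> /andP[]].
Qed.

(** The unit ellipsoid has positive and finite measure, which forces the total mass of [sigma] to be
    a positive real. *)
Lemma lebesgue_rho_ball : exists2 v : R, 0 < v &
  forall r, 0 < r -> (mu (rho @^-1` `]-oo, r[) = (v * r `^ gamma)%:E)%E.
Proof.
have [sigma HS] := polar_invariant hrho; have g0 := trace_gt0.
have HT r : 0 < r ->
    (mu (rho @^-1` `]-oo, r[) = sigma setT * (r `^ gamma / gamma)%:E)%E.
  move=> r0; rewrite -integral_powR_trace// -HS ?setIT//; exact: measurable_itv.
have V0 := rho_ball_gt0 (@ltr01 R).
have : (mu (rho @^-1` `]-oo, 1%R[) < +oo)%E.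
  by apply: (@rho_ball_finite _ 1) => //; exact: measurable_itv.
move: V0 HT; have := measure_ge0 sigma setT.
case: (sigma setT) => [s| |] s0 V0 HT; last 2 first.
- by rewrite HT// gt0_mulye ?lte_fin ?divr_gt0 ?powR_gt0.
- by move: V0; rewrite HT// gt0_mulNye ?lte_fin ?divr_gt0 ?powR_gt0.
move=> _; rewrite HT// powR1 -EFinM lte_fin in V0.
exists (s / gamma); first by move: V0; rewrite mul1r.
by move=> r r0; rewrite HT// -EFinM mulrAC mulrA.
Qed.

Lemma eball_gt0 : (0 < mu (@eball R n))%E.
Proof.
by apply: (lebesgue_nbhs_gt0 (@ltr01 R)) => [|x /ltW//]; exact: measurable_eball.
Qed.

Lemma eball_finite : (mu (@eball R n) < +oo)%E.
Proof. by apply: (@lebesgue_bounded_finite _ 1) => //; exact: measurable_eball. Qed.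

Lemma sphere_measureE A :
  (mu (@eball R n `&` @radial R n @^-1` A) =
    mu (@eball R n) * sphere_measure A)%E.
Proof.
have fe : mu (@eball R n) \is a fin_num by rewrite ge0_fin_numE// eball_finite.
rewrite /sphere_measure muleA -[X in (X * _ * _)%E](fineK fe) -EFinM divff ?mul1e//.
by rewrite gt_eqF// fine_gt0// eball_gt0 eball_finite.
Qed.

(** By the polar formula the annulus 1 < rho < 2 and the ball rho < r share the factor [sigma A].
    The annulus is controlled by the surface measure, and its radial integral [J] is positive, so
    [sigma A] can be eliminated. *)
Lemma measure_invariant_ball_le : exists2 C : R, 0 < C &
  forall A r, measurable A -> dilation_invariant P A -> 0 < r ->
    (mu (rho @^-1` `]-oo, r[ `&` A) <=
      (C * r `^ gamma)%:E * sphere_measure A)%E.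
Proof.
have [sigma HS] := polar_invariant hrho; have g0 := trace_gt0.
have [C C0 HC] := measure_invariant_annulus_le hrho (@ltr01 R) (ltr1n R 2).
pose e := fine (mu (@eball R n)).
have e0 : 0 < e by rewrite /e fine_gt0// eball_gt0 eball_finite.
pose J : R := (2 `^ gamma - 1 `^ gamma) / gamma.
have J0 : 0 < J.
  by rewrite divr_gt0// subr_gt0 gt0_ltr_powR ?nnegrE// ltr1n.
exists (C * e / (J * gamma)); first by rewrite divr_gt0// mulr_gt0.
move=> A r mA iA r0.
have sJ : (sigma A * J%:E <= (C * e)%:E * sphere_measure A)%E.
  rewrite [X in (_ <= X * _)%E]EFinM -muleA /e fineK ?ge0_fin_numE ?eball_finite// -sphere_measureE.
  apply: le_trans (HC A mA iA).
  rewrite (_ : [set x | _] = rho @^-1` `]1, 2[); last first.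
    by apply/seteqP; split => x /=; rewrite in_itv.
  rewrite HS//.
  rewrite -integral_powR_itv ?gt_eqF ?ltr1n//.
  rewrite (_ : _ `&` _ = `]1, 2[%classic); last first.
    apply/seteqP; split => t /=; rewrite !in_itv/= andbT; first by case.
    by move=> /andP[t1 ->]; rewrite t1; split => //; lra.
  by rewrite integral_itv_bndoo//; apply: measurable_funS (measurable_powR_pos _ measurableT).
rewrite HS//.
rewrite integral_powR_trace//.
have -> : r `^ gamma / gamma = J * (r `^ gamma / (J * gamma)).
  by field; rewrite !gt_eqF.
rewrite EFinM muleA.
have -> : C * e / (J * gamma) * r `^ gamma = (C * e) * (r `^ gamma / (J * gamma)) by ring.
rewrite [X in (_ <= X * _)%E]EFinM -[leRHS]muleA [X in (_ <= _ * X)%E]muleC muleA.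
by apply: lee_wpmul2r => //; rewrite lee_fin divr_ge0 ?powR_ge0// ltW// mulr_gt0.
Qed.

(** Preimages under [Omega] are dilation-invariant, so the inequality for sets compares the two
    image measures on the line, against which [G] is integrated. *)
Lemma integral_homogeneous_ball_le : exists2 C : R, 0 < C &
  forall (Omega : 'cV[R]_n -> R) (G : R -> \bar R) r,
    measurable_fun setT Omega -> dilation_homogeneous0 P Omega ->
    measurable_fun setT G -> (forall z, 0 <= G z)%E -> 0 < r ->
    (\int[mu]_(x in rho @^-1` `]-oo, r[) G (Omega x) <=
      (C * r `^ gamma)%:E * \int[@sphere_measure R n]_x G (Omega x))%E.
Proof.
have [C C0 HC] := measure_invariant_ball_le; exists C => //.
move=> Omega G r mO hO mG G0 r0.
have mE : measurable (rho @^-1` `]-oo, r[) by apply: mrho; exact: measurable_itv.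
have c0 : 0 <= C * r `^ gamma by rewrite mulr_ge0 ?powR_ge0// ltW.
have mGO : measurable_fun setT (G \o Omega) by exact: measurableT_comp.
have GO0 x : setT x -> (0 <= (G \o Omega) x)%E by move=> _; exact: G0.
pose sph := mscale (NngNum c0) (@sphere_measure R n).
apply: (@le_trans _ _ (\int[mrestr mu mE]_x (G \o Omega) x)%E).
  rewrite (@eq_measure_integral _ _ _ _ (mrestr mu mE)).
    apply: ge0_subset_integral => //.
  by move=> B mB BE; rewrite /= /mrestr setIidl.
rewrite -[leRHS](ge0_integral_mscale _ measurableT (NngNum c0) mGO)//.
have pE (m : {measure set 'cV[R]_n -> \bar R}) :
    (\int[m]_x (G \o Omega) x = \int[pushforward m Omega]_z G z)%E.
  by rewrite (ge0_integral_pushforward mO m measurableT mG).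
rewrite !pE; apply: ge0_le_measure_integral => // S mS.
rewrite /= /pushforward /mrestr /= setIC.
apply: HC => //.
  by rewrite -[X in measurable X]setTI; exact: mO.
by move=> t x t0; rewrite /= hO.
Qed.

End homogeneous_functions.

(** * Estimates for the part of the operator away from the ellipsoid *)

Section integral_inequalities.
Context {R : realType}.

Lemma ereal_nondecreasing_measurable (D : set (measurableTypeR R)) (f : R -> \bar R) :
  measurable D -> (forall s t, s <= t -> (f s <= f t)%E) -> measurable_fun D f.
Proof.
move=> mD ndf; apply: (measurability _ (ErealGenOInfty.measurableE R)) => //.
move=> _ [_ [r ->] <-]; apply: measurableI => //.
apply: is_interval_measurable => s t /=; rewrite !in_itv/= !andbT => rs _.
by move=> u /andP[su _]; rewrite in_itv/= andbT; apply: lt_le_trans rs _; exact: ndf.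
Qed.

Section power_mean.
Context d (T : measurableType d) (mu : {measure set T -> \bar R}).

(** The integral of a nonnegative function is a supremum over simple functions below it, which is
    monotone for arbitrary functions. *)
Lemma ge0_le_integral_nonmeasurable (D : set T) (f g : T -> \bar R) :
  (forall x, D x -> 0 <= f x)%E -> (forall x, D x -> f x <= g x)%E ->
  (\int[mu]_(x in D) f x <= \int[mu]_(x in D) g x)%E.
Proof.
move=> f0 fg; have g0 x : D x -> (0 <= g x)%E.
  by move=> Dx; exact: le_trans (f0 x Dx) (fg x Dx).
rewrite !ge0_integralE//; apply: ge_ereal_sup => _ [h /= hf] <-.
apply: ereal_sup_ubound; exists h => //= x; apply: le_trans (hf x) _.
by rewrite !patchE; case: ifPn => // xD; apply: fg; exact: set_mem.
Qed.

(** Jensen's inequality for the measure w dmu, up to the factor 2^p. It follows from h <= l + l^(1 -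
    p) h^p, valid for every l > 0: either h <= l, or h^(1 - p) <= l^(1 - p). *)
Lemma power_mean (h w : T -> R) (p m : R) : 1 <= p -> 0 < m ->
  measurable_fun setT h -> measurable_fun setT w ->
  (forall x, 0 <= h x) -> (forall x, 0 <= w x) ->
  (\int[mu]_x (w x)%:E <= m%:E)%E ->
  ((\int[mu]_x (h x * w x)%:E) `^ p <=
    (2 `^ p * m `^ (p - 1))%:E * \int[mu]_x (h x `^ p * w x)%:E)%E.
Proof.
move=> p1 m0 mh mw h0 w0 wm; have p0 : 0 < p by exact: lt_le_trans p1.
have c0 : 0 < 2 `^ p * m `^ (p - 1) by rewrite mulr_gt0// powR_gt0.
have mhw : measurable_fun setT (fun x => h x `^ p * w x).
  apply: measurable_funM => //; exact: (measurableT_comp (measurable_powR _)).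
set B := (\int[mu]_x (h x `^ p * w x)%:E)%E.
have B0 : (0 <= B)%E.
  by apply: integral_ge0 => x _; rewrite lee_fin mulr_ge0// powR_ge0.
have split_le (l : R) : 0 < l ->
    (\int[mu]_x (h x * w x)%:E <= (l `^ (1 - p))%:E * B + (l * m)%:E)%E.
  move=> l0; apply: (@le_trans _ _
    (\int[mu]_x ((l `^ (1 - p))%:E * (h x `^ p * w x)%:E + l%:E * (w x)%:E))%E).
    apply: ge0_le_integral => //.
    - by move=> x _; rewrite lee_fin mulr_ge0.
    - exact/measurable_EFinP/measurable_funM.
    - by apply/measurable_EFinP; apply: measurable_funD; apply: measurable_funM.
    - move=> x _; rewrite -!EFinM -EFinD lee_fin mulrA -mulrDl ler_wpM2r//.
      have [hl|lh] := leP (h x) l.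
        by apply: le_trans hl _; rewrite lerDr mulr_ge0// powR_ge0.
      have hx0 : 0 < h x by exact: lt_trans lh.
      apply: (@le_trans _ _ (l `^ (1 - p) * h x `^ p)); last by rewrite lerDl ltW.
      rewrite -[X in _ <= _ * _ `^ X](subrKC 1 p) [h x `^ _]powRD; last first.
        by rewrite (gt_eqF hx0) implybT.
      rewrite powRr1// mulrCA -[leLHS]mulr1 ler_wpM2l// -(opprB p) powRN.
      rewrite mulrC ler_pdivlMr ?powR_gt0// mul1r.
      by rewrite ge0_ler_powR ?nnegrE ?subr_ge0// ltW.
  rewrite ge0_integralD//; last 4 first.
  - by move=> x _; rewrite -EFinM lee_fin mulr_ge0 ?powR_ge0// mulr_ge0// powR_ge0.
  - by apply/measurable_EFinP; apply: measurable_funM.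
  - by move=> x _; rewrite -EFinM lee_fin mulr_ge0// ltW.
  - by apply/measurable_EFinP; apply: measurable_funM.
  rewrite ge0_integralZl//; last 3 first.
  - exact/measurable_EFinP.
  - by move=> x _; rewrite lee_fin mulr_ge0// powR_ge0.
  - by rewrite lee_fin powR_ge0.
  rewrite ge0_integralZl//; last 3 first.
  - exact/measurable_EFinP.
  - by move=> x _; rewrite lee_fin.
  - by rewrite lee_fin ltW.
  by rewrite leeD2l// EFinM lee_wpmul2l// lee_fin ltW.
have A0 : (0 <= \int[mu]_x (h x * w x)%:E)%E.
  by apply: integral_ge0 => x _; rewrite lee_fin mulr_ge0.
have [->|Boo] := eqVneq B +oo%E; first by rewrite gt0_muley ?lte_fin// leey.
have Bfin : B \is a fin_num by rewrite ge0_fin_numE// ltey.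
have := fine_ge0 B0; move: split_le; rewrite -(fineK Bfin) /=; set b := fine B.
move=> H; rewrite le_eqVlt => /predU1P[b0|b0].
  rewrite -b0 in H *.
  suff -> : (\int[mu]_x (h x * w x)%:E = 0)%E.
    by rewrite poweR0r ?mule0// gt_eqF.
  apply/eqP; rewrite eq_le A0 andbT; apply/lee_addgt0Pr => e e0.
  by have := H _ (divr_gt0 e0 m0); rewrite mule0 divfK ?gt_eqF.
(* With l^p = b / m the two terms of the split are equal, to l m each. *)
have l0 : 0 < (b / m) `^ p^-1 by rewrite powR_gt0// divr_gt0.
have := H _ l0; rewrite -EFinM; set l := (b / m) `^ p^-1 in l0 *.
have lp : l `^ p = b / m.
  by rewrite -powRrM mulVf ?gt_eqF// powRr1// ltW// divr_gt0.
have -> : l `^ (1 - p) * b = l * m.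
  rewrite powRD; last by rewrite (gt_eqF l0) implybT.
  by rewrite powRr1 ?(ltW l0)// powRN lp invf_div -mulrA divfK// gt_eqF.
move=> Hl; apply: (@le_trans _ _ ((2 * (l * m))%:E `^ p)%E).
  apply: gt0_ler_poweR.
  - exact: ltW.
  - by rewrite in_itv/= A0 leey.
  - by rewrite in_itv/= leey andbT lee_fin !mulr_ge0// ltW.
  by apply: le_trans Hl _; rewrite -EFinD lee_fin; lra.
have lm0 : 0 <= l * m by rewrite mulr_ge0// ltW.
rewrite poweR_EFin -EFinM lee_fin (powRM _ _ lm0)// (powRM _ (ltW l0) (ltW m0)) lp.
rewrite -(mulr_powRB1 (ltW m0) p0) le_eqVlt; apply/orP; left; apply/eqP.
by field; rewrite gt_eqF.
Qed.

End power_mean.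

Section tail.
Context d (T : measurableType d) (mu : {sigma_finite_measure set T -> \bar R}).

(** The exponent is left free because the formula serves twice: with a = gamma for |Omega| |f|, and
    with a = gamma - theta for the mass of the measure in the power mean. *)
Lemma tail_integral_le (rr h : T -> R) (a r0 : R) (B : R -> \bar R) :
  measurable_fun setT rr -> measurable_fun setT h -> (forall x, 0 <= h x) ->
  0 < a -> 0 < r0 ->
  (forall t, r0 < t -> (\int[mu]_(x in [set x | (rr x < t)%R]) (h x)%:E <= B t)%E) ->
  (\int[mu]_(x in [set x | (r0 <= rr x)%R]) (h x * rr x `^ (- a))%:E <=
    a%:E * \int[lebesgue_measure]_(t in `]r0, +oo[) ((t `^ (- a - 1))%:E * B t))%E.
Proof.
move=> mrr mh h0 a0 r00 HB.
have mD : measurable [set x | (r0 <= rr x)%R].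
  rewrite (_ : [set x | _] = rr @^-1` `[r0, +oo[); last first.
    by apply/seteqP; split => x /=; rewrite in_itv/= andbT.
  by rewrite -[X in measurable X]setTI; exact: mrr.
have mDt t : measurable [set x | (rr x < t)%R].
  rewrite (_ : [set x | _] = rr @^-1` `]-oo, t[); last first.
    by apply/seteqP; split => x /=; rewrite in_itv.
  by rewrite -[X in measurable X]setTI; exact: mrr.
pose g (z : T * measurableTypeR R) : \bar R :=
  (h z.1 * (r0 <= rr z.1)%R%:R * (rr z.1 < z.2)%R%:R * z.2 `^ (- a - 1))%:E.
have mb d' (U : measurableType d') (b : U -> bool) : measurable_fun setT b ->
    measurable_fun setT (fun z => (b z)%:R : R).
  move=> mb; rewrite (_ : (fun _ => _) = \1_[set z | b z]).
    apply: measurable_indic.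
    rewrite (_ : [set z | b z] = b @^-1` [set true])//.
    by rewrite -[X in measurable X]setTI; exact: mb.
  by apply/funext => z; rewrite indicE; congr (_%:R); congr nat_of_bool; apply/idP/idP; rewrite inE.
have mg : measurable_fun setT g.
  apply/measurable_EFinP; apply: measurable_funM; last first.
    exact: (measurableT_comp (measurable_powR _) measurable_snd).
  apply: measurable_funM; first apply: measurable_funM.
  - exact: (measurableT_comp mh measurable_fst).
  - by apply: mb; apply: measurable_fun_ler => //; exact: (measurableT_comp mrr measurable_fst).
  - by apply: mb; apply: measurable_fun_ltr; [exact: (measurableT_comp mrr measurable_fst)|exact: measurable_snd].
have g0 z : (0 <= g z)%E.
  by rewrite lee_fin !mulr_ge0// powR_ge0.
have gint x : r0 <= rr x ->
    (\int[lebesgue_measure]_t g (x, t) = (h x * rr x `^ (- a) / a)%:E)%E.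
  move=> Dx; have rx0 := lt_le_trans r00 Dx.
  transitivity (\int[lebesgue_measure]_(t in `[rr x, +oo[)
      ((h x)%:E * (t `^ (- a - 1))%:E))%E.
    rewrite -integral_itv_obnd_cbnd; last first.
      apply/measurable_EFinP; apply: measurable_funM => //.
      exact: (measurable_funS measurableT _ (measurable_powR _)).
    rewrite [RHS]integral_mkcond; apply: eq_integral => t _.
    rewrite patchE /g /= Dx mulr1 mem_setE in_itv/= andbT.
    by case: (rr x < t); rewrite ?mulr1 ?mulr0 ?mul0r// EFinM.
  rewrite ge0_integralZl//; last 3 first.
  - exact: measurable_powR_pos.
  - by move=> t _; rewrite lee_fin powR_ge0.
  - by rewrite lee_fin.
  by rewrite integral_powR_infty// -EFinM mulrA.
have mgF : measurable_fun setT (fun x => \int[lebesgue_measure]_t g (x, t))%E.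
  exact: (measurable_fun_fubini_tonelli_F g mg g0).
apply: (@le_trans _ _ (a%:E * \int[mu]_x \int[lebesgue_measure]_t g (x, t))%E).
  rewrite (eq_integral (fun x => (a%:E * \int[lebesgue_measure]_t g (x, t))%E)).
    rewrite ge0_integralZl//; last 3 first.
    - exact: measurable_funS mgF.
    - by move=> x _; apply: integral_ge0.
    - by rewrite lee_fin ltW.
    apply: lee_wpmul2l; first by rewrite lee_fin ltW.
    by apply: ge0_subset_integral => // x _; apply: integral_ge0.
  move=> x; rewrite inE/= => Dx; rewrite gint// -EFinM; congr EFin.
  by field; rewrite gt_eqF.
apply: lee_wpmul2l; first by rewrite lee_fin ltW.
rewrite (fubini_tonelli g mg g0) [leRHS]integral_mkcond.
apply: ge0_le_integral_nonmeasurable => t _; first by apply: integral_ge0.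
rewrite patchE mem_setE in_itv/= andbT.
have [rt|tr] := ltP r0 t; last first.
  rewrite (eq_integral (fun=> 0%E)) ?integral0// => x _; rewrite /g/=.
  have [rx|rx] := leP r0 (rr x); last by rewrite mulr0 !mul0r.
  by rewrite ltNge (le_trans tr rx) mulr0 mul0r.
apply: (@le_trans _ _ ((t `^ (- a - 1))%:E *
    \int[mu]_(x in [set x | (rr x < t)%R]) (h x)%:E)%E); last first.
  by apply: lee_wpmul2l; [rewrite lee_fin powR_ge0|exact: HB].
rewrite -ge0_integralZl//; last 3 first.
- by apply/measurable_EFinP; exact: measurable_funS mh.
- by move=> x _; rewrite lee_fin.
- by rewrite lee_fin powR_ge0.
rewrite [leRHS]integral_mkcond; apply: ge0_le_integral_nonmeasurable => // x _.
rewrite patchE /g/=; have [xt|tx] := boolP (rr x < t)%R; last first.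
  by rewrite memNset ?mulr0 ?mul0r//; exact/negP.
rewrite mem_set// mulr1 -EFinM lee_fin mulrC ler_wpM2l ?powR_ge0//.
by case: (r0 <= rr x); rewrite ?mulr1 ?mulr0.
Qed.

End tail.
End integral_inequalities.

Lemma poweR_le_root (R : realType) (A : \bar R) (q c : R) : (0 <= A)%E -> 0 < q ->
  0 <= c -> (A `^ q <= c%:E)%E -> (A <= (c `^ q^-1)%:E)%E.
Proof.
move=> A0 q0 c0 Ac; rewrite -[A]poweRe1// -(mulfV (lt0r_neq0 q0)) poweRrM -poweR_EFin.
apply: gt0_ler_poweR => //.
- by rewrite invr_ge0 ltW.
- by rewrite in_itv/= poweR_ge0 leey.
- by rewrite in_itv/= leey lee_fin c0.
Qed.

(** * Measure of ellipsoids and integrability of Omega on them *)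

Section kernel_estimates.
Context {R : realType} {n : nat}.
Variables (P : 'M[R]_n) (rho : 'cV[R]_n -> R).
Hypothesis hrho : quasi_distance P rho.
Implicit Types (x y : 'cV[R]_n).
Local Notation mu := (lebesgue_rn n).
Local Notation gamma := (\tr P).

Lemma measurable_rho_sub x : measurable_fun setT (fun y => rho (x - y)).
Proof.
rewrite (_ : (fun y => _) = rho \o signed_translation true x).
  apply: measurableT_comp; first exact: (qd_measurable hrho).
  exact: measurable_signed_translation.
by apply/funext => y; rewrite /= /signed_translation expr1 scaleN1r.
Qed.

Lemma measurable_ellipsoid x r : measurable (ellipsoid rho x r).
Proof.
rewrite (_ : ellipsoid rho x r = (fun y => rho (x - y)) @^-1` `]-oo, r[); last first.
  by apply/seteqP; split => y; rewrite /ellipsoid/= in_itv.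
by rewrite -[X in measurable X]setTI; exact: measurable_rho_sub.
Qed.

Lemma measurable_rho_ge x c : measurable [set y | (c <= rho (x - y))%R].
Proof.
rewrite (_ : [set y | _] = ~` (ellipsoid rho x c)).
  by apply: measurableC; exact: measurable_ellipsoid.
apply/seteqP; split => y; rewrite /ellipsoid/= leNgt; first by move/negP.
by move=> H; apply/negP.
Qed.

Lemma ellipsoidE x r :
  ellipsoid rho x r = signed_translation true x @^-1` (rho @^-1` `]-oo, r[).
Proof.
by apply/seteqP; split => y; rewrite /ellipsoid/= in_itv/= /signed_translation
  expr1 scaleN1r.
Qed.

Lemma lebesgue_ellipsoid : exists2 v : R, 0 < v &
  forall x r, 0 < r -> mu (ellipsoid rho x r) = (v * r `^ gamma)%:E.
Proof.
have [v v0 Hv] := lebesgue_rho_ball hrho; exists v => // x r r0.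
rewrite ellipsoidE lebesgue_rn_signed_translation ?Hv//.
exact: (measurable_quasi_distance_preimage hrho).
Qed.

Lemma integral_ellipsoid_subl (x0 y : 'cV[R]_n) (r r' : R) (G : 'cV[R]_n -> \bar R) :
  measurable_fun setT G -> (forall z, 0 <= G z)%E ->
  (forall x, rho (x0 - x) < r -> rho (x - y) < r') ->
  (\int[mu]_(x in ellipsoid rho x0 r) G (x - y)%R <=
   \int[mu]_(z in rho @^-1` `]-oo, r'[) G z)%E.
Proof.
move=> mG G0 sub.
have mE : measurable (rho @^-1` `]-oo, r'[).
  exact: (measurable_quasi_distance_preimage hrho).
rewrite [leRHS]integral_mkcond [leLHS]integral_mkcond.
rewrite -[leRHS](ge0_integral_subl y); last 2 first.
- by apply/(measurable_restrictT _ mE); exact: measurable_funS mG.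
- by move=> z; rewrite patchE; case: ifP.
apply: ge0_le_integral_nonmeasurable => x _; rewrite patchE; case: ifPn => //.
  by move=> /set_mem/sub xy; rewrite patchE mem_set//= in_itv.
by move=> _; rewrite patchE; case: ifP.
Qed.

Lemma integral_ellipsoid_subr (x0 x : 'cV[R]_n) (r r' : R) (G : 'cV[R]_n -> \bar R) :
  measurable_fun setT G -> (forall z, 0 <= G z)%E ->
  (forall y, rho (x0 - y) < r -> rho (x - y) < r') ->
  (\int[mu]_(y in ellipsoid rho x0 r) G (x - y)%R <=
   \int[mu]_(z in rho @^-1` `]-oo, r'[) G z)%E.
Proof.
move=> mG G0 sub.
have mE : measurable (rho @^-1` `]-oo, r'[).
  exact: (measurable_quasi_distance_preimage hrho).
rewrite [leRHS]integral_mkcond [leLHS]integral_mkcond.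
rewrite -[leRHS](ge0_integral_subr x); last 2 first.
- by apply/(measurable_restrictT _ mE); exact: measurable_funS mG.
- by move=> z; rewrite patchE; case: ifP.
apply: ge0_le_integral_nonmeasurable => y _; rewrite patchE; case: ifPn => //.
  by move=> /set_mem/sub xy; rewrite patchE mem_set//= in_itv.
by move=> _; rewrite patchE; case: ifP.
Qed.

Section omega.
Variables (s : \bar R) (Omega : 'cV[R]_n -> R).
Hypotheses (s1 : (1 < s)%E) (hOmega : Omega \in Lfun (@sphere_measure R n) s).
Hypothesis hOmega0 : dilation_homogeneous0 P Omega.

Lemma measurable_omega : measurable_fun setT Omega.
Proof. by have := sub_Lfun_mfun hOmega; rewrite inE. Qed.

Let mO := measurable_omega.

Lemma measurable_omega_sub :
  measurable_fun setT (fun z : 'cV[R]_n * 'cV[R]_n => `|Omega (z.1 - z.2)|).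
Proof.
apply: measurableT_comp => //; apply: (measurableT_comp mO).
apply: measurable_fun_mxP => i j.
rewrite (_ : (fun _ => _) = (fun z : 'cV[R]_n * 'cV[R]_n => z.1 i j - z.2 i j)).
  apply: measurable_funB.
    exact: (measurableT_comp (measurable_mx_coord i j) measurable_fst).
  exact: (measurableT_comp (measurable_mx_coord i j) measurable_snd).
by apply/funext => z; rewrite !mxE.
Qed.

Lemma measurable_omega_subl y : measurable_fun setT (fun x => `|Omega (x - y)|).
Proof. exact: (measurableT_comp measurable_omega_sub (measurable_pair2 y)). Qed.

Lemma measurable_omega_subr x : measurable_fun setT (fun y => `|Omega (x - y)|).
Proof. exact: (measurableT_comp measurable_omega_sub (measurable_pair1 x)). Qed.

Lemma measurable_normr_powR (q : R) :
  measurable_fun setT (fun z : measurableTypeR R => (`|z| `^ q)%:E : \bar R).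
Proof.
apply/measurable_EFinP; apply: (measurableT_comp (measurable_powR _)).
exact: normr_measurable.
Qed.

Lemma sphere_measure_finite : @sphere_measure R n setT \is a fin_num.
Proof.
rewrite ge0_fin_numE// /sphere_measure preimage_setT setIT.
by rewrite -[X in (_ * X)%E]fineK ?ge0_fin_numE ?eball_finite// -EFinM ltry.
Qed.

Lemma omega_power_le (q : R) : 1 <= q -> (q%:E <= s)%E -> exists2 C : R, 0 < C &
  forall r, 0 < r -> (\int[mu]_(z in rho @^-1` `]-oo, r[) (`|Omega z| `^ q)%:E <=
    (C * r `^ gamma)%:E)%E.
Proof.
move=> q1 qs; have q0 : 0 < q by exact: lt_le_trans q1.
have [C C0 HC] := integral_homogeneous_ball_le hrho.
have : Omega \in Lfun (@sphere_measure R n) q%:E.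
  by apply: (@Lfun_subset _ _ _ _ q%:E s) hOmega => //; [exact: ltW|exact: sphere_measure_finite].
rewrite inE => /andP[_]; rewrite inE/= /finite_norm unlock => Iq.
have I0 : (0 <= \int[@sphere_measure R n]_x (`|Omega x| `^ q)%:E)%E.
  by apply: integral_ge0 => x _; rewrite lee_fin powR_ge0.
have Ioo : (\int[@sphere_measure R n]_x (`|Omega x| `^ q)%:E < +oo)%E.
  have := @lty_poweRy _ _ q^-1 _ Iq; apply.
  by rewrite invr_neq0// gt_eqF.
have Ifin : (\int[@sphere_measure R n]_x (`|Omega x| `^ q)%:E)%E \is a fin_num.
  by rewrite ge0_fin_numE.
(* The added 1 keeps the constant positive when [Omega] vanishes almost everywhere on the sphere. *)
exists (C * (fine (\int[@sphere_measure R n]_x (`|Omega x| `^ q)%:E)%E + 1)).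
  by rewrite mulr_gt0// ltr_wpDl// fine_ge0.
move=> r r0.
have := HC Omega (fun z => (`|z| `^ q)%:E) r mO hOmega0 (measurable_normr_powR q) _ r0.
move=> /(_ (fun z => powR_ge0 _ _)) H; apply: le_trans H _.
rewrite -[X in (_ * X <= _)%E]fineK// -EFinM lee_fin mulrAC ler_wpM2r ?powR_ge0//.
by rewrite ler_wpM2l ?(ltW C0)// lerDl.
Qed.

(** The set where |Omega| > M is dilation-invariant and null on the sphere, hence null in each ball
    {rho < k + 1}. *)
Lemma omega_ess_bounded : s = +oo%E -> exists2 M : R, 0 < M &
  mu [set z | (M < `|Omega z|)%R] = 0%E.
Proof.
move=> soo; have := hOmega; rewrite soo inE => /andP[_]; rewrite inE/= /finite_norm.
have sph0 : (0 < @sphere_measure R n setT)%E.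
  rewrite /sphere_measure preimage_setT setIT mule_gt0 ?eball_gt0//.
  by rewrite lte_fin invr_gt0 fine_gt0// eball_gt0 eball_finite.
rewrite unlock sph0 => essO.
have [M M0 HM] : exists2 M : R, 0 < M &
    (ess_sup (@sphere_measure R n) (abse \o (EFin \o Omega)) <= M%:E)%E.
  move: essO; case: ess_sup => [m _|//|_]; last by exists 1; rewrite ?leNye.
  by exists (`|m| + 1); rewrite ?ltr_wpDl// lee_fin ler_wpDr// ler_norm.
exists M => //.
have mA : measurable [set z | (M < `|Omega z|)%R].
  rewrite (_ : [set z | _] = (fun z => `|Omega z|) @^-1` `]M, +oo[); last first.
    by apply/seteqP; split => z /=; rewrite in_itv/= andbT.
  have mnO : measurable_fun setT (fun z => `|Omega z|) by exact: measurableT_comp.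
  by rewrite -[X in measurable X]setTI; exact: mnO.
have iA : dilation_invariant P [set z | (M < `|Omega z|)%R].
  by move=> t z t0; rewrite /= hOmega0.
have sA : sphere_measure [set z | (M < `|Omega z|)%R] = 0%E.
  have /ess_supP[N [mN N0 NM]] := HM.
  apply: (subset_measure0 mA mN _ N0) => z /= Mz; apply: NM => /=.
  by rewrite lee_fin leNgt Mz.
have [C C0 HC] := measure_invariant_ball_le hrho.
apply/eqP; rewrite eq_le measure_ge0 andbT.
apply: (@le_trans _ _ (\sum_(k <oo) mu (rho @^-1` `]-oo, k.+1%:R[ `&`
    [set z | (M < `|Omega z|)%R]))%E).
  apply: measure_sigma_subadditive => //.
    move=> k; apply: measurableI => //.
    exact: (measurable_quasi_distance_preimage hrho).
  move=> z Mz; exists (Num.truncn (rho z)) => //; split => //=.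
  by rewrite in_itv/= truncnS_gt.
rewrite eseries0// => k _ _.
apply/eqP; rewrite eq_le measure_ge0 andbT.
have := HC _ k.+1%:R mA iA (ltr0Sn R k).
by rewrite sA mule0.
Qed.

End omega.
End kernel_estimates.

(** * Integrals of Omega over translated ellipsoids *)

Section far_part.
Context {R : realType} {n : nat}.
Variables (P : 'M[R]_n) (rho : 'cV[R]_n -> R).
Hypothesis hrho : quasi_distance P rho.
Implicit Types (x y : 'cV[R]_n).
Local Notation mu := (lebesgue_rn n).
Local Notation gamma := (\tr P).
Variables (s : \bar R) (Omega : 'cV[R]_n -> R).
Hypotheses (s1 : (1 < s)%E) (hOmega : Omega \in Lfun (@sphere_measure R n) s).
Hypothesis hOmega0 : dilation_homogeneous0 P Omega.
Variables (k : R) (k1 : 1 <= k).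
Hypothesis rho_triangle :
  forall x y z, rho (x - y) <= k * (rho (x - z) + rho (y - z)).
Variables (x0 : 'cV[R]_n) (p : R) (p1 : 1 <= p).
(** This is gamma / s, with value 0 for s = +oo. *)
Local Notation theta := (gamma * fine (s^-1)%E).

Let mO := measurable_omega hOmega.
Let k0 : 0 < k. Proof. exact: lt_le_trans k1. Qed.
Let p0 : 0 < p. Proof. exact: lt_le_trans p1. Qed.

Let measurable_omega_powR y (q : R) :
  measurable_fun setT (fun x => `|Omega (x - y)| `^ q).
Proof.
exact: (measurableT_comp (measurable_powR q) (measurable_omega_subl hOmega y)).
Qed.

Let rho_sub_lt x y (r t : R) : rho (x0 - x) < r -> rho (x0 - y) <= t -> r <= t ->
  rho (x - y) < 2 * k * t.
Proof.
move=> xr yt rt; apply: le_lt_trans (rho_triangle x y x0) _.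
rewrite (qd_sym hrho x) (qd_sym hrho y) (mulrC 2) -mulrA ltr_pM2l//; lra.
Qed.

(** For finite s this is the power mean with exponent s / p on an ellipsoid of volume v r^gamma.
    With t = rho (x0 - y) >= r, the differences x - y stay in {rho < 2 k t}, where the integral of
    |Omega|^s is O(t^gamma). For s = +oo, [Omega] is essentially bounded. *)
Lemma omega_translate_power_le : (p%:E < s)%E -> exists2 K : R, 0 < K &
  forall y r, 0 < r -> 2 * k * r <= rho (x0 - y) ->
    (\int[mu]_(x in ellipsoid rho x0 r) (`|Omega (x - y)| `^ p)%:E <=
      (K * rho (x0 - y) `^ (theta * p) * r `^ (gamma - theta * p))%:E)%E.
Proof.
move=> ps; have [v v0 Hv] := lebesgue_ellipsoid hrho.
have k20 : 0 < 2 * k by rewrite mulr_gt0.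
have tau_ge y r : 0 < r -> 2 * k * r <= rho (x0 - y) -> r <= rho (x0 - y).
  move=> r0; apply: le_trans; rewrite -[leLHS]mul1r ler_pM2r//.
  by move: k1; lra.
case: s s1 ps hOmega => [sg| |//] sg1 psg hO.
- rewrite lte_fin in psg; have sg0 : 0 < sg by exact: lt_trans psg.
  have sg1' : 1 <= sg by rewrite -lee_fin ltW.
  have psg0 : 0 < p / sg by rewrite divr_gt0.
  have sgp1 : 1 <= sg / p by rewrite ler_pdivlMr// mul1r ltW.
  have sgp0 : 0 < sg / p by rewrite divr_gt0.
  have [C C0 HC] := omega_power_le hrho sg1 hO hOmega0 sg1' (lexx _).
  rewrite inver gt_eqF//=.
  pose c0 := 2 `^ (sg / p) * v `^ (sg / p - 1) * C * (2 * k) `^ gamma.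
  have c00 : 0 < c0 by rewrite !mulr_gt0 ?powR_gt0.
  exists (c0 `^ (sg / p)^-1); first by rewrite powR_gt0.
  move=> y r r0 yr; have rt := tau_ge y r r0 yr; set t := rho (x0 - y) in rt *.
  have t0 : 0 < t by exact: lt_le_trans rt.
  have mE := measurable_ellipsoid hrho x0 r.
  have rw (q : R) : (\int[mu]_(x in ellipsoid rho x0 r) (`|Omega (x - y)| `^ q)%:E =
     \int[mu]_x (`|Omega (x - y)| `^ q * \1_(ellipsoid rho x0 r) x)%:E)%E.
    rewrite integral_mkcond; apply: eq_integral => x _.
    by rewrite patchE indicE; case: ifP; rewrite ?mulr1 ?mulr0.
  have vr0 : 0 < v * r `^ gamma by rewrite mulr_gt0// powR_gt0.
  have := @power_mean R _ _ mu (fun x => `|Omega (x - y)| `^ p)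
    \1_(ellipsoid rho x0 r) (sg / p) (v * r `^ gamma) sgp1 vr0
    (measurable_omega_powR y p) (measurable_indic mE).
  have wm : (\int[mu]_x (\1_(ellipsoid rho x0 r) x)%:E <= (v * r `^ gamma)%:E)%E.
    rewrite integral_indic// setIT le_eqVlt; apply/orP; left; apply/eqP; exact: Hv.
  move=> /(_ (fun x => powR_ge0 _ _) (fun x => ler0n _ _) wm).
  rewrite -rw => H.
  have H2 : (\int[mu]_x ((`|Omega (x - y)| `^ p) `^ (sg / p) *
      \1_(ellipsoid rho x0 r) x)%:E <= (C * (2 * k * t) `^ gamma)%:E)%E.
    rewrite (eq_integral (fun x => (`|Omega (x - y)| `^ sg * \1_(ellipsoid rho x0 r) x)%:E)); last first.
      by move=> x _; rewrite -powRrM mulrCA divff ?gt_eqF// mulr1.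
    rewrite -rw; apply: le_trans (HC _ (mulr_gt0 k20 t0)).
    apply: (integral_ellipsoid_subl hrho (G := fun z => (`|Omega z| `^ sg)%:E)).
    - exact: (measurableT_comp (measurable_normr_powR sg) mO).
    - by move=> z; rewrite lee_fin powR_ge0.
    - by move=> x xr; apply: rho_sub_lt xr (lexx _) rt.
  have {}H : (( \int[mu]_(x in ellipsoid rho x0 r) (`|Omega (x - y)| `^ p)%:E) `^ (sg / p)
      <= (c0 * r `^ (gamma * (sg / p - 1)) * t `^ gamma)%:E)%E.
    apply: le_trans H _; apply: le_trans (lee_wpmul2l _ H2) _.
      by rewrite lee_fin mulr_ge0 ?powR_ge0.
    rewrite -EFinM lee_fin le_eqVlt; apply/orP; left; apply/eqP.
    rewrite (powRM _ (ltW v0) (powR_ge0 _ _)) (powRM _ (ltW k20) (ltW t0)) -powRrM /c0.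
    by ring.
  apply: le_trans (poweR_le_root _ sgp0 _ H) _.
  - by apply: integral_ge0 => x _; rewrite lee_fin powR_ge0.
  - by rewrite !mulr_ge0 ?powR_ge0 ?(ltW C0)//.
  have A1 : 0 <= c0 * r `^ (gamma * (sg / p - 1)) by rewrite mulr_ge0 ?powR_ge0// ltW.
  rewrite lee_fin (powRM _ A1 (powR_ge0 _ _)) (powRM _ (ltW c00) (powR_ge0 _ _)).
  rewrite -!powRrM mulrAC invf_div.
  have -> : gamma * (sg / p - 1) * (p / sg) = gamma - gamma * sg^-1 * p.
    by field; rewrite !gt_eqF.
  by have -> : gamma * (p / sg) = gamma * sg^-1 * p by ring.
- have [M M0 HM] := omega_ess_bounded hrho hO hOmega0 erefl.
  exists (M `^ p * v); first by rewrite mulr_gt0 ?powR_gt0.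
  move=> y r r0 yr; rewrite invey/= mulr0 mul0r subr0 powRr0 mulr1.
  have mE := measurable_ellipsoid hrho x0 r.
  apply: (@le_trans _ _ (\int[mu]_(x in ellipsoid rho x0 r) (cst (M `^ p)%:E x))%E).
    apply: ae_ge0_le_integral => //.
      by apply/measurable_EFinP; apply: measurable_funS (measurable_omega_powR y p).
      by move=> x _; rewrite /= lee_fin powR_ge0.
    have mA : measurable [set z | (M < `|Omega z|)%R].
      rewrite (_ : [set z | _] = (fun z => `|Omega z|) @^-1` `]M, +oo[); last first.
        by apply/seteqP; split => z /=; rewrite in_itv/= andbT.
      have mnO : measurable_fun setT (fun z => `|Omega z|) by exact: measurableT_comp.
      by rewrite -[X in measurable X]setTI; exact: mnO.
    (* The exceptional x form a translate of the null set where |Omega| > M. *)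
    exists (signed_translation false (- y) @^-1` [set z | (M < `|Omega z|)%R]); split.
    - rewrite -[X in measurable X]setTI.
      exact: (@measurable_signed_translation R n false (- y) measurableT _ mA).
    - by rewrite -[RHS]HM; exact: lebesgue_rn_signed_translation.
    - move=> x /= Hx; rewrite ltNge; apply/negP => OM; apply: Hx => _.
      move: OM; rewrite /signed_translation expr0 scale1r addrC => OM.
      by rewrite lee_fin ge0_ler_powR ?nnegrE// ltW.
  rewrite integral_cst// -mulrA [leRHS]EFinM; apply: lee_wpmul2l.
    by rewrite lee_fin powR_ge0.
  by rewrite le_eqVlt; apply/orP; left; apply/eqP; exact: Hv.
Qed.

Lemma conj_exponent_le : 1 < p -> (hoelder_conjugate s <= p%:E)%E ->
  ((p / (p - 1))%:E <= s)%E.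
Proof.
move=> p1'; move: s1; case: s => [sg| |//] sg1; last by rewrite leey.
have sg1' : 1 < sg by rewrite -lte_fin.
rewrite /hoelder_conjugate /= eqe gt_eqF ?(lt_trans _ sg1')//.
rewrite -EFinB inver gt_eqF ?subr_gt0//= -EFinM !lee_fin.
rewrite ler_pdivrMr ?subr_gt0// ler_pdivrMr ?subr_gt0// !mulrBr mulr1; lra.
Qed.

(** Hoelder's inequality with q = p', which is at most s. As r <= t, the differences x - y stay in
    {rho < 2 k t}, so the norm of [Omega] is O(t^(gamma / q)), and gamma / q = gamma - gamma / p. *)
Lemma omega_hoelder : 1 < p -> (hoelder_conjugate s <= p%:E)%E ->
  exists2 C : R, 0 < C & forall (F : 'cV[R]_n -> R) x r t,
    measurable_fun setT F -> (forall y, 0 <= F y) ->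
    0 < r -> r <= t -> rho (x0 - x) < r ->
    (\int[mu]_(y in ellipsoid rho x0 t) (`|Omega (x - y)| * F y)%:E <=
      (C * t `^ (gamma - gamma / p))%:E * Lp_norm p (F \_ (ellipsoid rho x0 t)))%E.
Proof.
move=> p1' hc; pose q := p / (p - 1); have pm0 : 0 < p - 1 by rewrite subr_gt0.
have q1 : 1 <= q by rewrite ler_pdivlMr// mul1r gerBl.
have q0 : 0 < q by exact: lt_le_trans q1.
have [C C0 HC] := omega_power_le hrho s1 hOmega hOmega0 q1 (conj_exponent_le p1' hc).
have k20 : 0 < 2 * k by rewrite mulr_gt0.
exists ((C * (2 * k) `^ gamma) `^ q^-1); first by rewrite powR_gt0// mulr_gt0// powR_gt0.
move=> F x r t mF F0 r0 rt xr; have t0 := lt_le_trans r0 rt.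
have mE := measurable_ellipsoid hrho x0 t.
pose f := (fun y => `|Omega (x - y)|) \_ (ellipsoid rho x0 t).
pose g := F \_ (ellipsoid rho x0 t).
have mOx := measurable_omega_subr hOmega x.
have mf : measurable_fun setT f by apply/(measurable_restrictT _ mE); exact: measurable_funS mOx.
have mg : measurable_fun setT g by apply/(measurable_restrictT _ mE); exact: measurable_funS mF.
have pq : q^-1 + p^-1 = 1 by rewrite /q; field; rewrite !gt_eqF.
have := hoelder mu mf mg q0 p0 pq.
rewrite Lnorm1 => H.
apply: (@le_trans _ _ ('N[mu]_q%:E[EFin \o f] * Lp_norm p g)%E).
  apply: le_trans H; rewrite [leLHS]integral_mkcond; apply: ge0_le_integral_nonmeasurable.
    by move=> y _; rewrite patchE; case: ifP => // _; rewrite lee_fin mulr_ge0.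
  move=> y _; rewrite /= /f /g !patchE; case: ifP => _; last by rewrite mul0r normr0.
  by rewrite lee_fin ler_norm.
apply: lee_wpmul2r; first exact: Lnorm_ge0.
rewrite unlock.
have Iq : (\int[mu]_y `|(EFin \o f) y| `^ q <= (C * (2 * k * t) `^ gamma)%:E)%E.
  apply: le_trans (HC _ (mulr_gt0 k20 t0)).
  apply: le_trans (integral_ellipsoid_subr hrho (x := x) (x0 := x0) (r := t)
    (G := fun z => (`|Omega z| `^ q)%:E) _ _ _).
  - rewrite [leRHS]integral_mkcond; apply: ge0_le_integral_nonmeasurable => y _.
      exact: poweR_ge0.
    rewrite /= /f !patchE; case: ifP => _; first by rewrite normr_id.
    by rewrite normr0 powR0// gt_eqF.
  - exact: (measurableT_comp (measurable_normr_powR q) mO).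
  - by move=> z; rewrite lee_fin powR_ge0.
  - move=> y yt; apply: le_lt_trans (rho_triangle x y x0) _.
    rewrite (qd_sym hrho x) (qd_sym hrho y) (mulrC 2) -mulrA ltr_pM2l//; lra.
apply: (@le_trans _ _ ((C * (2 * k * t) `^ gamma)%:E `^ q^-1)%E).
  apply: gt0_ler_poweR.
  - by rewrite invr_ge0 ltW.
  - by rewrite in_itv/= leey andbT integral_ge0// => y _; exact: poweR_ge0.
  - by rewrite in_itv/= leey lee_fin mulr_ge0 ?powR_ge0// ltW.
  - exact: Iq.
have Ck0 : 0 <= C * (2 * k) `^ gamma by rewrite mulr_ge0 ?powR_ge0// ltW.
rewrite poweR_EFin lee_fin (@powRM _ (2 * k) t gamma (ltW k20) (ltW t0)) mulrA.
rewrite (powRM _ Ck0 (powR_ge0 _ _)) -[(t `^ _) `^ _]powRrM.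
have -> // : gamma / q = gamma - gamma / p.
by rewrite /q; field; rewrite !gt_eqF.
Qed.

End far_part.

Lemma poweR_le_inv (R : realType) (A B : \bar R) (q : R) : 0 < q ->
  (0 <= A)%E -> (0 <= B)%E -> (A `^ q <= B `^ q)%E -> (A <= B)%E.
Proof.
move=> q0 A0 B0 AB.
rewrite -[A]poweRe1// -[B]poweRe1// -(mulfV (lt0r_neq0 q0)) !poweRrM.
apply: gt0_ler_poweR => //.
- by rewrite invr_ge0 ltW.
- by rewrite in_itv/= poweR_ge0 leey.
- by rewrite in_itv/= poweR_ge0 leey.
Qed.

(** * Bounds in L_p for the far part *)

Section far_part_bounds.
Context {R : realType} {n : nat}.
Variables (P : 'M[R]_n) (rho : 'cV[R]_n -> R).
Hypothesis hrho : quasi_distance P rho.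
Implicit Types (x y : 'cV[R]_n) (F : 'cV[R]_n -> R) (e : R -> \bar R).
Local Notation mu := (lebesgue_rn n).
Local Notation gamma := (\tr P).
Variables (s : \bar R) (Omega : 'cV[R]_n -> R).
Hypotheses (s1 : (1 < s)%E) (hOmega : Omega \in Lfun (@sphere_measure R n) s).
Hypothesis hOmega0 : dilation_homogeneous0 P Omega.
Variables (k : R) (k1 : 1 <= k).
Hypothesis rho_triangle :
  forall x y z, rho (x - y) <= k * (rho (x - z) + rho (y - z)).
Variables (x0 : 'cV[R]_n) (p : R) (p1 : 1 <= p).
Local Notation theta := (gamma * fine (s^-1)%E).

Let mO := measurable_omega hOmega.
Let k0 : 0 < k. Proof. exact: lt_le_trans k1. Qed.
Let p0 : 0 < p. Proof. exact: lt_le_trans p1. Qed.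
Let g0 : 0 < gamma. Proof. exact: trace_gt0 hrho. Qed.

Definition far_part F r x : \bar R :=
  (\int[mu]_(y in [set y | (2 * k * r <= rho (x0 - y))%R])
    (`|Omega (x - y)| * F y * rho (x0 - y) `^ (- gamma))%:E)%E.

(** The weight [e] is abstract here; it will be the essential infimum of phi_1 tau^(gamma/p) over
    tau > t, and [N] a multiple of a bound for the Morrey norm. *)
Definition local_norm_le F (N : R) e :=
  forall t, 0 < t -> (Lp_norm p (F \_ (ellipsoid rho x0 t)) <= N%:E * e t)%E.

(** The common conclusion of both cases: b = 0 if s' <= p, b = gamma / s if p < s. The p-th root of
    the right side is C N D r^(gamma/p - b); the factor r^b in the bound [D] supplied by the
    integral condition restores r^(gamma/p). *)
Definition far_part_estimate (b : R) := exists2 C : R, 0 < C &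
  forall F (N : R) e (r D : R),
    measurable_fun setT F -> (forall y, 0 <= F y) -> 0 < N ->
    (forall u t, u <= t -> (e u <= e t)%E) -> (forall t, 0 <= e t)%E ->
    local_norm_le F N e -> 0 < r -> 0 < D ->
    (\int[lebesgue_measure]_(t in `](2 * k * r)%R, +oo[)
       (e t * ((t `^ (gamma / p - b + 1))^-1)%:E) <= D%:E)%E ->
    (\int[mu]_(x in ellipsoid rho x0 r) far_part F r x `^ p <=
       ((C * N * D) `^ p * r `^ (gamma - b * p))%:E)%E.

Let measurable_weight e (b a : R) : (forall u t, u <= t -> (e u <= e t)%E) ->
  measurable_fun (`]b, +oo[%classic : set (measurableTypeR R))
    (fun t => (e t * ((t `^ a)^-1)%:E)%E).
Proof.
move=> nde; apply: emeasurable_funM.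
  exact: ereal_nondecreasing_measurable.
rewrite (_ : (fun t => _) = (fun t : R => (t `^ (- a))%:E)).
  exact: measurable_powR_pos.
by apply/funext => t; rewrite powRN.
Qed.

Let integral_weight_le e (b a : R) (B : R -> \bar R) (C N D : R) :
  (forall u t, u <= t -> (e u <= e t)%E) -> (forall t, 0 <= e t)%E ->
  0 <= C -> 0 <= N ->
  (\int[lebesgue_measure]_(t in `]b, +oo[) (e t * ((t `^ a)^-1)%:E) <= D%:E)%E ->
  (forall t, b < t -> B t = ((C * N)%:E * (e t * ((t `^ a)^-1)%:E))%E) ->
  (\int[lebesgue_measure]_(t in `]b, +oo[) B t <= (C * N * D)%:E)%E.
Proof.
move=> nde e0 C0 N0 eD BE.
have -> : (\int[lebesgue_measure]_(t in `]b, +oo[) B t =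
    \int[lebesgue_measure]_(t in `]b, +oo[)
      ((C * N)%:E * (e t * ((t `^ a)^-1)%:E)))%E.
  by apply: eq_integral => t; rewrite inE/= in_itv/= andbT; exact: BE.
rewrite ge0_integralZl//; last 3 first.
- exact: measurable_weight.
- by move=> t _; rewrite mule_ge0// lee_fin invr_ge0 powR_ge0.
- by rewrite lee_fin mulr_ge0.
by rewrite [leRHS]EFinM; apply: lee_wpmul2l => //; rewrite lee_fin mulr_ge0.
Qed.

Let mellipsoid t := measurable_ellipsoid hrho x0 t.

(** Here the far part is bounded uniformly on E(x0, r), and integration only contributes the volume
    v r^gamma. *)
Lemma far_part_le_conj : 1 < p -> (hoelder_conjugate s <= p%:E)%E ->
  far_part_estimate 0.
Proof.
move=> p1' hc; have [v v0 Hv] := lebesgue_ellipsoid hrho.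
have [C C0 HC] := omega_hoelder hrho s1 hOmega hOmega0 k1 rho_triangle x0 p1 p1' hc.
exists (gamma * C * v `^ p^-1); first by rewrite !mulr_gt0// powR_gt0.
move=> F N e r D; rewrite (subr0 (gamma / p)) (mul0r p) (subr0 gamma).
move=> mF F0 N0 nde e0 FN r0 D0 eD.
have R0 : 0 < 2 * k * r by rewrite !mulr_gt0.
have rR : r <= 2 * k * r.
  by rewrite -[leLHS]mul1r ler_pM2r//; move: k1; lra.
have far x : rho (x0 - x) < r -> (far_part F r x <= (gamma * (C * N * D))%:E)%E.
  move=> xr.
  have mh : measurable_fun setT (fun y => `|Omega (x - y)| * F y).
    by apply: measurable_funM => //; exact: measurable_omega_subr hOmega x.
  have h0 y : 0 <= `|Omega (x - y)| * F y by rewrite mulr_ge0.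
  apply: le_trans (tail_integral_le (B := fun t => ((C * t `^ (gamma - gamma / p))%:E *
    (N%:E * e t))%E) (measurable_rho_sub hrho x0) mh h0 g0 R0 _) _.
    move=> t Rt; have rt : r <= t by apply: le_trans rR (ltW Rt).
    apply: le_trans (HC F x r t mF F0 r0 rt xr) _.
    apply: lee_wpmul2l; first by rewrite lee_fin mulr_ge0 ?powR_ge0// ltW.
    exact/FN/(lt_le_trans r0).
  rewrite [leRHS]EFinM; apply: lee_wpmul2l; first by rewrite lee_fin ltW.
  apply: (integral_weight_le nde e0 (ltW C0) (ltW N0) eD) => t Rt.
  have t0 : 0 < t := lt_trans R0 Rt.
  rewrite (muleC (e t)) !muleA -!EFinM; congr (_%:E * _)%E.
  have -> : (t `^ (gamma / p + 1))^-1 = t `^ (- gamma - 1) * t `^ (gamma - gamma / p).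
    rewrite -powRN -powRD; last by rewrite (gt_eqF t0) implybT.
    by congr (_ `^ _); ring.
  by ring.
have K0 : 0 <= gamma * (C * N * D) by rewrite !mulr_ge0// ltW.
apply: (@le_trans _ _ (\int[mu]_(x in ellipsoid rho x0 r)
    (cst ((gamma * (C * N * D)) `^ p)%:E x))%E).
  apply: ge0_le_integral_nonmeasurable => x xr; first exact: poweR_ge0.
  rewrite /= -poweR_EFin; apply: gt0_ler_poweR.
  - exact: ltW.
  - by rewrite in_itv/= leey andbT integral_ge0// => y _; rewrite lee_fin !mulr_ge0// powR_ge0.
  - by rewrite in_itv/= leey lee_fin K0.
  - exact: far.
rewrite integral_cst// [X in (_ * X <= _)%E](_ : _ = (v * r `^ gamma)%:E); last exact: Hv.
rewrite -EFinM lee_fin.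
rewrite (_ : gamma * C * v `^ p^-1 * N * D = gamma * (C * N * D) * v `^ p^-1); last by ring.
rewrite (powRM _ K0 (powR_ge0 _ _)) -powRrM mulVf ?gt_eqF// powRr1 ?(ltW v0)//.
by rewrite -[leRHS]mulrA.
Qed.

(** The power mean on an ellipsoid of volume v t^gamma, which treats p = 1 together with p > 1. *)
Lemma local_L1_le : exists2 c : R, 0 < c & forall F t,
  measurable_fun setT F -> (forall y, 0 <= F y) -> 0 < t ->
  (\int[mu]_(y in ellipsoid rho x0 t) (F y)%:E <=
    (c * t `^ (gamma - gamma / p))%:E * Lp_norm p (F \_ (ellipsoid rho x0 t)))%E.
Proof.
have [v v0 Hv] := lebesgue_ellipsoid hrho.
exists (2 * v `^ (1 - p^-1)); first by rewrite mulr_gt0// powR_gt0.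
move=> F t mF F0 t0; have vt0 : 0 < v * t `^ gamma by rewrite mulr_gt0// powR_gt0.
have c0 : 0 <= 2 * v `^ (1 - p^-1) * t `^ (gamma - gamma / p).
  by rewrite !mulr_ge0 ?powR_ge0.
have wm : (\int[mu]_x (\1_(ellipsoid rho x0 t) x)%:E <= (v * t `^ gamma)%:E)%E.
  rewrite integral_indic// setIT le_eqVlt; apply/orP; left; apply/eqP; exact: Hv.
have := @power_mean R _ _ mu F \1_(ellipsoid rho x0 t) p (v * t `^ gamma) p1 vt0
  mF (measurable_indic (mellipsoid t)) F0 (fun x => ler0n _ _) wm.
have rw (G : 'cV[R]_n -> R) : (\int[mu]_(x in ellipsoid rho x0 t) (G x)%:E =
    \int[mu]_x (G x * \1_(ellipsoid rho x0 t) x)%:E)%E.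
  rewrite integral_mkcond; apply: eq_integral => x _.
  by rewrite patchE indicE; case: ifP; rewrite ?mulr1 ?mulr0.
rewrite -!rw => H.
apply: (poweR_le_inv p0).
- by apply: integral_ge0 => y _; rewrite lee_fin.
- by apply: mule_ge0; [rewrite lee_fin|exact: Lnorm_ge0].
apply: le_trans H _; rewrite poweRM ?lee_fin ?Lnorm_ge0//.
rewrite poweR_Lnorm ?gt_eqF// poweR_EFin; apply: lee_pmul.
- by rewrite lee_fin mulr_ge0 ?powR_ge0.
- by apply: integral_ge0 => y _; rewrite lee_fin powR_ge0.
- rewrite lee_fin le_eqVlt; apply/orP; left; apply/eqP.
  rewrite (powRM _ (mulr_ge0 (ler0n R 2) (powR_ge0 v (1 - p^-1))) (powR_ge0 _ _)).
  rewrite (powRM _ (ler0n R 2) (powR_ge0 _ _)) (powRM _ (ltW v0) (powR_ge0 _ _)).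
  rewrite -!powRrM mulrA; congr (_ * _ `^ _ * _ `^ _); field; rewrite gt_eqF//.
- rewrite [leLHS]integral_mkcond; apply: ge0_le_integral_nonmeasurable => y _.
    by rewrite patchE; case: ifP => // _; rewrite lee_fin powR_ge0.
  rewrite /= !patchE; case: ifP => _; first by rewrite ger0_norm.
  by rewrite lee_fin powR_ge0.
Qed.

(** The exponent theta makes the powers of [rho] cancel: the integral of |Omega(x - y)|^p over E(x0,
    r) grows like rho(x0 - y)^(theta p), which the factor rho^(- theta) of [u], raised to p,
    absorbs. Only the mass of [w] is left, bounded by [m]. *)
Lemma far_part_le_power : (p%:E < s)%E -> far_part_estimate theta.
Proof.
move=> ps; have [v v0 Hv] := lebesgue_ellipsoid hrho.
have [K K0 HK] := omega_translate_power_le hrho s1 hOmega hOmega0 k1 rho_triangle x0 p1 ps.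
(* Since s > 1, gamma - theta is a legitimate exponent for the tail formula. *)
have a0 : 0 < gamma - theta.
  rewrite -{1}(mulr1 gamma) -mulrBr mulr_gt0// subr_gt0.
  move: s1; case: (s) => [sg| |//] sg1; last by rewrite invey.
  have sg1' : 1 < sg by rewrite -lte_fin.
  by rewrite inver gt_eqF ?(lt_trans _ sg1')//= invf_lt1// (lt_trans _ sg1').
have [c1 c10 Hc1] := local_L1_le.
exists (2 * K `^ p^-1 * ((gamma - theta) * c1)).
  by rewrite !mulr_gt0// powR_gt0.
move=> F N e r D mF F0 N0 nde e0 FN r0 D0 eD.
have R0 : 0 < 2 * k * r by rewrite !mulr_gt0.
pose far_set : set 'cV[R]_n := [set y | (2 * k * r <= rho (x0 - y))%R].
have mfar : measurable far_set by exact: measurable_rho_ge hrho x0 _.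
pose w y : R := F y * rho (x0 - y) `^ (- (gamma - theta)) * \1_far_set y.
pose u x y : R := `|Omega (x - y)| * rho (x0 - y) `^ (- theta).
pose m : R := (gamma - theta) * (c1 * N * D).
have m0 : 0 < m by rewrite !mulr_gt0.
have w0 y : 0 <= w y by rewrite !mulr_ge0// powR_ge0.
have u0 x y : 0 <= u x y by rewrite !mulr_ge0// powR_ge0.
have wm : (\int[mu]_y (w y)%:E <= m%:E)%E.
  rewrite (_ : (\int[mu]_y (w y)%:E)%E =
      (\int[mu]_(y in far_set) (F y * rho (x0 - y) `^ (- (gamma - theta)))%:E)%E); last first.
    rewrite [RHS]integral_mkcond; apply: eq_integral => y _.
    by rewrite patchE /w indicE; case: ifP; rewrite ?mulr1 ?mulr0.
  apply: le_trans (tail_integral_le (B := fun t => ((c1 * t `^ (gamma - gamma / p))%:E *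
    (N%:E * e t))%E) (measurable_rho_sub hrho x0) mF F0 a0 R0 _) _.
    move=> t Rt; have t0 := lt_trans R0 Rt; apply: le_trans (Hc1 F t mF F0 t0) _.
    apply: lee_wpmul2l; first by rewrite lee_fin mulr_ge0 ?powR_ge0// ltW.
    exact: FN.
  rewrite /m [leRHS]EFinM; apply: lee_wpmul2l; first by rewrite lee_fin ltW.
  apply: (integral_weight_le nde e0 (ltW c10) (ltW N0) eD) => t Rt.
  have t0 : 0 < t := lt_trans R0 Rt.
  rewrite (muleC (e t)) !muleA -!EFinM; congr (_%:E * _)%E.
  have -> : (t `^ (gamma / p - theta + 1))^-1 =
      t `^ (- (gamma - theta) - 1) * t `^ (gamma - gamma / p).
    rewrite -powRN -powRD; last by rewrite (gt_eqF t0) implybT.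
    by congr (_ `^ _); ring.
  by ring.
have mw : measurable_fun setT w.
  apply: measurable_funM; last exact: measurable_indic.
  apply: measurable_funM => //; apply: (measurableT_comp (measurable_powR _)).
  exact: (measurable_rho_sub hrho x0).
have mrr : measurable_fun setT (fun y => rho (x0 - y) `^ (- theta)).
  apply: (measurableT_comp (measurable_powR _)); exact: (measurable_rho_sub hrho x0).
have mu2 : measurable_fun setT (fun z : 'cV[R]_n * 'cV[R]_n => u z.1 z.2).
  apply: measurable_funM; last exact: (measurableT_comp mrr measurable_snd).
  exact: measurable_omega_sub hOmega.
have mu1 x : measurable_fun setT (u x).
  exact: (measurableT_comp mu2 (measurable_pair1 x)).
have Hpow x : (far_part F r x `^ p <=
    (2 `^ p * m `^ (p - 1))%:E * \int[mu]_y (u x y `^ p * w y)%:E)%E.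
  rewrite (_ : far_part F r x = \int[mu]_y (u x y * w y)%:E)%E.
    exact: (power_mean p1 m0 (mu1 x) mw (u0 x) w0 wm).
  rewrite /far_part [LHS]integral_mkcond; apply: eq_integral => y _.
  rewrite patchE /w indicE -/far_set; case: ifPn => yR; last by rewrite !mulr0.
  rewrite mulr1 /u; congr EFin.
  have y0 : 0 < rho (x0 - y) by apply: lt_le_trans R0 _; exact: (set_mem yR).
  have -> : rho (x0 - y) `^ (- gamma) =
      rho (x0 - y) `^ (- theta) * rho (x0 - y) `^ (- (gamma - theta)).
    rewrite -powRD; last by rewrite (gt_eqF y0) implybT.
    by congr (_ `^ _); ring.
  by ring.
pose f (z : 'cV[R]_n * 'cV[R]_n) : \bar R :=
  (u z.1 z.2 `^ p * w z.2 * \1_(ellipsoid rho x0 r) z.1)%:E.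
have mupw : measurable_fun setT
    (fun z : 'cV[R]_n * 'cV[R]_n => (u z.1 z.2 `^ p * w z.2)%:E).
  apply/measurable_EFinP; apply: measurable_funM.
    exact: (measurableT_comp (measurable_powR _) mu2).
  exact: (measurableT_comp mw measurable_snd).
have mf : measurable_fun setT f.
  apply/measurable_EFinP; apply: measurable_funM; first exact/measurable_EFinP.
  exact: (measurableT_comp (measurable_indic (mellipsoid r)) measurable_fst).
have f0 z : (0 <= f z)%E by rewrite lee_fin !mulr_ge0// powR_ge0.
have tonelli : (\int[mu]_(x in ellipsoid rho x0 r) \int[mu]_y (u x y `^ p * w y)%:E <=
    (K * r `^ (gamma - theta * p) * m)%:E)%E.
  rewrite (_ : (\int[mu]_(x in ellipsoid rho x0 r) \int[mu]_y (u x y `^ p * w y)%:E)%E =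
      (\int[mu]_x \int[mu]_y f (x, y))%E); last first.
    rewrite [LHS]integral_mkcond; apply: eq_integral => x _; rewrite patchE.
    rewrite /f/= indicE; case: ifP => _; first by under [RHS]eq_integral do rewrite mulr1.
    by under [RHS]eq_integral do rewrite mulr0; rewrite integral0.
  rewrite (fubini_tonelli f mf f0).
  apply: (@le_trans _ _ (\int[mu]_y ((K * r `^ (gamma - theta * p))%:E * (w y)%:E))%E).
    apply: ge0_le_integral_nonmeasurable => y _; first by apply: integral_ge0.
    rewrite (_ : (\int[mu]_x f (x, y))%E = ((w y * rho (x0 - y) `^ (- theta * p))%:E *
        \int[mu]_(x in ellipsoid rho x0 r) (`|Omega (x - y)| `^ p)%:E)%E); last first.
      rewrite [in RHS]integral_mkcond -ge0_integralZl//; last 3 first.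
      - apply/(measurable_restrictT _ (mellipsoid r))/measurable_EFinP.
        apply: measurable_funS measurableT _ _ => //.
        exact: (measurableT_comp (measurable_powR p) (measurable_omega_subl hOmega y)).
      - by move=> x _; rewrite patchE; case: ifP => // _; rewrite lee_fin powR_ge0.
      - by rewrite lee_fin mulr_ge0 ?powR_ge0.
      apply: eq_integral => x _; rewrite patchE /f /= indicE.
      case: ifP => _; last by rewrite mulr0 mule0.
      rewrite mulr1 -EFinM /u powRM ?powR_ge0// -powRrM; congr EFin; ring.
    have [yR|yR] := boolP (2 * k * r <= rho (x0 - y)); last first.
      by rewrite /w indicE memNset ?mulr0 ?mul0r ?mul0e ?mule0//; exact/negP.
    have y0 : 0 < rho (x0 - y) by exact: lt_le_trans yR.
    apply: le_trans (lee_wpmul2l _ (HK y r r0 yR)) _.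
      by rewrite lee_fin mulr_ge0 ?powR_ge0.
    rewrite -!EFinM lee_fin mulNr powRN le_eqVlt; apply/orP; left; apply/eqP.
    by field; rewrite gt_eqF// powR_gt0.
  rewrite ge0_integralZl//; last 3 first.
  - exact/measurable_EFinP.
  - by move=> y _; rewrite lee_fin.
  - by rewrite lee_fin mulr_ge0 ?powR_ge0// ltW.
  rewrite [leRHS]EFinM; apply: lee_wpmul2l => //.
  by rewrite lee_fin mulr_ge0 ?powR_ge0// ltW.
have c0 : 0 <= 2 `^ p * m `^ (p - 1) by rewrite mulr_ge0 ?powR_ge0.
apply: (@le_trans _ _ (\int[mu]_(x in ellipsoid rho x0 r)
    ((2 `^ p * m `^ (p - 1))%:E * \int[mu]_y (u x y `^ p * w y)%:E))%E).
  apply: ge0_le_integral_nonmeasurable => x xr; first exact: poweR_ge0.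
  exact: Hpow.
rewrite ge0_integralZl//; last 2 first.
- apply: measurable_funS (measurable_fun_fubini_tonelli_F _ mupw _) => // z.
  by rewrite lee_fin mulr_ge0// powR_ge0.
- by move=> x _; apply: integral_ge0 => y _; rewrite lee_fin mulr_ge0// powR_ge0.
apply: le_trans (lee_wpmul2l _ tonelli) _; first by rewrite lee_fin.
rewrite -EFinM lee_fin le_eqVlt; apply/orP; left; apply/eqP.
rewrite (_ : 2 * K `^ p^-1 * ((gamma - theta) * c1) * N * D = 2 * (K `^ p^-1 * m)); last first.
  by rewrite /m; ring.
have Km : 0 <= K `^ p^-1 * m by rewrite mulr_ge0 ?powR_ge0// ltW.
rewrite (powRM _ (ler0n R 2) Km) (powRM _ (powR_ge0 _ _) (ltW m0)) -powRrM.
rewrite mulVf ?gt_eqF// powRr1 ?(ltW K0)// -(mulr_powRB1 (ltW m0) p0).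
by ring.
Qed.

End far_part_bounds.

(** * Reduction of the operator to its near and far parts *)

Section bounded_sets.
Context {R : realType} {n : nat}.
Implicit Types (A K : set 'cV[R]_n).

Lemma mx_norm_tr_le m1 m2 (x : 'M[R]_(m1, m2)) : `|x^T| <= `|x|.
Proof.
rewrite /Num.norm/= !mx_normrE; apply/bigmax_leP; split.
  by apply: bigmax_ge_id.
by move=> -[i j] _ /=; rewrite mxE; exact: (le_bigmax _ _ (j, i)).
Qed.

Lemma trmx_continuous m1 m2 : continuous (@trmx R m1 m2).
Proof.
move=> x A [Q Qx QA]; exists (fun i j => Q j i).
  by move=> i j; have := Qx j i; rewrite mxE.
by move=> M QM; apply: QA => i j; rewrite mxE; exact: QM.
Qed.

(** Heine-Borel is carried over from row vectors by transposition, which is continuous and does not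
    increase the norm. *)
Lemma bounded_closed_compact_cV A (M : R) :
  closed A -> (forall x, A x -> `|x| <= M) -> compact A.
Proof.
move=> cA AM.
rewrite (_ : A = trmx @` (@trmx R 1 n @^-1` A)); last first.
  apply/seteqP; split => [x Ax|_ [y Ay <-]//].
  by exists x^T; rewrite ?trmxK//= trmxK.
apply: continuous_compact.
  by apply: continuous_subspaceT => x; exact: trmx_continuous.
apply: bounded_closed_compact.
  exists M; split; [exact: num_real|move=> t Mt y /= /AM yM]; apply: ltW; apply: le_lt_trans Mt.
  by apply: le_trans yM; rewrite -{1}(trmxK y); exact: mx_norm_tr_le.
by apply: closed_comp => // y _; exact: trmx_continuous.
Qed.

Variables (P : 'M[R]_n) (rho : 'cV[R]_n -> R).
Hypothesis hrho : quasi_distance P rho.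

Lemma compact_sub_ellipsoid K x : compact K ->
  exists2 r : R, 0 < r & K `<=` ellipsoid rho x r.
Proof.
move=> cK; have [M [Mreal HM]] := compact_bounded cK.
have {}HM y : K y -> `|y| <= M + 1 by apply: HM; rewrite ltrDl.
have [c1 [c2 [b1 [b2 [c10 c20 b10 b20 rl]]]]] := qd_large hrho.
pose L := n%:R * (`|x| + `|M + 1|).
have L0 : 0 <= L by rewrite mulr_ge0.
exists (2 + c2 * L `^ b2).
  by rewrite ltr_wpDr// mulr_ge0 ?powR_ge0// ltW.
move=> y Ky; rewrite /ellipsoid/=.
have [r1|r1] := leP 1 (rho (x - y)); last first.
  by apply: lt_trans r1 _; rewrite ltr_wpDr ?ltr1n// mulr_ge0 ?powR_ge0// ltW.
have /andP[_ r2] := rl _ r1; apply: le_lt_trans r2 _.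
rewrite ltr_pwDl// ler_wpM2l ?(ltW c20)// ge0_ler_powR ?nnegrE ?enorm_ge0 ?(ltW b20)//.
apply: le_trans (enorm_le_norm _) _; rewrite ler_wpM2l//.
apply: le_trans (ler_normB _ _) _; rewrite lerD2l.
exact: le_trans (HM y Ky) (ler_norm _).
Qed.

Lemma ellipsoid_norm_le x r : exists2 M : R, 0 < M &
  forall y, ellipsoid rho x r y -> `|y| <= M.
Proof.
have [K K0 HK] := quasi_distance_bounded hrho r.
exists (K + `|x|); first by rewrite ltr_pwDl.
move=> y /ltW/HK xy; rewrite -[y](subKr x).
apply: le_trans (ler_normB _ _) _; rewrite addrC lerD2r.
exact: le_trans (norm_le_enorm _) xy.
Qed.

Lemma compact_closure_ellipsoid A x r : A `<=` ellipsoid rho x r -> compact (closure A).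
Proof.
move=> AE; have [M M0 HM] := ellipsoid_norm_le x r.
apply: (@bounded_closed_compact_cV _ M); first exact: closed_closure.
have cM : closed [set y : 'cV[R]_n | `|y| <= M].
  rewrite (_ : [set y | _] = (@Num.norm R _) @^-1` [set t | t <= M]) //.
  by apply: closed_comp; [move=> y _; exact: norm_continuous|exact: closed_le].
move=> y Ay; suff : closure [set y : 'cV[R]_n | `|y| <= M] y by rewrite -(closure_id _).1.
by apply: closure_subset Ay => z /AE/HM.
Qed.

End bounded_sets.

(** * Norms, Chebyshev's inequality and weak type *)

Section lebesgue_spaces.
Context {R : realType} {n : nat}.
Implicit Types (A D : set 'cV[R]_n) (f g : 'cV[R]_n -> R) (p : R).
Local Notation mu := (lebesgue_rn n).

Lemma LpP p f : Lp p f <-> measurable_fun setT f /\ (Lp_norm p f < +oo)%E.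
Proof.
rewrite /Lp/= inE; split => [/andP[]|[mf nf]]; first by rewrite !inE.
by apply/andP; split; rewrite inE.
Qed.

Lemma Lp_norm_ge0 p f : (0 <= Lp_norm p f)%E.
Proof. exact: Lnorm_ge0. Qed.

Lemma Lp_norm_powE p f : 0 < p ->
  (Lp_norm p f `^ p = \int[mu]_x (`|f x| `^ p)%:E)%E.
Proof. by move=> p0; rewrite /Lp_norm poweR_Lnorm ?gt_eqF. Qed.

Lemma Lp_norm_le p f g : 0 < p -> (forall x, `|f x| <= `|g x|) ->
  (Lp_norm p f <= Lp_norm p g)%E.
Proof.
move=> p0 fg; apply: (poweR_le_inv p0 (Lp_norm_ge0 _ _) (Lp_norm_ge0 _ _)).
rewrite (Lp_norm_powE f p0) (Lp_norm_powE g p0).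
apply: ge0_le_integral_nonmeasurable => x _; rewrite lee_fin ?powR_ge0//.
by rewrite ge0_ler_powR ?nnegrE ?(ltW p0).
Qed.

Lemma normr_patch_le f A x : `|(f \_ A) x| <= `|f x|.
Proof. by rewrite patchE; case: ifP; rewrite ?normr0. Qed.

Lemma measurable_patch f A : measurable A -> measurable_fun setT f ->
  measurable_fun setT (f \_ A).
Proof. by move=> mA mf; apply/(measurable_restrictT _ mA); exact: measurable_funS mf. Qed.

Lemma Lp_patch p f A : 0 < p -> measurable A -> Lp p f -> Lp p (f \_ A).
Proof.
move=> p0 mA /LpP[mf nf]; apply/LpP; split; first exact: measurable_patch.
by apply: le_lt_trans nf; apply: Lp_norm_le => // x; exact: normr_patch_le.
Qed.

Lemma markov_set (A : set 'cV[R]_n) (a : R) (G : 'cV[R]_n -> \bar R) :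
  measurable A -> 0 <= a -> (forall x, A x -> a%:E <= G x)%E ->
  (a%:E * mu A <= \int[mu]_(x in A) G x)%E.
Proof.
move=> mA a0 aG; rewrite -integral_cst//.
by apply: ge0_le_integral_nonmeasurable => x Ax; [rewrite lee_fin|exact: aG].
Qed.

Lemma measurable_gt_norm f t : measurable_fun setT f ->
  measurable [set x | (t < `|f x|)%R].
Proof.
move=> mf; rewrite (_ : [set x | _] = (fun z => `|f z|) @^-1` `]t, +oo[); last first.
  by apply/seteqP; split => z /=; rewrite in_itv/= andbT.
have mnf : measurable_fun setT (fun z => `|f z|) by exact: measurableT_comp.
by rewrite -[X in measurable X]setTI; exact: mnf.
Qed.

Lemma Lp_chebyshev p f t : 0 < p -> 0 < t -> measurable_fun setT f ->
  ((t `^ p)%:E * mu [set x | (t < `|f x|)%R] <= Lp_norm p f `^ p)%E.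
Proof.
move=> p0 t0 mf; rewrite Lp_norm_powE//.
apply: le_trans (markov_set (G := fun x => (`|f x| `^ p)%:E) _ _ _) _.
- exact: measurable_gt_norm.
- exact: powR_ge0.
- move=> x /= /ltW tf; rewrite lee_fin ge0_ler_powR ?nnegrE ?(ltW p0)//.
  exact: ltW.
rewrite [leLHS]integral_mkcond; apply: ge0_le_integral_nonmeasurable => x _;
  by rewrite patchE; case: ifP => // _; rewrite lee_fin powR_ge0.
Qed.

Variables (p : R) (p1 : 1 <= p) (T : ('cV[R]_n -> R) -> ('cV[R]_n -> R)).

(** The common consequence of the strong bound for p > 1 and the weak bound for p = 1, in p-th
    powers. It yields both the almost everywhere bound of T f and the weak Morrey estimate. *)
Definition weak_type := exists2 C : R, 0 < C & forall g, Lp p g ->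
  measurable_fun setT (T g) /\ forall t, 0 < t ->
    ((t `^ p)%:E * mu [set x | (t < `|T g x|)%R] <= (C%:E * Lp_norm p g) `^ p)%E.

Lemma weak_type_bounded :
  (1 < p -> bounded_operator T (Lp p) (Lp_norm p) (Lp p) (Lp_norm p)) ->
  (p = 1 -> bounded_operator T
    (Lp 1) (Lp_norm 1) (weakLp 1) (weak_norm 1 [set: 'cV[R]_n])) -> weak_type.
Proof.
have p0 : 0 < p by exact: lt_le_trans p1.
move=> Tp T1; have := p1; rewrite le_eqVlt => /predU1P[p1'|p1'].
  have [C C0 HC] := T1 (esym p1'); rewrite /weak_type -p1'; exists C => // g /HC.
  move=> [[mTg _] wT]; split => // t t0; rewrite powRr1 ?(ltW t0)// poweRe1; last first.
    by rewrite mule_ge0 ?lee_fin ?Lp_norm_ge0// ltW.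
  apply: le_trans wT; apply: ereal_sup_ubound; exists t => //.
  by rewrite invr1 poweRe1// setTI.
have [C C0 HC] := Tp p1'; exists C => // g /HC[/LpP[mTg _] nT]; split => // t t0.
apply: le_trans (Lp_chebyshev p0 t0 mTg) _.
apply: gt0_ler_poweR => //; first exact: ltW.
- by rewrite in_itv/= leey Lp_norm_ge0.
- by rewrite in_itv/= leey mule_ge0 ?lee_fin ?Lp_norm_ge0// ltW.
Qed.

End lebesgue_spaces.

(** * The size condition on a bounded region away from the centre *)

Section far_bound.
Context {R : realType} {n : nat}.
Variables (P : 'M[R]_n) (rho : 'cV[R]_n -> R).
Hypothesis hrho : quasi_distance P rho.
Implicit Types (x y : 'cV[R]_n) (f g : 'cV[R]_n -> R).
Local Notation mu := (lebesgue_rn n).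
Local Notation gamma := (\tr P).
Variables (s : \bar R) (Omega : 'cV[R]_n -> R).
Hypothesis hOmega : Omega \in Lfun (@sphere_measure R n) s.
Variables (k : R) (k1 : 1 <= k).
Hypothesis rho_triangle :
  forall x y z, rho (x - y) <= k * (rho (x - z) + rho (y - z)).
Variables (x0 : 'cV[R]_n) (p : R) (p1 : 1 <= p).

Let k0 : 0 < k. Proof. exact: lt_le_trans k1. Qed.
Let p0 : 0 < p. Proof. exact: lt_le_trans p1. Qed.
Let g0 : 0 < gamma. Proof. exact: trace_gt0 hrho. Qed.

(** The size condition is stated on L_1; bounded support provides the passage from L_p. *)
Lemma Lp_Lp1 f t : 0 < t -> Lp p f -> (forall y, f y != 0 -> rho (x0 - y) < t) -> Lp 1 f.
Proof.
move=> t0 /LpP[mf nf] ft; apply/LpP; split => //.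
have [c c0 Hc] := local_L1_le hrho x0 p1.
have mF : measurable_fun setT (fun y => `|f y|) by exact: measurableT_comp.
have := Hc _ t mF (fun y => normr_ge0 _) t0.
rewrite /Lp_norm Lnorm1 => H; apply: le_lt_trans (le_trans _ H) _.
  rewrite [leRHS]integral_mkcond.
  apply: ge0_le_integral_nonmeasurable => y _; first by rewrite lee_fin.
  rewrite patchE; case: ifPn => // /negP yt; rewrite lee_fin.
  have [->|fy] := eqVneq (f y) 0; first by rewrite normr0.
  by exfalso; apply: yt; apply/mem_set; exact: ft.
apply: lte_mul_pinfty; rewrite ?lee_fin ?mulr_ge0 ?powR_ge0//; first exact: ltW.
apply: le_lt_trans nf; apply: Lp_norm_le => // y.
by apply: le_trans (normr_patch_le _ _ _) _; rewrite normr_id.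
Qed.

Variable T : ('cV[R]_n -> R) -> ('cV[R]_n -> R).
Variable c0 : R.
Hypothesis c00 : 0 < c0.
Hypothesis Tsize : forall f, Lp 1 f -> compact (supp f) ->
  forall x, ~ supp f x ->
    (`|T f x|%:E <= c0%:E * \int[mu]_y
      (`|Omega (x - y)| / rho (x - y) `^ \tr P * `|f y|)%:E)%E.

(** The bound [t] makes the support compact. The gap 2kr gives rho(x0 - y) <= k r + k rho(x - y)
    with k r <= rho(x0 - y) / 2, hence [half], which replaces rho(x - y) by rho(x0 - y) in the
    kernel at the cost (2k)^gamma. *)
Lemma far_size_bound f r t x (A : set 'cV[R]_n) : 0 < r -> 0 < t ->
  measurable_fun setT f -> Lp p (f \_ A) -> (forall y, A y -> 2 * k * r <= rho (x0 - y) < t) ->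
  rho (x0 - x) < r ->
  (`|T (f \_ A) x|%:E <= (c0 * (2 * k) `^ gamma)%:E *
    far_part P rho Omega k x0 (fun y => `|f y|%R) r x)%E.
Proof.
move=> r0 t0 mf LpA At xr.
have LA y : (f \_ A) y != 0 -> A y.
  by rewrite patchE; case: ifPn => [/set_mem//|_]; rewrite eqxx.
have cs : compact (supp (f \_ A)).
  apply: (compact_closure_ellipsoid hrho (x := x0) (r := t)).
  by move=> y /LA/At/andP[].
have L1 : Lp 1 (f \_ A).
  by apply: (Lp_Lp1 t0 LpA) => y /LA/At/andP[].
have half y : 2 * k * r <= rho (x0 - y) -> rho (x0 - y) <= 2 * k * rho (x - y).
  move=> yr; have := rho_triangle x0 y x; rewrite (qd_sym hrho y x).
  have : k * rho (x0 - x) < k * r by rewrite ltr_pM2l.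
  rewrite mulrDr => H1 H2.
  have := le_trans H2 (lerD (ltW H1) (lexx _)).
  by move: yr; rewrite -2!mulrA; set a := k * r; set b := k * _; lra.
(* As [supp] is a closure, a neighbourhood of [x] has to miss [A]: points y near [x] satisfy rho(x -
   y) < r, whereas [half] gives rho(x - y) >= r on [A]. *)
have xs : ~ supp (f \_ A) x.
  have [d d0 Hd] := quasi_distance_small hrho r0.
  have dn : 0 < d / n.+1%:R by rewrite divr_gt0.
  move=> /(_ _ (nbhsx_ballx x _ dn))[y [/LA Ay]].
  rewrite -ball_normE/= => xy.
  have : rho (x - y) < r.
    apply: Hd; apply: le_lt_trans (enorm_le_norm _) _.
    apply: (@le_lt_trans _ _ (n.+1%:R * `|x - y|)).
      by rewrite ler_wpM2r// ler_nat.
    by rewrite mulrC -ltr_pdivlMr.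
  have /andP[yr _] := At y Ay.
  have := half y yr => H1; apply/negP; rewrite -leNgt.
  by rewrite -(ler_pM2l (_ : 0 < 2 * k)) ?mulr_gt0//; exact: le_trans yr H1.
apply: le_trans (Tsize L1 cs xs) _; rewrite EFinM -muleA.
apply: lee_wpmul2l; first by rewrite lee_fin ltW.
have mOm := measurable_omega_subr hOmega x.
rewrite -[leRHS]ge0_integralZl//; last 4 first.
- exact: measurable_rho_ge hrho x0 _.
- apply/measurable_EFinP; apply: measurable_funM.
    apply: measurable_funM; first exact: measurable_funS mOm.
    by apply: measurableT_comp => //; exact: measurable_funS mf.
  apply: (measurableT_comp (measurable_powR _)).
  exact: measurable_funS (measurable_rho_sub hrho x0).
- by move=> y _; rewrite lee_fin !mulr_ge0// powR_ge0.
- by rewrite lee_fin powR_ge0.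
rewrite [leRHS]integral_mkcond; apply: ge0_le_integral_nonmeasurable => y _.
  by rewrite lee_fin !mulr_ge0// invr_ge0 powR_ge0.
rewrite [leRHS]patchE; case: ifPn => [/set_mem/= yr|/negP ny]; last first.
  have [->|/LA Ay] := eqVneq ((f \_ A) y) 0; first by rewrite normr0 mulr0.
  by exfalso; apply: ny; apply/mem_set => /=; have /andP[] := At y Ay.
have R0 : 0 < 2 * k * r by rewrite !mulr_gt0.
have y0 : 0 < rho (x0 - y) by exact: lt_le_trans yr.
have xy0 : 0 < rho (x - y).
  by have := lt_le_trans y0 (half y yr); rewrite pmulr_rgt0// mulr_gt0.
have k20 : 0 < 2 * k by rewrite mulr_gt0.
rewrite -EFinM lee_fin mulrAC [leRHS]mulrCA; apply: ler_pM => //.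
- by rewrite invr_ge0 powR_ge0.
- by rewrite ler_wpM2l//; exact: normr_patch_le.
rewrite powRN ler_pdivlMr ?powR_gt0// mulrC ler_pdivrMr ?powR_gt0//.
rewrite -powRM ?(ltW k20) ?(ltW xy0)// ge0_ler_powR ?nnegrE ?(ltW g0) ?(ltW y0)//.
  by rewrite mulr_ge0 ?ltW.
exact: half.
Qed.
End far_bound.

(** * Almost everywhere bound of T f by the near and far parts *)

Section pointwise_bound.
Context {R : realType} {n : nat}.
Variables (P : 'M[R]_n) (rho : 'cV[R]_n -> R).
Hypothesis hrho : quasi_distance P rho.
Implicit Types (x y : 'cV[R]_n) (f g : 'cV[R]_n -> R).
Local Notation mu := (lebesgue_rn n).
Local Notation gamma := (\tr P).
Variables (s : \bar R) (Omega : 'cV[R]_n -> R).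
Hypothesis hOmega : Omega \in Lfun (@sphere_measure R n) s.
Variables (k : R) (k1 : 1 <= k).
Hypothesis rho_triangle :
  forall x y z, rho (x - y) <= k * (rho (x - z) + rho (y - z)).
Variables (x0 : 'cV[R]_n) (p : R) (p1 : 1 <= p).
Variable T : ('cV[R]_n -> R) -> ('cV[R]_n -> R).
Hypothesis Tsub : sublinear_on (Lp p) T.
Hypothesis Tweak : weak_type p T.
Variable c0 : R.
Hypothesis c00 : 0 < c0.
Hypothesis Tsize : forall f, Lp 1 f -> compact (supp f) ->
  forall x, ~ supp f x ->
    (`|T f x|%:E <= c0%:E * \int[mu]_y
      (`|Omega (x - y)| / rho (x - y) `^ \tr P * `|f y|)%:E)%E.

Let k0 : 0 < k. Proof. exact: lt_le_trans k1. Qed.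
Let p0 : 0 < p. Proof. exact: lt_le_trans p1. Qed.

Variables (f : 'cV[R]_n -> R) (mf : measurable_fun setT f).
Hypothesis f_loc : forall x t, Lp p (f \_ (ellipsoid rho x t)).
Variables (r : R) (r0 : 0 < r).

Local Notation far x := (far_part P rho Omega k x0 (fun y => `|f y|%R) r x).
Local Notation c := (c0 * (2 * k) `^ gamma).
Local Notation E := (ellipsoid rho x0 (2 * k * r)).
Local Notation B := (ellipsoid rho 0).
Local Notation near_part := (f \_ E).

Let mE x t : measurable (ellipsoid rho x t). Proof. exact: measurable_ellipsoid hrho x t. Qed.

(** From this index on the truncating ellipsoids, centred at 0, contain the near ellipsoid centred
    at [x0]. *)
Let N0 : nat := (Num.truncn (k * (rho (0 - x0) + 2 * k * r))).+1.

Let E_sub_B N : (N0 <= N)%N -> E `<=` B N%:R.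
Proof.
move=> NN y yE; rewrite /ellipsoid/=.
apply: le_lt_trans (rho_triangle 0 y x0) _.
apply: (@lt_le_trans _ _ N0%:R); last by rewrite ler_nat.
apply: le_lt_trans (truncnS_gt _).
rewrite ler_wpM2l ?(ltW k0)// lerD2l (qd_sym hrho); exact: ltW.
Qed.

(** The truncation is the near part plus a function supported in the bounded set B_N \ E, to which
    the size condition applies. The bound obtained is the same for all N. *)
Let truncation_bound N : (N0 <= N)%N -> {ae mu, forall x, rho (x0 - x) < r ->
  (`|T (f \_ (B N%:R)) x|%:E <= `|T near_part x|%:E + c%:E * far x)%E}.
Proof.
move=> NN; pose A := B N%:R `\` E.
have mA : measurable A by apply: measurableD.
have fE : f \_ (B N%:R) = near_part \+ f \_ A.
  apply/funext => y /=; rewrite !patchE /A.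
  have [yE|yE] := pselect (E y).
    rewrite (mem_set yE) (mem_set (E_sub_B NN yE)) memNset ?addr0//.
    by move=> -[_]; exact.
  rewrite (memNset yE) add0r; have [yB|yB] := pselect (B N%:R y).
    by rewrite !mem_set.
  by rewrite !memNset// => -[].
have LA : Lp p (f \_ A).
  apply/LpP; split; first exact: measurable_patch.
  have /LpP[_] := f_loc 0 N%:R; apply: le_lt_trans; apply: Lp_norm_le => // y.
  rewrite /A !patchE; have [yA|yA] := pselect ((B N%:R `\` E) y).
    by rewrite (mem_set yA) mem_set//; case: yA.
  by rewrite (memNset yA) normr0.
have [t t0 At] : exists2 t, 0 < t & forall y, A y -> 2 * k * r <= rho (x0 - y) < t.
  exists (k * (rho (x0 - 0) + N%:R) + 1).
    by rewrite ltr_wpDl// mulr_ge0 ?(ltW k0)// addr_ge0// (qd_ge0 hrho).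
  move=> y [By /negP]; rewrite -leNgt => -> /=.
  apply: le_lt_trans (rho_triangle x0 y 0) _; rewrite ltr_pwDr//.
  rewrite ler_wpM2l ?(ltW k0)// lerD2l (qd_sym hrho); exact: ltW.
rewrite fE; have [N' [mN N0' sub]] := Tsub (f_loc x0 (2 * k * r)) LA.
exists N'; split => // x /= /not_implyP[xr nx]; apply: sub => /= H; apply: nx.
apply: (@le_trans _ _ (`|T near_part x| + `|T (f \_ A) x|)%:E); first by rewrite lee_fin.
rewrite EFinD; apply: leeD => //.
exact: (far_size_bound hrho hOmega k1 rho_triangle p1 c00 Tsize r0 t0 mf LA At xr).
Qed.

(** Countably many null sets are merged, so that N may depend on x. *)
Let truncation_bound_all : {ae mu, forall x N, (N0 <= N)%N -> rho (x0 - x) < r ->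
  (`|T (f \_ (B N%:R)) x|%:E <= `|T near_part x|%:E + c%:E * far x)%E}.
Proof.
apply/ae_foralln => N; have [NN|NN] := leqP N0 N.
  have [Z [mZ Z0 sub]] := truncation_bound NN; exists Z; split => // x /= nx.
  by apply: sub => /= H; apply: nx => _; exact: H.
by exists set0; split => // x /= nx; exfalso; exact: nx.
Qed.

Let bound_notin_Lp :
  {ae mu, forall x, (`|T f x|%:E <=
      limn_esup (fun N : nat => `|T (f \_ (ellipsoid rho 0 N%:R)) x|%:E))%E} ->
  {ae mu, forall x, rho (x0 - x) < r ->
    (`|T f x|%:E <= `|T near_part x|%:E + c%:E * far x)%E}.
Proof.
move=> [Z [mZ Z0 Zsub]]; have [Y [mY Y0 Ysub]] := truncation_bound_all.
exists (Z `|` Y); split; first exact: measurableU.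
  exact: null_set_setU.
move=> x /= /not_implyP[xr nx]; apply: contrapT => /not_orP[nZ nY]; apply: nx.
have Hx : (`|T f x|%:E <=
      limn_esup (fun N : nat => `|T (f \_ (ellipsoid rho 0 N%:R)) x|%:E))%E.
  by apply: contrapT => H; apply: nZ; exact: Zsub.
apply: le_trans Hx _; rewrite /limn_esup /limf_esup.
apply: (@le_trans _ _ (ereal_sup
    ((fun N : nat => `|T (f \_ (ellipsoid rho 0 N%:R)) x|%:E) @` [set N | (N0 <= N)%N]))).
  by apply: ereal_inf_lbound; exists [set N | (N0 <= N)%N] => //; exists N0.
apply: ge_ereal_sup => _ [N NN <-].
by apply: contrapT => H; apply: nY; apply: Ysub => /= /(_ N NN xr).
Qed.

(** Dominated convergence: at each point the remainder is eventually 0, since the ellipsoids exhaust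
    the space. *)
Let remainder_cvg0 d : Lp p f -> 0 < d -> exists2 N, (N0 <= N)%N &
  (Lp_norm p (f \_ (~` B N%:R)) `^ p <= d%:E)%E.
Proof.
move=> Lf d0; have /LpP[_ nf] := Lf.
pose F N x : \bar R := (`|(f \_ (~` B N%:R)) x| `^ p)%:E.
have mF (h : 'cV[R]_n -> R) : measurable_fun setT h ->
    measurable_fun setT (fun x => (`|h x| `^ p)%:E : \bar R).
  by move=> mh; exact: (measurableT_comp (measurable_normr_powR p) mh).
have ig : mu.-integrable setT (fun x => (`|f x| `^ p)%:E).
  apply/integrableP; split; first exact: mF.
  under eq_integral do rewrite gee0_abs ?lee_fin ?powR_ge0//.
  by rewrite -Lp_norm_powE//; apply: poweR_lty => //; exact: Lp_norm_ge0.
have mFN N : measurable_fun setT (F N).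
  by apply: mF; apply: measurable_patch => //; exact: measurableC.
have FN0 : {ae mu, forall x, setT x -> F ^~ x @ \oo --> (cst 0%E : 'cV[R]_n -> \bar R) x}.
  apply: aeW => x _; apply: cvg_near_cst; exists (Num.truncn (rho (0 - x))).+1 => // N /= NN.
  rewrite /F patchE memNset; last first.
    by apply; rewrite /ellipsoid/=; apply: lt_le_trans (truncnS_gt _) _; rewrite ler_nat.
  by rewrite normr0 powR0// gt_eqF.
have FNf : {ae mu, forall x N, setT x -> (`|F N x| <= (`|f x| `^ p)%:E)%E}.
  apply: aeW => x N _; rewrite gee0_abs ?lee_fin ?powR_ge0//.
  by rewrite ge0_ler_powR ?nnegrE ?(ltW p0)//; exact: normr_patch_le.
have [_ _ ] := dominated_convergence measurableT mFN (measurable_cst _) FN0 ig FNf.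
rewrite integral0 => H.
have /H[M _ HM] : nbhs 0%E [set y : \bar R | (y < d%:E)%E].
  by apply: open_ereal_lt'; rewrite lte_fin.
exists (maxn N0 M); first exact: leq_maxl.
rewrite Lp_norm_powE//; apply: ltW; exact: (HM _ (leq_maxr _ _)).
Qed.

(** No subsequence is extracted: for each tolerance e, almost every x admits some N, depending on x,
    with |T(f - f_N) x| <= e. This N gives the bound up to e, and e runs through 1/(j+1). *)
Let bound_in_Lp : Lp p f ->
  {ae mu, forall x, rho (x0 - x) < r ->
    (`|T f x|%:E <= `|T near_part x|%:E + c%:E * far x)%E}.
Proof.
move=> Lf; have [C C0 HC] := Tweak.
have LB N : Lp p (f \_ (B N%:R)) by [].
have LBc N : Lp p (f \_ (~` B N%:R)).
  by apply: Lp_patch => //; exact: measurableC.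
have split_ae : {ae mu, forall x N,
    `|T f x| <= `|T (f \_ (B N%:R)) x| + `|T (f \_ (~` B N%:R)) x|}.
  apply/ae_foralln => N; have [Z [mZ Z0 sub]] := Tsub (LB N) (LBc N).
  exists Z; split => //; apply: subset_trans sub; apply: subsetC => x /=.
  rewrite (_ : _ \+ _ = f)//; apply/funext => y /=; rewrite !patchE in_setC.
  by case: ifP; rewrite /= ?addr0 ?add0r.
have [Z [mZ Z0 Zsub]] := split_ae; have [Y [mY Y0 Ysub]] := truncation_bound_all.
have eps_ae (j : nat) : {ae mu, forall x, rho (x0 - x) < r ->
    (`|T f x|%:E <= `|T near_part x|%:E + c%:E * far x + (j.+1%:R^-1)%:E)%E}.
  pose e : R := j.+1%:R^-1; have e0 : 0 < e by rewrite invr_gt0.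
  pose W N := [set x | (e < `|T (f \_ (~` B N%:R)) x|)%R].
  have mW N : measurable (W N) by apply: measurable_gt_norm; case: (HC _ (LBc N)).
  (* The points where every remainder exceeds e; [V] is no larger than any [W N], whose measures
     become arbitrarily small by the weak type inequality. *)
  pose V := \bigcap_(N in [set N | (N0 <= N)%N]) W N.
  have mV : measurable V by apply: bigcap_measurable => //; exists N0 => /=.
  have V0 : mu V = 0%E.
    apply/eqP; rewrite eq_le measure_ge0 andbT; apply/lee_addgt0Pr => d d0.
    rewrite add0e.
    (* A remainder with p-th power at most this number makes e^p mu(W N) <= e^p d. *)
    have q0 : 0 < e `^ p * d / C `^ p by rewrite divr_gt0 ?mulr_gt0 ?powR_gt0.
    have [N NN HN] := remainder_cvg0 Lf q0.
    rewrite -(@lee_pmul2l _ (e `^ p)%:E)//; last by rewrite lte_fin powR_gt0.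
    apply: (@le_trans _ _ ((e `^ p)%:E * mu (W N))%E).
      apply: lee_wpmul2l; first by rewrite lee_fin powR_ge0.
      by apply: le_measure; rewrite ?inE//; exact: bigcap_inf.
    apply: le_trans ((HC _ (LBc N)).2 _ e0) _.
    rewrite poweRM ?lee_fin ?Lp_norm_ge0 ?(ltW C0)// poweR_EFin.
    apply: le_trans (lee_wpmul2l _ HN) _; first by rewrite lee_fin powR_ge0.
    by rewrite -!EFinM lee_fin mulrC divfK// gt_eqF// powR_gt0.
  exists (Z `|` Y `|` V); split.
  - by apply: measurableU => //; exact: measurableU.
  - by rewrite null_set_setU//; [exact: measurableU|exact: null_set_setU].
  move=> x /= /not_implyP[xr nx]; apply: contrapT => /not_orP[/not_orP[nZ nY] nV]; apply: nx.
  have /existsNP[N /not_implyP[NN /negP]] : ~ (forall N, (N0 <= N)%N -> W N x) by [].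
  rewrite -leNgt => We.
  have H1 : `|T f x| <= `|T (f \_ (B N%:R)) x| + `|T (f \_ (~` B N%:R)) x|.
    by apply: contrapT => H; apply: nZ; apply: Zsub => /= /(_ N).
  have H2 : (`|T (f \_ (B N%:R)) x|%:E <= `|T near_part x|%:E + c%:E * far x)%E.
    by apply: contrapT => H; apply: nY; apply: Ysub => /= /(_ N NN xr).
  apply: (@le_trans _ _ (`|T (f \_ (B N%:R)) x| + `|T (f \_ (~` B N%:R)) x|)%:E).
    by rewrite lee_fin.
  by rewrite EFinD; apply: leeD => //; rewrite lee_fin.
have [X [mX X0 Xsub]] : {ae mu, forall x j, rho (x0 - x) < r ->
    (`|T f x|%:E <= `|T near_part x|%:E + c%:E * far x + (j.+1%:R^-1)%:E)%E}.
  exact/ae_foralln.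
exists X; split => //; apply: subset_trans Xsub; apply: subsetC => x /= H xr.
apply/lee_addgt0Pr => d d0.
apply: le_trans (H (Num.truncn d^-1) xr) _; apply: leeD2l => //.
rewrite lee_fin invf_ple ?posrE//; apply: ltW; exact: truncnS_gt.
Qed.

Lemma local_pointwise_bound :
  (~ Lp p f -> {ae mu, forall x, (`|T f x|%:E <=
      limn_esup (fun N : nat => `|T (f \_ (ellipsoid rho 0 N%:R)) x|%:E))%E}) ->
  {ae mu, forall x, rho (x0 - x) < r ->
    (`|T f x|%:E <= `|T near_part x|%:E + c%:E * far x)%E}.
Proof.
by move=> fext; have [/bound_in_Lp//|/fext/bound_notin_Lp] := pselect (Lp p f).
Qed.

End pointwise_bound.

(** * Boundedness on local Morrey spaces *)

Section morrey_estimates.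
Context {R : realType} {n : nat}.
Variables (P : 'M[R]_n) (rho : 'cV[R]_n -> R).
Implicit Types (x y : 'cV[R]_n) (f g : 'cV[R]_n -> R) (phi : 'cV[R]_n -> R -> R).
Local Notation mu := (lebesgue_rn n).
Local Notation gamma := (\tr P).
Variables (x0 : 'cV[R]_n) (p : R) (p1 : 1 <= p).

Let p0 : 0 < p. Proof. exact: lt_le_trans p1. Qed.

Lemma le_essinf_phiP phi t (y : \bar R) : (y <= essinf_phi P phi p x0 t)%E <->
  {ae lebesgue_measure, forall tau, t < tau ->
     (y <= (phi x0 tau * tau `^ (gamma / p))%:E)%E}.
Proof.
split=> [/ess_infP[Z [mZ Z0 sub]]|[Z [mZ Z0 sub]]].
  exists (Z `&` `]t, +oo[); split => //; first exact: measurableI.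
  move=> tau /= /not_implyP[ttau H]; split; first exact: sub.
  by rewrite /= in_itv/= ttau.
apply/ess_infP; exists (Z `|` ~` `]t, +oo[); split.
- by apply: measurableU => //; exact: measurableC.
- transitivity (lebesgue_measure ((Z `|` ~` `]t, +oo[) `&` `]t, +oo[)) => //.
  rewrite setIUl setICl setU0.
  apply/eqP; rewrite eq_le measure_ge0 andbT -Z0.
  by apply: le_measure; rewrite ?inE//; exact: measurableI.
move=> tau /= H; have [ttau|ttau] := pselect (t < tau).
  by left; apply: sub => /= /(_ ttau).
by right; rewrite /= in_itv/= andbT.
Qed.

Lemma essinf_phi_nondecreasing phi u t : u <= t ->
  (essinf_phi P phi p x0 u <= essinf_phi P phi p x0 t)%E.
Proof.
move=> ut; apply/le_essinf_phiP.
have /le_essinf_phiP[Z [mZ Z0 sub]] := lexx (essinf_phi P phi p x0 u).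
exists Z; split => //; apply: subset_trans sub; apply: subsetC => tau /= H ttau.
by apply: H; exact: le_lt_trans ttau.
Qed.

Lemma essinf_phi_ge0 phi t : positive_measurable phi -> 0 <= t ->
  (0 <= essinf_phi P phi p x0 t)%E.
Proof.
move=> [_ phi0] t0; apply/le_essinf_phiP; apply: aeW => tau ttau.
by rewrite lee_fin mulr_ge0 ?powR_ge0// ltW// phi0// (le_lt_trans t0).
Qed.

Variables (v : R) (v0 : 0 < v).
Hypothesis Hv : forall x r, 0 < r -> mu (ellipsoid rho x r) = (v * r `^ gamma)%:E.

Lemma morrey_weightE phi r : 0 < r -> morrey_weight rho phi p x0 r =
  (phi x0 r * (v `^ p^-1 * r `^ (gamma / p)))^-1.
Proof.
move=> r0; rewrite /morrey_weight Hv//= powRM ?(ltW v0) ?powR_ge0// -powRrM mulrN.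
by rewrite !powRN -!invfM.
Qed.

Lemma LM_norm_le phi f (N r : R) : positive_measurable phi -> 0 < r ->
  (LM_norm rho phi p x0 f <= N%:E)%E ->
  (Lp_norm p (f \_ (ellipsoid rho x0 r)) <=
    (N * v `^ p^-1 * (phi x0 r * r `^ (gamma / p)))%:E)%E.
Proof.
move=> [_ phi0] r0 fN.
have w0 : 0 < phi x0 r * (v `^ p^-1 * r `^ (gamma / p)).
  by rewrite !mulr_gt0 ?powR_gt0// phi0.
have : ((morrey_weight rho phi p x0 r)%:E *
    Lp_norm p (f \_ (ellipsoid rho x0 r)) <= N%:E)%E.
  by apply: le_trans fN; apply: ereal_sup_ubound; exists r.
rewrite morrey_weightE// lee_pdivrMl//; move/le_trans; apply.
by rewrite -EFinM lee_fin le_eqVlt; apply/orP; left; apply/eqP; ring.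
Qed.

Lemma LM_norm_ge0 phi f : positive_measurable phi -> (0 <= LM_norm rho phi p x0 f)%E.
Proof.
move=> [_ phi0]; apply: (@le_trans _ _ ((morrey_weight rho phi p x0 1)%:E *
    Lp_norm p (f \_ (ellipsoid rho x0 1)))%E); last first.
  by apply: ereal_sup_ubound; exists 1 => /=.
rewrite mule_ge0 ?Lp_norm_ge0// lee_fin mulr_ge0 ?powR_ge0//.
by rewrite invr_ge0 ltW// phi0.
Qed.

Variables (phi1 phi2 : 'cV[R]_n -> R -> R).
Hypotheses (hphi1 : positive_measurable phi1) (hphi2 : positive_measurable phi2).

(* The weight is evaluated at max t 0 so that it is nonnegative and monotone on
   the whole line; only t > 0 matters. *)
Local Notation e := (fun t => essinf_phi P phi1 p x0 (Num.max t 0)).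

Let nde u t : u <= t -> (e u <= e t)%E.
Proof.
by move=> ut; apply: essinf_phi_nondecreasing; rewrite ge_max !le_max ut lexx orbT.
Qed.

Let e0 t : (0 <= e t)%E.
Proof. by apply: essinf_phi_ge0 => //; rewrite le_max lexx orbT. Qed.

Let ellipsoid_patch_le f u t : u <= t ->
  (Lp_norm p (f \_ (ellipsoid rho x0 u)) <= Lp_norm p (f \_ (ellipsoid rho x0 t)))%E.
Proof.
move=> ut; apply: Lp_norm_le => // y; rewrite !patchE.
case: ifPn => [/set_mem yu|_]; last by rewrite normr0.
by rewrite mem_set//; exact: lt_le_trans ut.
Qed.

(** The norm over E(x0, t) is at most the norm over E(x0, tau) for each tau > t, which the Morrey
    norm controls through phi_1 tau^(gamma/p). The left side does not involve tau, so the essential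
    infimum may be taken. *)
Lemma LM_local_norm_le f (N : R) : 0 < N ->
  (forall t, Lp p (f \_ (ellipsoid rho x0 t))) ->
  (LM_norm rho phi1 p x0 f <= N%:E)%E ->
  local_norm_le rho x0 p (fun y => `|f y|) (N * v `^ p^-1) e.
Proof.
move=> N0 f_loc fN t t0.
have Nv0 : 0 < N * v `^ p^-1 by rewrite mulr_gt0// powR_gt0.
have -> : Lp_norm p ((fun y => `|f y|) \_ (ellipsoid rho x0 t)) =
    Lp_norm p (f \_ (ellipsoid rho x0 t)).
  by apply/eqP; rewrite eq_le; apply/andP; split; apply: Lp_norm_le => // y;
    rewrite !patchE; case: ifP => _; rewrite ?normr_id ?normr0.
have ffin : Lp_norm p (f \_ (ellipsoid rho x0 t)) \is a fin_num.
  by rewrite ge0_fin_numE ?Lp_norm_ge0//; have /LpP[] := f_loc t.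
rewrite -(fineK ffin) -lee_pdivrMl// (max_idPl (ltW t0)).
apply/le_essinf_phiP; apply: aeW => tau ttau; rewrite lee_pdivrMl// fineK//.
rewrite -EFinM; apply: le_trans (ellipsoid_patch_le f (ltW ttau)) _.
exact: LM_norm_le hphi1 (lt_trans t0 ttau) fN.
Qed.

Variables (theta C0 : R).
Local Notation b := (gamma / p - theta).
Hypotheses (b0 : 0 < b) (C00 : 0 < C0).
Hypothesis hphi : forall r, 0 < r -> (\int[lebesgue_measure]_(t in `]r, +oo[)
  (essinf_phi P phi1 p x0 t * ((t `^ (b + 1))^-1)%:E) <=
    (C0 * phi2 x0 r * r `^ theta)%:E)%E.
Variables (kappa : R) (kappa1 : 1 <= kappa).

Let kappa0 : 0 < kappa. Proof. exact: lt_le_trans kappa1. Qed.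

Let weight0 t : (0 <= e t * ((t `^ (b + 1))^-1)%:E)%E.
Proof. by rewrite mule_ge0// lee_fin invr_ge0 powR_ge0. Qed.

Let tail_weight_le r : 0 < r ->
  (\int[lebesgue_measure]_(t in `](kappa * r)%R, +oo[) (e t * ((t `^ (b + 1))^-1)%:E) <=
    (C0 * phi2 x0 r * r `^ theta)%:E)%E.
Proof.
move=> r0; apply: le_trans (hphi r0).
rewrite [leLHS]integral_mkcond [leRHS]integral_mkcond.
apply: ge0_le_integral_nonmeasurable => t _; first by rewrite patchE; case: ifP.
rewrite patchE; case: ifPn => [|_]; last first.
  rewrite patchE; case: ifP => //; rewrite inE/= in_itv/= andbT => rt.
  rewrite mule_ge0 ?lee_fin ?invr_ge0 ?powR_ge0//.
  by apply: essinf_phi_ge0 => //; exact: ltW (lt_trans r0 rt).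
rewrite inE/= in_itv/= andbT => rt.
have rt' : r < t by apply: le_lt_trans rt; rewrite ler_peMl// ltW.
by rewrite patchE mem_set/= ?in_itv/= ?rt'// (max_idPl (ltW (lt_trans r0 rt'))).
Qed.

(** The constant A = ||f|| over E(x0, kappa r) is integrated against t^(-b-1) over t > kappa r,
    which gives A (kappa r)^(-b) / b since b > 0; there A is at most N v^(1/p) times the weight at
    t, so the integral condition applies. *)
Lemma LM_near_norm_le f (N r : R) : 0 < N -> 0 < r ->
  (forall t, Lp p (f \_ (ellipsoid rho x0 t))) ->
  (LM_norm rho phi1 p x0 f <= N%:E)%E ->
  (Lp_norm p (f \_ (ellipsoid rho x0 (kappa * r))) <=
    (v `^ p^-1 * C0 * b * kappa `^ b * N * (phi2 x0 r * r `^ (gamma / p)))%:E)%E.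
Proof.
move=> N0 r0 f_loc fN; have Rr0 : 0 < kappa * r by rewrite mulr_gt0.
have floc := LM_local_norm_le N0 f_loc fN.
set A := Lp_norm p _.
have Afin : A \is a fin_num.
  by rewrite ge0_fin_numE ?Lp_norm_ge0//; have /LpP[] := f_loc (kappa * r).
have A0 : 0 <= fine A by rewrite fine_ge0 ?Lp_norm_ge0.
have Nv0 : 0 < N * v `^ p^-1 by rewrite mulr_gt0// powR_gt0.
have key : ((fine A)%:E * (((kappa * r) `^ (- b)) / b)%:E <=
    (N * v `^ p^-1)%:E * (C0 * phi2 x0 r * r `^ theta)%:E)%E.
  apply: le_trans (lee_wpmul2l _ (tail_weight_le r0)); last by rewrite lee_fin ltW.
  rewrite -ge0_integralZl//; last 2 first.
  - apply: emeasurable_funM; first exact: ereal_nondecreasing_measurable.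
    rewrite (_ : (fun t => _) = (fun t : R => (t `^ (- (b + 1)))%:E)).
      exact: measurable_powR_pos.
    by apply/funext => t; rewrite powRN.
  - by rewrite lee_fin ltW.
  rewrite -integral_powR_infty// -integral_itv_obnd_cbnd; last exact: measurable_powR_pos.
  rewrite -ge0_integralZl//; last 2 first.
  - exact: measurable_powR_pos.
  - by move=> t _; rewrite lee_fin powR_ge0.
  apply: ge0_le_integral_nonmeasurable => t.
    by move=> _; rewrite mule_ge0// lee_fin ?powR_ge0.
  rewrite /= in_itv/= andbT => rt; rewrite muleA -opprD -powRN.
  apply: lee_wpmul2r; first by rewrite lee_fin powR_ge0.
  rewrite fineK//; apply: le_trans (floc t (lt_trans Rr0 rt)).
  apply: le_trans (ellipsoid_patch_le f (ltW rt)) _.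
  by apply: Lp_norm_le => // y; rewrite !patchE; case: ifP; rewrite ?normr_id ?normr0.
rewrite -(fineK Afin); move: key; rewrite -!EFinM !lee_fin powRN => key.
have q0 : 0 < (kappa * r) `^ b by rewrite powR_gt0.
have {}key : fine A <= N * v `^ p^-1 * (C0 * phi2 x0 r * r `^ theta) * ((kappa * r) `^ b * b).
  by rewrite -ler_pdivrMr ?mulr_gt0// invfM.
apply: le_trans key _; rewrite le_eqVlt; apply/orP; left; apply/eqP.
have -> : r `^ (gamma / p) = r `^ theta * r `^ b.
  by rewrite -powRD ?(gt_eqF r0) ?implybT//; congr (_ `^ _); ring.
by rewrite powRM ?(ltW kappa0) ?(ltW r0)//; ring.
Qed.

Lemma LM_far_part_le Omega k : kappa = 2 * k -> far_part_estimate P rho Omega k x0 p theta ->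
  exists2 C : R, 0 < C & forall f (N r : R), 0 < N -> 0 < r ->
    measurable_fun setT f -> (forall t, Lp p (f \_ (ellipsoid rho x0 t))) ->
    (LM_norm rho phi1 p x0 f <= N%:E)%E ->
    (\int[mu]_(x in ellipsoid rho x0 r)
        far_part P rho Omega k x0 (fun y => `|f y|%R) r x `^ p <=
      ((C * N * (phi2 x0 r * r `^ (gamma / p))) `^ p)%:E)%E.
Proof.
move=> kE [C1 C10 HC1]; exists (C1 * v `^ p^-1 * C0).
  by rewrite !mulr_gt0// powR_gt0.
move=> f N r N0 r0 mf f_loc fN.
have Nv0 : 0 < N * v `^ p^-1 by rewrite mulr_gt0// powR_gt0.
have phi20 : 0 < phi2 x0 r by apply: hphi2.2.
have D0 : 0 < C0 * phi2 x0 r * r `^ theta by rewrite !mulr_gt0 ?powR_gt0.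
have mF : measurable_fun setT (fun y => `|f y|) by exact: measurableT_comp.
have := tail_weight_le r0; rewrite kE => tail.
apply: le_trans (HC1 _ _ e r _ mF (fun y => normr_ge0 _) Nv0 nde e0
  (LM_local_norm_le N0 f_loc fN) r0 D0 tail) _.
rewrite lee_fin le_eqVlt; apply/orP; left; apply/eqP.
have -> : gamma - theta * p = b * p by field; rewrite gt_eqF.
rewrite powRrM -powRM ?powR_ge0//; last by rewrite !mulr_ge0 ?powR_ge0// ltW.
congr (_ `^ _).
have -> : r `^ (gamma / p) = r `^ theta * r `^ b.
  by rewrite -powRD ?(gt_eqF r0) ?implybT//; congr (_ `^ _); ring.
by ring.
Qed.

End morrey_estimates.

Lemma poweR_add_le (R : realType) (a b : \bar R) (p : R) : 0 < p ->
  (0 <= a)%E -> (0 <= b)%E ->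
  ((a + b) `^ p <= (2 `^ p)%:E * (a `^ p + b `^ p))%E.
Proof.
move=> p0; wlog ab : a b / (a <= b)%E.
  move=> H a0 b0; have [ab|/ltW ba] := leP a b; first exact: H.
  by rewrite addeC [in leRHS]addeC; exact: H.
move=> a0 b0; apply: (@le_trans _ _ ((2%:E * b) `^ p)%E).
  apply: gt0_ler_poweR => //.
  - exact: ltW.
  - by rewrite in_itv/= leey adde_ge0.
  - by rewrite in_itv/= leey mule_ge0.
  - by rewrite mule_natl mule2n leeD2r.
rewrite poweRM// poweR_EFin; apply: lee_wpmul2l; first by rewrite lee_fin powR_ge0.
by rewrite leeDr// poweR_ge0.
Qed.

(* The real upper bounds N > 0 of M stand for M so as to cover M = 0. *)
Lemma lee_mul_approx (R : realType) (A M : \bar R) (C : R) : 0 < C ->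
  M \is a fin_num -> (0 <= M)%E ->
  (forall N : R, 0 < N -> (M <= N%:E)%E -> (A <= (C * N)%:E)%E) -> (A <= C%:E * M)%E.
Proof.
move=> C0 Mfin M0 H; apply/lee_addgt0Pr => d d0.
have dC : 0 < d / C by rewrite divr_gt0.
have -> : (C%:E * M + d%:E = (C * (fine M + d / C))%:E)%E.
  by rewrite -{1}(fineK Mfin) -EFinM -EFinD; congr EFin; field; rewrite gt_eqF.
apply: H; first by rewrite ltr_wpDl// fine_ge0.
by rewrite EFinD fineK// leeDl// lee_fin ltW.
Qed.

(** * Strong and weak local Morrey estimates for T *)

Section morrey_boundedness.
Context {R : realType} {n : nat}.
Variables (P : 'M[R]_n) (rho : 'cV[R]_n -> R).
Hypothesis hrho : quasi_distance P rho.
Implicit Types (x y : 'cV[R]_n) (f g F : 'cV[R]_n -> R).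
Local Notation mu := (lebesgue_rn n).
Local Notation gamma := (\tr P).
Variables (s : \bar R) (Omega : 'cV[R]_n -> R).
Hypothesis hOmega : Omega \in Lfun (@sphere_measure R n) s.
Variables (k : R) (k1 : 1 <= k).
Hypothesis rho_triangle :
  forall x y z, rho (x - y) <= k * (rho (x - z) + rho (y - z)).
Variables (x0 : 'cV[R]_n).

Lemma measurable_far_part F r : measurable_fun setT F -> (forall y, 0 <= F y) ->
  measurable_fun setT (far_part P rho Omega k x0 F r).
Proof.
move=> mF F0.
have mfar := measurable_rho_ge hrho x0 (2 * k * r).
pose w y : R := F y * rho (x0 - y) `^ (- gamma) *
  \1_[set y | (2 * k * r <= rho (x0 - y))%R] y.
have mw : measurable_fun setT w.
  apply: measurable_funM; last exact: measurable_indic.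
  apply: measurable_funM => //; apply: (measurableT_comp (measurable_powR _)).
  exact: (measurable_rho_sub hrho x0).
have mh : measurable_fun setT
    (fun z : 'cV[R]_n * 'cV[R]_n => (`|Omega (z.1 - z.2)| * w z.2)%:E).
  apply/measurable_EFinP; apply: measurable_funM; last first.
    exact: (measurableT_comp mw measurable_snd).
  exact: measurable_omega_sub hOmega.
rewrite (_ : far_part P rho Omega k x0 F r =
    (fun x => \int[mu]_y (`|Omega (x - y)| * w y)%:E)%E).
  apply: (measurable_fun_fubini_tonelli_F _ mh) => z.
  by rewrite lee_fin !mulr_ge0// powR_ge0.
apply/funext => x; rewrite /far_part [LHS]integral_mkcond.
apply: eq_integral => y _; rewrite patchE /w indicE.
by case: ifP => _; rewrite ?mulr0// mulr1 mulrA.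
Qed.

Lemma far_part_ge0 F r x : (forall y, 0 <= F y) ->
  (0 <= far_part P rho Omega k x0 F r x)%E.
Proof.
by move=> F0; apply: integral_ge0 => y _; rewrite lee_fin !mulr_ge0// powR_ge0.
Qed.

Variables (p : R) (p1 : 1 <= p).
Variable T : ('cV[R]_n -> R) -> ('cV[R]_n -> R).
Variables (phi1 phi2 : 'cV[R]_n -> R -> R).
Hypotheses (hphi1 : positive_measurable phi1) (hphi2 : positive_measurable phi2).
Hypothesis Tsub : sublinear_on (Lp p) T.
Hypothesis Tweak : weak_type p T.
Variable c0 : R.
Hypothesis c00 : 0 < c0.
Hypothesis Tsize : forall f, Lp 1 f -> compact (supp f) ->
  forall x, ~ supp f x ->
    (`|T f x|%:E <= c0%:E * \int[mu]_y
      (`|Omega (x - y)| / rho (x - y) `^ \tr P * `|f y|)%:E)%E.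
Hypothesis Text : truncation_extension rho p (LM rho phi1 p x0) T.
Variables (v C1 C2 : R) (v0 : 0 < v) (C10 : 0 < C1) (C20 : 0 < C2).
Hypothesis Hv : forall x r, 0 < r -> mu (ellipsoid rho x r) = (v * r `^ gamma)%:E.
Hypothesis near_bound : forall f (N r : R), 0 < N -> 0 < r ->
  (forall t, Lp p (f \_ (ellipsoid rho x0 t))) ->
  (LM_norm rho phi1 p x0 f <= N%:E)%E ->
  (Lp_norm p (f \_ (ellipsoid rho x0 (2 * k * r))) <=
    (C1 * N * (phi2 x0 r * r `^ (gamma / p)))%:E)%E.
Hypothesis far_bound : forall f (N r : R), 0 < N -> 0 < r ->
  measurable_fun setT f -> (forall t, Lp p (f \_ (ellipsoid rho x0 t))) ->
  (LM_norm rho phi1 p x0 f <= N%:E)%E ->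
  (\int[mu]_(x in ellipsoid rho x0 r)
      far_part P rho Omega k x0 (fun y => `|f y|%R) r x `^ p <=
    ((C2 * N * (phi2 x0 r * r `^ (gamma / p))) `^ p)%:E)%E.

Let k0 : 0 < k. Proof. exact: lt_le_trans k1. Qed.
Let p0 : 0 < p. Proof. exact: lt_le_trans p1. Qed.
Local Notation c := (c0 * (2 * k) `^ gamma).
Let cpos : 0 < c. Proof. by rewrite mulr_gt0// powR_gt0// mulr_gt0. Qed.
Let mE x t : measurable (ellipsoid rho x t). Proof. exact: measurable_ellipsoid hrho x t. Qed.
Let phi20 r : 0 < r -> 0 < phi2 x0 r. Proof. exact: hphi2.2. Qed.

Lemma Lp_loc_ellipsoid f x t : Lp_loc p f -> Lp p (f \_ (ellipsoid rho x t)).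
Proof.
move=> [mf fK]; apply/LpP; split; first exact: measurable_patch.
apply: le_lt_trans (fK (closure (ellipsoid rho x t)) _); last first.
  exact: (compact_closure_ellipsoid hrho (x := x) (r := t)).
apply: Lp_norm_le => // y; rewrite !patchE.
case: ifPn => [/set_mem yE|_]; last by rewrite normr0.
by rewrite mem_set//; exact: subset_closure.
Qed.

Lemma LM_image_measurable f : LM rho phi1 p x0 f -> measurable_fun setT (T f).
Proof.
move=> Lf; have [C _ HC] := Tweak.
by have [/HC[]//|nLf] := pselect (Lp p f); have [] := Text Lf nLf.
Qed.

Let pointwise f r : LM rho phi1 p x0 f -> 0 < r ->
  {ae mu, forall x, rho (x0 - x) < r ->
    (`|T f x|%:E <= `|T (f \_ (ellipsoid rho x0 (2 * k * r))) x|%:E +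
      c%:E * far_part P rho Omega k x0 (fun y => `|f y|%R) r x)%E}.
Proof.
move=> Lf r0.
apply: (local_pointwise_bound hrho hOmega k1 rho_triangle x0 p1 Tsub Tweak c00 Tsize
  _ _ r0).
- by case: Lf => -[].
- by move=> x t; apply: Lp_loc_ellipsoid; case: Lf.
- by move=> nLf; have [] := Text Lf nLf.
Qed.


Lemma compact_Lp_norm_le f K : compact K -> (forall r, 0 < r ->
  (Lp_norm p (f \_ (ellipsoid rho x0 r)) < +oo)%E) -> (Lp_norm p (f \_ K) < +oo)%E.
Proof.
move=> cK H; have [r r0 KE] := compact_sub_ellipsoid hrho x0 cK.
apply: le_lt_trans (H r r0); apply: Lp_norm_le => // y; rewrite !patchE.
case: ifPn => [/set_mem/KE yE|_]; last by rewrite normr0.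
by rewrite mem_set.
Qed.

Let bound_N f (N r : R) : LM rho phi1 p x0 f -> 0 < N -> 0 < r ->
  (LM_norm rho phi1 p x0 f <= N%:E)%E ->
  [/\ (Lp_norm p (f \_ (ellipsoid rho x0 (2 * k * r))) <=
    (C1 * N * (phi2 x0 r * r `^ (gamma / p)))%:E)%E &
  (\int[mu]_(x in ellipsoid rho x0 r)
      far_part P rho Omega k x0 (fun y => `|f y|%R) r x `^ p <=
    ((C2 * N * (phi2 x0 r * r `^ (gamma / p))) `^ p)%:E)%E].
Proof.
move=> [Lf _] N0 r0 fN.
have f_loc t : Lp p (f \_ (ellipsoid rho x0 t)) by exact: Lp_loc_ellipsoid.
by split; [exact: near_bound|apply: far_bound => //; case: Lf].
Qed.

Let weight_bound (a N r : R) (A : \bar R) : 0 < r ->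
  (A <= (a * N * (phi2 x0 r * r `^ (gamma / p)))%:E)%E ->
  ((morrey_weight rho phi2 p x0 r)%:E * A <= (a / v `^ p^-1 * N)%:E)%E.
Proof.
move=> r0 HA; rewrite (morrey_weightE _ _ v0 Hv)//.
have w0 : 0 < phi2 x0 r * (v `^ p^-1 * r `^ (gamma / p)).
  by rewrite !mulr_gt0 ?powR_gt0// phi20.
rewrite lee_pdivrMl//; apply: le_trans HA _.
rewrite -EFinM lee_fin le_eqVlt; apply/orP; left; apply/eqP; field.
by rewrite gt_eqF// powR_gt0.
Qed.

Lemma sublinear_LM_bounded : bounded_operator T (Lp p) (Lp_norm p) (Lp p) (Lp_norm p) ->
  bounded_operator T (LM rho phi1 p x0) (LM_norm rho phi1 p x0)
    (LM rho phi2 p x0) (LM_norm rho phi2 p x0).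
Proof.
move=> [CT CT0 HCT].
(* A common bound for the near constant CT * C1 and the far constant c * C2. In the factor 4 below,
   one 2 comes from (u + w)^p <= 2^p (u^p + w^p), the other from adding two equal terms. *)
pose a := CT * C1 + c * C2.
have a0 : 0 < a by rewrite addr_gt0// mulr_gt0.
have local f (N r : R) : LM rho phi1 p x0 f -> 0 < N -> 0 < r ->
    (LM_norm rho phi1 p x0 f <= N%:E)%E ->
    (Lp_norm p (T f \_ (ellipsoid rho x0 r)) <=
      (4 * a * N * (phi2 x0 r * r `^ (gamma / p)))%:E)%E.
  move=> Lf N0 r0 fN; have [near far] := bound_N Lf N0 r0 fN.
  set E := ellipsoid rho x0 r; have mEr : measurable E by exact: mE.
  set f1 := f \_ _ in near.
  set M := phi2 x0 r * _ in near far *.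
  have M0 : 0 < M by rewrite mulr_gt0 ?powR_gt0// phi20.
  clearbody M.
  have Lf1 : Lp p f1 by apply: Lp_loc_ellipsoid; case: Lf.
  have [/LpP[mTf1 _] nTf1] := HCT _ Lf1.
  have mTf := LM_image_measurable Lf.
  have mf : measurable_fun setT f by case: Lf => -[].
  have mfar := measurable_far_part r (measurableT_comp (@normr_measurable R setT) mf)
    (fun y => normr_ge0 _).
  set G := far_part P rho Omega k x0 _ r in far mfar *.
  have G0 x : (0 <= G x)%E by exact: far_part_ge0.
  have mpow (h : 'cV[R]_n -> R) : measurable_fun setT h ->
      measurable_fun E (fun x => (`|h x| `^ p)%:E : \bar R).
    move=> mh; apply: (measurable_funS measurableT) => //.
    exact: (measurableT_comp (measurable_normr_powR p) mh).
  have mG : measurable_fun E (fun x => (G x `^ p)%E).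
    apply: (measurable_funS measurableT) => //.
    exact: (measurableT_comp (measurable_poweR p) mfar).
  apply: (poweR_le_inv p0 (Lp_norm_ge0 _ _)).
    by rewrite lee_fin !mulr_ge0 ?(ltW a0) ?(ltW N0) ?(ltW M0)//.
  rewrite Lp_norm_powE// (_ : (\int[mu]_x _)%E = (\int[mu]_(x in E) (`|T f x| `^ p)%:E)%E); last first.
    rewrite [RHS]integral_mkcond; apply: eq_integral => x _; rewrite !patchE.
    by case: ifP => // _; rewrite normr0 powR0// gt_eqF.
  apply: (@le_trans _ _ (\int[mu]_(x in E) ((2 `^ p)%:E *
      ((`|T f1 x| `^ p)%:E + (c `^ p)%:E * G x `^ p)))%E).
    apply: ae_ge0_le_integral => //.
    - exact: mpow.
    - move=> x _; rewrite mule_ge0 ?lee_fin ?powR_ge0// adde_ge0 ?lee_fin ?powR_ge0//.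
      by rewrite mule_ge0 ?lee_fin ?powR_ge0// poweR_ge0.
    - apply: emeasurable_funM => //; apply: emeasurable_funD; first exact: mpow.
      exact: emeasurable_funM.
    have [Z [mZ Z0 sub]] := pointwise Lf r0.
    exists Z; split => //; apply: subset_trans sub; apply: subsetC => x /= H /H{}H.
    rewrite -(poweR_EFin c) -poweRM ?lee_fin ?(ltW cpos)//.
    rewrite -(poweR_EFin `|T f1 x|) -(poweR_EFin `|T f x|).
    apply: le_trans (poweR_add_le p0 _ _); rewrite ?mule_ge0 ?lee_fin ?(ltW cpos)//.
    apply: gt0_ler_poweR => //; first exact: ltW.
    - by rewrite in_itv/= leey lee_fin normr_ge0.
    - by rewrite in_itv/= leey adde_ge0 ?mule_ge0 ?lee_fin ?(ltW cpos).
  rewrite ge0_integralZl//; last 2 first.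
  - by apply: emeasurable_funD; [exact: mpow|exact: emeasurable_funM].
  - move=> x _; rewrite adde_ge0 ?lee_fin ?powR_ge0//.
    by rewrite mule_ge0 ?lee_fin ?powR_ge0// poweR_ge0.
  rewrite ge0_integralD//; last 3 first.
  - exact: mpow.
  - by move=> x _; rewrite mule_ge0 ?lee_fin ?powR_ge0// poweR_ge0.
  - exact: emeasurable_funM.
  rewrite ge0_integralZl//; last 2 first.
  - by move=> x _; exact: poweR_ge0.
  - by rewrite lee_fin powR_ge0.
  have aNM : 0 <= a * N * M by rewrite !mulr_ge0 ?(ltW a0) ?(ltW N0) ?(ltW M0).
  have I1 : (\int[mu]_(x in E) (`|T f1 x| `^ p)%:E <= ((a * N * M) `^ p)%:E)%E.
    apply: (@le_trans _ _ (Lp_norm p (T f1) `^ p)%E).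
      rewrite Lp_norm_powE// [leLHS]integral_mkcond.
      apply: ge0_le_integral_nonmeasurable => x _;
        by rewrite patchE; case: ifP => // _; rewrite lee_fin powR_ge0.
    rewrite -poweR_EFin; apply: gt0_ler_poweR; first exact: ltW.
    - by rewrite in_itv/= leey Lp_norm_ge0.
    - by rewrite in_itv/= leey lee_fin aNM.
    apply: le_trans nTf1 _.
    apply: (@le_trans _ _ (CT%:E * (C1 * N * M)%:E)%E).
      by apply: lee_wpmul2l near; rewrite lee_fin ltW.
    rewrite -EFinM lee_fin !mulrA ler_wpM2r ?(ltW M0)// ler_wpM2r ?(ltW N0)//.
    by rewrite lerDl ltW// mulr_gt0.
  have I2 : ((c `^ p)%:E * \int[mu]_(x in E) G x `^ p <= ((a * N * M) `^ p)%:E)%E.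
    apply: le_trans (lee_wpmul2l _ far) _; first by rewrite lee_fin powR_ge0.
    have cNM : 0 <= C2 * N * M by rewrite !mulr_ge0 ?(ltW C20) ?(ltW N0) ?(ltW M0).
    rewrite -EFinM -powRM ?(ltW cpos)// lee_fin ge0_ler_powR ?nnegrE ?(ltW p0)//.
      by rewrite mulr_ge0 ?(ltW cpos).
    rewrite !mulrA ler_wpM2r ?(ltW M0)// ler_wpM2r ?(ltW N0)//.
    by rewrite lerDr ltW// mulr_gt0.
  apply: le_trans (lee_wpmul2l _ (leeD I1 I2)) _; first by rewrite lee_fin powR_ge0.
  rewrite poweR_EFin -EFinD -EFinM lee_fin -mulr2n -(mulr_natl ((a * N * M) `^ p) 2).
  rewrite (_ : 4 * a * N * M = 2 * (2 * (a * N * M))); last by ring.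
  have aNM2 : 0 <= 2 * (a * N * M) by rewrite mulr_ge0.
  rewrite (powRM p (ler0n R 2) aNM2) (powRM p (ler0n R 2) aNM).
  rewrite ler_wpM2l ?powR_ge0// ler_wpM2r ?powR_ge0//.
  by rewrite -[leLHS](powRr1 (ler0n R 2)) ler_powR// ler1n.
pose C := 4 * a / v `^ p^-1.
have C0 : 0 < C by rewrite divr_gt0 ?powR_gt0// mulr_gt0.
have global f (N : R) : LM rho phi1 p x0 f -> 0 < N ->
    (LM_norm rho phi1 p x0 f <= N%:E)%E -> (LM_norm rho phi2 p x0 (T f) <= (C * N)%:E)%E.
  move=> Lf N0 fN; apply: ge_ereal_sup => _ [r r0 <-].
  by apply: weight_bound => //; exact: local.
exists C => // f Lf.
have M0 : (0 <= LM_norm rho phi1 p x0 f)%E by exact: LM_norm_ge0.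
have Mfin : LM_norm rho phi1 p x0 f \is a fin_num by rewrite ge0_fin_numE//; case: Lf.
have fle : (LM_norm rho phi2 p x0 (T f) <= C%:E * LM_norm rho phi1 p x0 f)%E.
  by apply: lee_mul_approx => // N N0; exact: global.
split=> //; split; last first.
  by apply: le_lt_trans fle _; rewrite -(fineK Mfin) -EFinM ltry.
split; first exact: LM_image_measurable.
move=> K cK; apply: compact_Lp_norm_le => // r r0.
have N0 : 0 < fine (LM_norm rho phi1 p x0 f) + 1 by rewrite ltr_wpDl// fine_ge0.
apply: le_lt_trans (local f _ r Lf N0 r0 _) _; last exact: ltry.
by rewrite EFinD fineK// leeDl.
Qed.

(** Inside E(x0, r), where |T f| > t either |T f1| > t / 2 or c G > t / 2, up to a null set. The
    weak type inequality bounds the first set and Chebyshev's inequality for the far part [G] the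
    second. *)
Lemma sublinear_WLM_bounded :
  bounded_operator T (LM rho phi1 p x0) (LM_norm rho phi1 p x0)
    (WLM rho phi2 p x0) (WLM_norm rho phi2 p x0).
Proof.
have [CT CT0 HCT] := Tweak.
pose a := CT * C1 + c * C2.
have a0 : 0 < a by rewrite addr_gt0// mulr_gt0.
have local f (N r : R) : LM rho phi1 p x0 f -> 0 < N -> 0 < r ->
    (LM_norm rho phi1 p x0 f <= N%:E)%E ->
    (weak_norm p (ellipsoid rho x0 r) (T f) <=
      (4 * a * N * (phi2 x0 r * r `^ (gamma / p)))%:E)%E.
  move=> Lf N0 r0 fN; have [near far] := bound_N Lf N0 r0 fN.
  set E := ellipsoid rho x0 r; have mEr : measurable E by exact: mE.
  set f1 := f \_ _ in near.
  set M := phi2 x0 r * _ in near far *.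
  have M0 : 0 < M by rewrite mulr_gt0 ?powR_gt0// phi20.
  clearbody M.
  have Lf1 : Lp p f1 by apply: Lp_loc_ellipsoid; case: Lf.
  have [mTf1 wTf1] := HCT _ Lf1.
  have mTf := LM_image_measurable Lf.
  have mf : measurable_fun setT f by case: Lf => -[].
  have mfar := measurable_far_part r (measurableT_comp (@normr_measurable R setT) mf)
    (fun y => normr_ge0 _).
  have pw := pointwise Lf r0; rewrite -/f1 in pw.
  set G := far_part P rho Omega k x0 _ r in far mfar pw.
  have G0 x : (0 <= G x)%E by exact: far_part_ge0.
  have aNM : 0 <= a * N * M by rewrite !mulr_ge0 ?(ltW a0) ?(ltW N0) ?(ltW M0).
  apply: ge_ereal_sup => _ [t t0 <-].
  have t20 : 0 < t / 2 by rewrite divr_gt0.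
  pose A1 := [set x | (t / 2 < `|T f1 x|)%R].
  pose A2 := E `&` [set x | ((t / 2)%:E < c%:E * G x)%E].
  have mA1 : measurable A1 by exact: measurable_gt_norm.
  have mA2 : measurable A2.
    apply: emeasurable_fun_o_infty => //.
    by apply: (measurable_funS measurableT) => //; exact: emeasurable_funM.
  have mA : measurable (E `&` [set x | (t < `|T f x|)%R]).
    by apply: measurableI => //; exact: measurable_gt_norm.
  have I1 : (((t / 2) `^ p)%:E * mu A1 <= ((a * N * M) `^ p)%:E)%E.
    apply: le_trans (wTf1 _ t20) _.
    rewrite -poweR_EFin; apply: gt0_ler_poweR; first exact: ltW.
    - by rewrite in_itv/= leey mule_ge0 ?lee_fin ?Lp_norm_ge0// ltW.
    - by rewrite in_itv/= leey lee_fin aNM.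
    apply: (@le_trans _ _ (CT%:E * (C1 * N * M)%:E)%E).
      by apply: lee_wpmul2l near; rewrite lee_fin ltW.
    rewrite -EFinM lee_fin !mulrA ler_wpM2r ?(ltW M0)// ler_wpM2r ?(ltW N0)//.
    by rewrite lerDl ltW// mulr_gt0.
  have I2 : (((t / 2) `^ p)%:E * mu A2 <= ((a * N * M) `^ p)%:E)%E.
    apply: (@le_trans _ _ (\int[mu]_(x in E) ((c `^ p)%:E * G x `^ p))%E).
      apply: le_trans (markov_set (G := fun x => ((c `^ p)%:E * G x `^ p)%E) mA2 (powR_ge0 _ _) _) _.
        move=> x [_ /= /ltW tG].
        rewrite -(poweR_EFin c) -poweRM ?lee_fin ?(ltW cpos)// -poweR_EFin.
        apply: gt0_ler_poweR => //; first exact: ltW.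
        - by rewrite in_itv/= leey lee_fin ltW.
        - by rewrite in_itv/= leey mule_ge0 ?lee_fin ?(ltW cpos).
      rewrite [leLHS]integral_mkcond [leRHS]integral_mkcond.
      have cG x : (0 <= (c `^ p)%:E * G x `^ p)%E.
        by rewrite mule_ge0 ?lee_fin ?powR_ge0// poweR_ge0.
      apply: ge0_le_integral_nonmeasurable => x _; rewrite !patchE.
        by case: ifP.
      case: ifPn => [/set_mem[Ex _]|_]; first by rewrite mem_set.
      by case: ifP.
    rewrite ge0_integralZl//; last 3 first.
    - apply: (measurable_funS measurableT) => //.
      exact: (measurableT_comp (measurable_poweR p) mfar).
    - by move=> x _; exact: poweR_ge0.
    - by rewrite lee_fin powR_ge0.
    apply: le_trans (lee_wpmul2l _ far) _; first by rewrite lee_fin powR_ge0.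
    have cNM : 0 <= C2 * N * M by rewrite !mulr_ge0 ?(ltW C20) ?(ltW N0) ?(ltW M0).
    rewrite -EFinM -powRM ?(ltW cpos)// lee_fin ge0_ler_powR ?nnegrE ?(ltW p0)//.
      by rewrite mulr_ge0 ?(ltW cpos).
    rewrite !mulrA ler_wpM2r ?(ltW M0)// ler_wpM2r ?(ltW N0)//.
    by rewrite lerDr ltW// mulr_gt0.
  have AU : (mu (E `&` [set x | (t < `|T f x|)%R]) <= mu A1 + mu A2)%E.
    have [Z [mZ Z0 sub]] := pw.
    apply: (@le_trans _ _ (mu ((A1 `|` A2) `|` Z))).
      apply: le_measure; rewrite ?inE//.
        by apply: measurableU => //; exact: measurableU.
      move=> x [Ex /= tx]; apply: contrapT => /not_orP[/not_orP[n1 n2] nZ].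
      have : (`|T f x|%:E <= `|T f1 x|%:E + c%:E * G x)%E.
        by apply: contrapT => H; apply: nZ; apply: sub => /= /(_ Ex).
      apply/negP; rewrite -ltNge; apply: (@le_lt_trans _ _ t%:E); last by rewrite lte_fin.
      rewrite [in leRHS](splitr t) EFinD; apply: leeD.
        by rewrite lee_fin leNgt; apply/negP.
      by rewrite leNgt; apply/negP => H; apply: n2.
    have mU : measurable (A1 `|` A2) by exact: measurableU.
    apply: le_trans (measureU2 mu mA1 mA2).
    by rewrite le_eqVlt; apply/orP; left; apply/eqP; exact: measureU0 mU mZ Z0.
  apply: (poweR_le_inv p0).
  - by rewrite mule_ge0 ?lee_fin ?(ltW t0)// poweR_ge0.
  - by rewrite lee_fin !mulr_ge0 ?(ltW a0) ?(ltW N0) ?(ltW M0).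
  rewrite poweRM ?lee_fin ?poweR_ge0 ?(ltW t0)// -poweRrM mulVf ?gt_eqF// poweRe1//.
  rewrite poweR_EFin (_ : t = 2 * (t / 2)); last by field.
  rewrite (powRM p (ler0n R 2) (ltW t20)) EFinM -muleA.
  rewrite (_ : 4 * a * N * M = 2 * (2 * (a * N * M))); last by ring.
  have aNM2 : 0 <= 2 * (a * N * M) by rewrite mulr_ge0.
  rewrite poweR_EFin (powRM p (ler0n R 2) aNM2) (powRM p (ler0n R 2) aNM) [leRHS]EFinM.
  apply: lee_wpmul2l; first by rewrite lee_fin powR_ge0.
  rewrite -(_ : t = 2 * (t / 2)); last by field.
  apply: le_trans (lee_wpmul2l _ AU) _; first by rewrite lee_fin powR_ge0.
  rewrite ge0_muleDr//; apply: le_trans (leeD I1 I2) _.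
  rewrite -EFinD lee_fin -mulr2n -(mulr_natl ((a * N * M) `^ p) 2).
  rewrite ler_wpM2r ?powR_ge0//.
  by rewrite -[leLHS](powRr1 (ler0n R 2)) ler_powR// ler1n.
pose C := 4 * a / v `^ p^-1.
have C0 : 0 < C by rewrite divr_gt0 ?powR_gt0// mulr_gt0.
have global f (N : R) : LM rho phi1 p x0 f -> 0 < N ->
    (LM_norm rho phi1 p x0 f <= N%:E)%E -> (WLM_norm rho phi2 p x0 (T f) <= (C * N)%:E)%E.
  move=> Lf N0 fN; apply: ge_ereal_sup => _ [r r0 <-].
  by apply: weight_bound => //; exact: local.
exists C => // f Lf.
have M0 : (0 <= LM_norm rho phi1 p x0 f)%E by exact: LM_norm_ge0.
have Mfin : LM_norm rho phi1 p x0 f \is a fin_num by rewrite ge0_fin_numE//; case: Lf.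
have fle : (WLM_norm rho phi2 p x0 (T f) <= C%:E * LM_norm rho phi1 p x0 f)%E.
  by apply: lee_mul_approx => // N N0; exact: global.
have mTf := LM_image_measurable Lf.
split=> //; split; last first.
  by apply: le_lt_trans fle _; rewrite -(fineK Mfin) -EFinM ltry.
split=> // K cK; have [r r0 KE] := compact_sub_ellipsoid hrho x0 cK.
have N0 : 0 < fine (LM_norm rho phi1 p x0 f) + 1 by rewrite ltr_wpDl// fine_ge0.
apply: (@le_lt_trans _ _ (weak_norm p (ellipsoid rho x0 r) (T f))).
  apply: ge_ereal_sup => _ [t t0 <-].
  apply: (@le_trans _ _ (t%:E *
      mu (ellipsoid rho x0 r `&` [set y | (t < `|T f y|)%R]) `^ p^-1)%E); last first.
    by apply: ereal_sup_ubound; exists t.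
  apply: lee_wpmul2l; first by rewrite lee_fin ltW.
  apply: gt0_ler_poweR.
  - by rewrite invr_ge0 ltW.
  - by rewrite in_itv/= leey measure_ge0.
  - by rewrite in_itv/= leey measure_ge0.
  have mgt := measurable_gt_norm t mTf.
  apply: le_measure; rewrite ?inE; [|exact: measurableI|exact: setSI].
  by apply: measurableI => //; exact: measurable_compact.
apply: le_lt_trans (local f _ r Lf N0 r0 _) _; last exact: ltry.
by rewrite EFinD fineK// leeDl.
Qed.

End morrey_boundedness.

(** * Choice of theta and conclusion *)

Theorem theorem7 (R : realType) (n : nat) (hn : (2 <= n)%N)
  (P : 'M[R]_n) (hP : positive_spectrum P)
  (rho : 'cV[R]_n -> R) (hrho : quasi_distance P rho)
  (x0 : 'cV[R]_n) (p : R) (hp : 1 <= p)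
  (s : \bar R) (hs : (1 < s)%E)
  (Omega : 'cV[R]_n -> R) (hOmega : Omega \in Lfun (@sphere_measure R n) s)
  (hOmega0 : dilation_homogeneous0 P Omega)
  (phi1 phi2 : 'cV[R]_n -> R -> R)
  (hphi1 : positive_measurable phi1) (hphi2 : positive_measurable phi2)
  (T : ('cV[R]_n -> R) -> ('cV[R]_n -> R))
  (hT : sublinear_on (Lp p) T)
  (hTsize : size_condition P rho Omega T)
  (hText : truncation_extension rho p (LM rho phi1 p x0) T)
  (hTp : 1 < p -> bounded_operator T (Lp p) (Lp_norm p) (Lp p) (Lp_norm p))
  (hT1 : p = 1 -> bounded_operator T
    (Lp 1) (Lp_norm 1) (weakLp 1) (weak_norm 1 [set: 'cV[R]_n]))
  (hphi :
    [/\ (hoelder_conjugate s <= p%:E)%E, p <> 1 &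
      exists C : R, forall r : R, 0 < r ->
        (\int[lebesgue_measure]_(t in `]r, +oo[)
            (essinf_phi P phi1 p x0 t * ((t `^ (\tr P / p + 1))^-1)%:E)
          <= (C * phi2 x0 r)%:E)%E]
    \/
    (p%:E < s)%E /\
      exists C : R, forall r : R, 0 < r ->
        (\int[lebesgue_measure]_(t in `]r, +oo[)
            (essinf_phi P phi1 p x0 t *
              ((t `^ (\tr P / p - \tr P * fine (s^-1)%E + 1))^-1)%:E)
          <= (C * phi2 x0 r * r `^ (\tr P * fine (s^-1)%E))%:E)%E) :
  (1 < p -> bounded_operator T
    (LM rho phi1 p x0) (LM_norm rho phi1 p x0)
    (LM rho phi2 p x0) (LM_norm rho phi2 p x0)) /\
  (p = 1 -> bounded_operator T
    (LM rho phi1 1 x0) (LM_norm rho phi1 1 x0)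
    (WLM rho phi2 1 x0) (WLM_norm rho phi2 1 x0)).
Proof.
have p0 : 0 < p by exact: lt_le_trans hp.
have g0 := trace_gt0 hrho.
have [k k1 tri] := quasi_distance_triangle_ge1 hrho.
have [v v0 Hv] := lebesgue_ellipsoid hrho.
have Tweak := weak_type_bounded hp hTp hT1.
have [c0 c00 Tsize] := hTsize.
(* The constants of the integral conditions are arbitrary reals; |C| + 1 is a positive
   substitute. *)
have constP (A : \bar R) (C M : R) : 0 <= M -> (A <= (C * M)%:E)%E ->
    (A <= ((`|C| + 1) * M)%:E)%E.
  move=> M0 /le_trans; apply; rewrite lee_fin ler_wpM2r//.
  by apply: le_trans (ler_norm C) _; rewrite lerDl.
(* The distinction between the two alternatives is confined to this choice. *)
have [theta [C0 [b0 C00 cond est]]] : exists theta C0 : R,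
    [/\ 0 < \tr P / p - theta, 0 < C0,
      forall r, 0 < r -> (\int[lebesgue_measure]_(t in `]r, +oo[)
        (essinf_phi P phi1 p x0 t * ((t `^ (\tr P / p - theta + 1))^-1)%:E) <=
        (C0 * phi2 x0 r * r `^ theta)%:E)%E &
      far_part_estimate P rho Omega k x0 p theta].
  case: hphi => [[sp pn1 [C HC]]|[ps [C HC]]].
    exists 0, (`|C| + 1); split.
    - by rewrite subr0 divr_gt0.
    - by rewrite ltr_wpDl.
    - move=> r r0; rewrite subr0 powRr0 mulr1; apply: constP (HC r r0).
      by apply: ltW; exact: hphi2.2.
    have p1 : 1 < p by rewrite lt_neqAle hp andbT eq_sym; exact/eqP.
    exact: (far_part_le_conj hrho hs hOmega hOmega0 k1 tri x0 hp p1 sp).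
  exists (\tr P * fine (s^-1)%E), (`|C| + 1); split.
  - rewrite -mulrBr mulr_gt0// subr_gt0.
    (* The inequality theta < gamma / p amounts to 1 / s < 1 / p, with 1 / s = 0 for s = +oo. *)
    move: ps; case: (s) => [sr|_|//]; last by rewrite invey invr_gt0.
    rewrite lte_fin => psr; have s0 : 0 < sr by exact: lt_trans psr.
    by rewrite inver gt_eqF//= ltf_pV2.
  - by rewrite ltr_wpDl.
  - move=> r r0; rewrite -mulrA; apply: constP; last by rewrite mulrA; exact: HC.
    by rewrite mulr_ge0 ?powR_ge0// ltW//; exact: hphi2.2.
  exact: (far_part_le_power hrho hs hOmega hOmega0 k1 tri x0 hp ps).
have kappa1 : 1 <= 2 * k by move: k1; lra.
have [C2 C20 far_bound] := LM_far_part_le hp v0 Hv hphi1 hphi2 C00 cond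
  kappa1 erefl est.
have near_bound := LM_near_norm_le hp v0 Hv hphi1 b0 cond kappa1.
have C10 : 0 < v `^ p^-1 * C0 * (\tr P / p - theta) * (2 * k) `^ (\tr P / p - theta).
  by rewrite !mulr_gt0 ?powR_gt0// (lt_le_trans _ kappa1).
split=> [p1|p1].
  exact: (sublinear_LM_bounded hrho hOmega k1 tri hp hphi1 hphi2 hT Tweak c00 Tsize
    hText v0 C10 C20 Hv near_bound far_bound (hTp p1)).
have := sublinear_WLM_bounded hrho hOmega k1 tri hp hphi1 hphi2 hT Tweak c00 Tsize
  hText v0 C10 C20 Hv near_bound far_bound.
by rewrite p1.
Qed.
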